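(* Consider the single sample split estimators $\hat\psi^{\mathrm{INT}}_{k_1,k_2}$, $\hat\psi^{\mathrm{MC}}_{k_1,k_2}$, $\hat\psi^{\mathrm{IF}}_{k_1,k_2}$ of $\psi(\mathbb P)=\mathbb E_{\mathbb P}[\mathrm{Cov}_{\mathbb P}(A,Y\mid X)]$ over $\mathcal P_{(\alpha,\beta)}$ defined in the context, and write $k_{\min}=k_1\wedge k_2$, $k_{\max}=k_1\vee k_2$. If $\frac{\alpha+\beta}2\ge\frac d2$, then (1) $\hat\psi^{\mathrm{INT}}_{k_1,k_2}$ is minimax rate optimal when choosing $n^{\frac d{2\alpha+2\beta}}\lesssim k_{\min}\lesssim\sqrt n$; (2) $\hat\psi^{\mathrm{MC}}_{k_1,k_2}$ is minimax rate optimal when choosing $n^{\frac d{2\alpha+2\beta}}\lesssim k_{\min}\lesssim\sqrt n$ and $k_{\max}\lesssim n$; (3) $\hat\psi^{\mathrm{IF}}_{k_1,k_2}$ is minimax rate optimal when choosing $k_{\min}\lesssim\sqrt n$ and $n^{\frac d{2\alpha+2\beta}}\lesssim k_{\max}\lesssim n$. If $\frac{\alpha+\beta}2<\frac d2$, then (1) $\hat\psi^{\mathrm{INT}}_{k_1,k_2}$ cannot be minimax rate optimal for any choice of $k_1,k_2$; its best rate of estimation of $\psi(\mathbb P)$ is $n^{-\frac{2\alpha+2\beta}{\alpha+\beta+d}}$, which occurs when choosing $k_{\min}\asymp n^{\frac d{\alpha+\beta+d}}$; (2) $\hat\psi^{\mathrm{MC}}_{k_1,k_2}$ cannot be minimax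 rate optimal for any choice of $k_1,k_2$; its best rate of estimation of $\psi(\mathbb P)$ is $n^{-\frac{2\alpha+2\beta}{\alpha+\beta+d}}$, which occurs when choosing $k_{\min}\asymp n^{\frac d{\alpha+\beta+d}}$ and $k_{\max}\lesssim n^{\frac{2d}{\alpha+\beta+d}}$; (3) $\hat\psi^{\mathrm{IF}}_{k_1,k_2}$ is minimax rate optimal when choosing $k_{\min}\lesssim\sqrt n$ and $n^{\frac d{2\alpha+2\beta}}\lesssim k_{\max}\lesssim n$ when $\frac d4\le\frac{\alpha+\beta}2<\frac d2$, and when choosing $k_{\min}\lesssim n^{\frac d{2\alpha+2\beta+d}}$ and $k_{\max}\asymp n^{\frac{2d}{2\alpha+2\beta+d}}$ when $\frac{\alpha+\beta}2<\frac d4$.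
   Context: Notation. $a\vee b=\max(a,b)$, $a\wedge b=\min(a,b)$; integrals are over $[0,1]^d$. For nonnegative sequences, $a_n\lesssim b_n$ means there is a constant $C>0$ with $a_n\le Cb_n$ for all $n\ge n_0$; $a_n\gtrsim b_n$ means $b_n\lesssim a_n$; $a_n\asymp b_n$ means both. Resolutions $k_1,k_2$ are sequences that may depend on $n$. Wavelets. Fix a compactly supported Cohen–Daubechies–Vial type orthonormal wavelet basis $\{\Phi_{J_0m},\Psi^{\iota}_{lm'}: m\in\mathcal Z_{J_0},\,m'\in\mathcal Z_l,\,\iota\in\{0,1\}^d\setminus\{0\},\,l\ge J_0\}$ of $L^2([0,1]^d)$ of regularity $S\ge1$, $S>\alpha\vee\beta$, with $2^{J_0}\ge S$, $|\mathcal Z_l|\asymp 2^{ld}$. For $j\ge J_0$ let $V_j=\mathrm{span}\{\Phi_{jm}:m\in\mathcal Z_j\}$ ($\{\Phi_{jm}\}_m$ the orthonormal scaling functions at level $j$; the $V_j$ are nested). A resolution is a number $k=2^{jd}$, $j\ge J_0$; write $V_k,\Phi_{km},\mathcal Z_k$ for $V_j,\Phi_{jm},\mathcal Z_j$. Standard properties: $|\Phi_{km}|\lesssim\sqrt k$ uniformly with support in a set of Lebesgue measure $O(1/k)$; $V_k$ contains all polynomials of degree at most $S-1$. The projection kernel is $K_{V_k}(x,y)=\sum_{m\in\mathcal Z_k}\Phi_{km}(x)\Phi_{km}(y)$. Hölder ball. $H(\alpha,M)$ is the set of uniformly continuous $h:[0,1]^d\to\mathbb R$ with $2^{J_0(\alpha+d/2)}\max_m|\langle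 h,\Phi_{J_0m}\rangle|+\sup_{l\ge J_0,m\in\mathcal Z_l,\iota}2^{l(\alpha+d/2)}|\langle h,\Psi^\iota_{lm}\rangle|\le M$. Model. $\mathcal P_{(\alpha,\beta)}$ is the set of distributions $\mathbb P$ of $(X,A,Y)\in[0,1]^d\times\mathbb R\times\mathbb R$ with $X\sim\mathrm{Uniform}([0,1]^d)$, $A,Y\in[C_1,C_2]$ a.s., $p(x):=\mathbb E_{\mathbb P}[A\mid X=x]\in H(\alpha,M)$ and $b(x):=\mathbb E_{\mathbb P}[Y\mid X=x]\in H(\beta,M)$, where $C_1,C_2\in\mathbb R$, $\alpha,\beta,M>0$ are fixed known constants. The functional is $\psi(\mathbb P)=\mathbb E_{\mathbb P}[\mathrm{Cov}_{\mathbb P}(A,Y\mid X)]$. Estimators. I.i.d. observations from $\mathbb P$ are split into disjoint subsamples $\mathcal D_1,\mathcal D_2,\dots$, each of size $n$. Put $\hat p^{(j)}_k(x)=\frac1n\sum_{i\in\mathcal D_j}A_iK_{V_k}(X_i,x)$ and $\hat b^{(j)}_k(x)=\frac1n\sum_{i\in\mathcal D_j}Y_iK_{V_k}(X_i,x)$. With single sample splitting: $\hat\psi^{\mathrm{INT}}_{k_1,k_2}=\frac1n\sum_{i\in\mathcal D_2}A_iY_i-\int\hat p^{(1)}_{k_1}(x)\hat b^{(1)}_{k_2}(x)\,dx$; $\hat\psi^{\mathrm{MC}}_{k_1,k_2}=\frac1n\sum_{i\in\mathcal D_2}A_iY_i-\frac1n\sum_{i\in\mathcal D_3}\hat p^{(1)}_{k_1}(X_i)\hat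 b^{(1)}_{k_2}(X_i)$; $\hat\psi^{\mathrm{IF}}_{k_1,k_2}=\frac1n\sum_{i\in\mathcal D_2}(A_i-\hat p^{(1)}_{k_1}(X_i))(Y_i-\hat b^{(1)}_{k_2}(X_i))$. Rates. The (known) minimax rate for squared error over $\mathcal P_{(\alpha,\beta)}$ is $r_n^*=n^{-1}$ if $\frac{\alpha+\beta}2\ge\frac d4$ and $r_n^*=n^{-\frac{4\alpha+4\beta}{2\alpha+2\beta+d}}$ if $\frac{\alpha+\beta}2<\frac d4$. For an estimator $\hat\psi$ with given resolution sequences let $R_n=\sup_{\mathbb P\in\mathcal P_{(\alpha,\beta)}}\mathbb E_{\mathbb P}[(\hat\psi-\psi(\mathbb P))^2]$. The estimator is minimax rate optimal for a choice of resolutions if $R_n\lesssim r_n^*$. Its best rate is $r_n$ if some choice of resolutions gives $R_n\lesssim r_n$ while every choice gives $R_n\gtrsim r_n$; the best rate ''occurs when choosing'' certain resolutions if these give $R_n\lesssim r_n$.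
   Formalization: The claims that INT and MC cannot be optimal and their best rates assume that for some ε>0 there are p∈H(α,M−ε), b∈H(β,M−ε) with values in [C1+ε,C2−ε]; without this they fail, e.g. for C1=C2=0, where the risk is 0. *)

(* Defs.v *)
From HB Require Import structures.
From mathcomp Require Import all_boot all_order all_algebra.
From mathcomp Require Import all_classical all_reals all_analysis.

Set Implicit Arguments.
Unset Strict Implicit.
Unset Printing Implicit Defensive.

Import Order.TTheory GRing.Theory Num.Theory.
Import numFieldNormedType.Exports.

Local Open Scope classical_set_scope.
Local Open Scope ring_scope.

Section iid_sample.
Context {dT : measure_display} {T : measurableType dT} {R : realType}.

Definition tuple_cons n (x : T * n.-tuple T) : n.+1.-tuple T :=
  [the n.+1.-tuple T of x.1 :: x.2].

Lemma measurable_tuple_cons n : measurable_fun setT (@tuple_cons n).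
Proof. by apply: measurable_cons. Qed.

HB.instance Definition _ n := isMeasurableFun.Build _ _ _ _ (@tuple_cons n)
  (@measurable_tuple_cons n).

(* The n-fold product P (x) ... (x) P, i.e. the joint law of an i.i.d. n-sample
   from P. *)
Fixpoint iid (P : probability T R) n : probability (n.-tuple T) R :=
  if n is n'.+1 then distribution (P \x iid P n')%E (@tuple_cons n')
  else dirac [tuple].

End iid_sample.

Section rates.
Context {R : realType}.
Implicit Types u v : nat -> \bar R.

Definition lesssim u v := exists (C : R) (n0 : nat), 0 < C /\
  forall n, (n0 <= n)%N -> (u n <= C%:E * v n)%E.

Definition asymp u v := lesssim u v /\ lesssim v u.

Definition npow (e : R) : nat -> \bar R := fun n => (n%:R `^ e)%:E.

Definition nsqrt : nat -> \bar R := fun n => (Num.sqrt (n%:R : R))%:E.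

End rates.

Section cube.
Context (R : realType) (d : nat).

(* A function on [0,1]^d is represented by a function on R^d, of which only the
   values on unit_cube matter. *)
Definition vec := d.-tuple (measurableTypeR R).

Definition unit_cube : set vec := [set x | forall i, 0 <= tnth x i <= 1].

(* Lebesgue measure on [0,1]^d, as a measure on R^d. *)
Definition unif : probability vec R := iid (uniform_prob (@ltr01 R)) d.

Definition inner (f g : vec -> R) : R :=
  \int[unif]_(x in unit_cube) (f x * g x).

Definition unif_continuous_on_cube (h : vec -> R) :=
  forall e : R, 0 < e -> exists2 r : R, 0 < r &
    forall x y, unit_cube x -> unit_cube y ->
      (forall i, `|tnth x i - tnth y i| < r) -> `|h x - h y| < e.

End cube.

Section wavelets.
Context (R : realType) (d : nat).
Local Notation vec := (vec R d).
Local Notation cube := (@unit_cube R d).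
Local Notation unif := (unif R d).

(* {0,1}^d \ {0} *)
Definition orient := {e : {ffun 'I_d -> bool} | e != [ffun => false]}.

Record wavelet_system := WaveletSystem {
  Zidx : nat -> finType;
  Phi : forall j, Zidx j -> vec -> R;
  Psi : forall l, orient -> Zidx l -> vec -> R }.

Definition localized (C : R) (j : nat) (Z : finType) (f : Z -> vec -> R) :=
  [/\ forall m x, cube x -> `|f m x| <= C * 2 `^ (j%:R * d%:R / 2),
      exists a : Z -> vec, forall m x, cube x -> f m x != 0 ->
        forall i, `|tnth x i - tnth (a m) i| <= C * 2 ^- j
    & forall x, cube x -> (#|[pred m | f m x != 0]|)%:R <= C].

(* Compactly supported orthonormal wavelet basis of L^2([0,1]^d) of
   Cohen-Daubechies-Vial type, regularity S, coarsest level J0. Regularity is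
   only used through the polynomials contained in the V_j, so no smoothness of
   Phi and Psi is required (the Haar basis is allowed for S = 1). Identities
   between elements of L^2 hold almost everywhere. *)
Record cdv_basis (S J0 : nat) (W : wavelet_system) : Prop := CDVBasis {
  Phi_measurable : forall j m, measurable_fun setT (@Phi W j m);
  Psi_measurable : forall l e m, measurable_fun setT (@Psi W l e m);
  Phi_orthonormal : forall j (m m' : Zidx W j), (J0 <= j)%N ->
    inner (Phi m) (Phi m') = (m == m')%:R;
  Psi_orthonormal : forall l e e' (m m' : Zidx W l), (J0 <= l)%N ->
    inner (Psi e m) (Psi e' m') = ((e == e') && (m == m'))%:R;
  Psi_orthogonal_levels : forall l l' e e' (m : Zidx W l) (m' : Zidx W l'),
    (J0 <= l)%N -> (J0 <= l')%N -> l != l' -> inner (Psi e m) (Psi e' m') = 0;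
  Phi_Psi_orthogonal : forall l e (m : Zidx W J0) (m' : Zidx W l),
    (J0 <= l)%N -> inner (Phi m) (Psi e m') = 0;
  (* V_{j+1} = V_j + W_j, where W_j is spanned by the Psi of level j *)
  Phi_nested : forall j (m : Zidx W j), (J0 <= j)%N ->
    exists c : Zidx W j.+1 -> R,
      \forall x \ae unif, Phi m x = \sum_m' c m' * Phi m' x;
  Psi_nested : forall j e (m : Zidx W j), (J0 <= j)%N ->
    exists c : Zidx W j.+1 -> R,
      \forall x \ae unif, Psi e m x = \sum_m' c m' * Phi m' x;
  Phi_split : forall j (m : Zidx W j.+1), (J0 <= j)%N ->
    exists (c : Zidx W j -> R) (c' : orient -> Zidx W j -> R),
      \forall x \ae unif, Phi m x = \sum_m' c m' * Phi m' x
                        + \sum_e \sum_m' c' e m' * Psi e m' x;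
  (* the union of the V_j is dense in L^2([0,1]^d) *)
  Phi_dense : forall f : vec -> R, measurable_fun setT f ->
    (\int[unif]_x ((f x) ^+ 2)%:E < +oo)%E ->
    forall eps : R, 0 < eps -> exists2 j, (J0 <= j)%N &
      exists c : Zidx W j -> R,
        \int[unif]_x ((f x - \sum_m c m * Phi m x) ^+ 2) < eps;
  Phi_polynomials : forall j (a : 'I_d -> nat), (J0 <= j)%N ->
    (\sum_i a i < S)%N ->
    exists c : Zidx W j -> R,
      \forall x \ae unif, \prod_i (tnth x i : R) ^+ a i = \sum_m c m * Phi m x;
  card_Zidx : exists c C : R, 0 < c /\ forall l, (J0 <= l)%N ->
    c * 2 ^+ (l * d) <= (#|Zidx W l|)%:R <= C * 2 ^+ (l * d);
  Phi_Psi_localized : exists C : R, forall j, (J0 <= j)%N ->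
    localized C j (@Phi W j) /\ forall e, localized C j (@Psi W j e) }.

Context (J0 : nat) (W : wavelet_system).

(* The projection kernel of V_k for k = 2^(jd). *)
Definition proj_kernel (j : nat) (x y : vec) : R :=
  \sum_(m : Zidx W j) Phi m x * Phi m y.

Definition holder_norm (alpha : R) (h : vec -> R) : \bar R :=
  ((2 `^ (J0%:R * (alpha + d%:R / 2))
     * \big[Num.max/0]_(m : Zidx W J0) `|inner h (Phi m)|)%:E
   + ereal_sup [set v : \bar R | exists l (m : Zidx W l) e, (J0 <= l)%N /\
       v = (2 `^ (l%:R * (alpha + d%:R / 2)) * `|inner h (Psi e m)|)%:E])%E.

Definition holder_ball (alpha M : R) : set (vec -> R) :=
  [set h | unif_continuous_on_cube h /\ (holder_norm alpha h <= M%:E)%E].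

End wavelets.

Section model.
Context (R : realType) (d : nat).

Definition obs := (vec R d * measurableTypeR R * measurableTypeR R)%type.
Definition obsX (o : obs) : vec R d := o.1.1.
Definition obsA (o : obs) : R := o.1.2.
Definition obsY (o : obs) : R := o.2.

(* g is a version of x |-> E_P[f | X = x] *)
Definition is_condexp (P : probability obs R) (f : obs -> R)
    (g : vec R d -> R) :=
  [/\ measurable_fun setT g,
      P.-integrable setT (fun o => (g (obsX o))%:E)
    & forall B, measurable B ->
        (\int[P]_(o in obsX @^-1` B) (f o)%:E
         = \int[P]_(o in obsX @^-1` B) (g (obsX o))%:E)%E].

Definition condexp (P : probability obs R) (f : obs -> R) : vec R d -> R :=
  xget (fun=> 0) [set g | is_condexp P f g].

(* Cov_P(A, Y | X = x) *)
Definition condcov (P : probability obs R) : vec R d -> R :=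
  condexp P (fun o => (obsA o - condexp P obsA (obsX o))
                      * (obsY o - condexp P obsY (obsX o))).

Definition psi (P : probability obs R) : R :=
  \int[P]_o (condcov P (obsX o)).

Context (J0 : nat) (W : wavelet_system R d).

Definition model (alpha beta M C1 C2 : R) : set (probability obs R) :=
  [set P : probability obs R | [/\ forall B, measurable B -> P (obsX @^-1` B) = unif R d B,
      \forall o \ae P, C1 <= obsA o <= C2 /\ C1 <= obsY o <= C2,
      exists2 p, holder_ball J0 W alpha M p & is_condexp P obsA p
    & exists2 b, holder_ball J0 W beta M b & is_condexp P obsY b]].

(* Each regression constraint can be met with some room to spare. Without this
   the model may be empty or reduced to a single regression function (e.g. M
   small and C1 large, or C1 = C2), in which case no lower bound can hold. *)
Definition nondegenerate_model (alpha beta M C1 C2 : R) :=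
  exists eps : R, [/\ 0 < eps,
    exists2 p, holder_ball J0 W alpha (M - eps) p &
      forall x, unit_cube x -> C1 + eps <= p x <= C2 - eps
  & exists2 b, holder_ball J0 W beta (M - eps) b &
      forall x, unit_cube x -> C1 + eps <= b x <= C2 - eps].

End model.

Section estimators.
Context (R : realType) (d J0 : nat) (W : wavelet_system R d).
Local Notation obs := (obs R d).

(* The subsamples D_1, D_2, D_3. *)
Definition sample n := (n.-tuple obs * n.-tuple obs * n.-tuple obs)%type.
Definition D1 n (D : sample n) := D.1.1.
Definition D2 n (D : sample n) := D.1.2.
Definition D3 n (D : sample n) := D.2.

Definition avg n (D : n.-tuple obs) (f : obs -> R) : R :=
  n%:R^-1 * \sum_(i < n) f (tnth D i).

Definition phat n (D : n.-tuple obs) (j : nat) (x : vec R d) : R :=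
  avg D (fun o => obsA o * proj_kernel W j (obsX o) x).

Definition bhat n (D : n.-tuple obs) (j : nat) (x : vec R d) : R :=
  avg D (fun o => obsY o * proj_kernel W j (obsX o) x).

(* The resolutions are k1 = 2^(j1 d) and k2 = 2^(j2 d). *)
Definition estimator := forall (j1 j2 n : nat), sample n -> R.

Definition psi_INT : estimator := fun j1 j2 n D =>
  avg (D2 D) (fun o => obsA o * obsY o)
  - inner (phat (D1 D) j1) (bhat (D1 D) j2).

Definition psi_MC : estimator := fun j1 j2 n D =>
  avg (D2 D) (fun o => obsA o * obsY o)
  - avg (D3 D) (fun o => phat (D1 D) j1 (obsX o) * bhat (D1 D) j2 (obsX o)).

Definition psi_IF : estimator := fun j1 j2 n D =>
  avg (D2 D) (fun o => (obsA o - phat (D1 D) j1 (obsX o))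
                       * (obsY o - bhat (D1 D) j2 (obsX o))).

Definition mse (P : probability obs R) n (T : sample n -> R) : \bar R :=
  'E_((iid P n \x iid P n) \x iid P n)%E[fun D => (T D - psi P) ^+ 2].

Definition max_risk (alpha beta M C1 C2 : R) (T : estimator)
    (j1 j2 : nat -> nat) : nat -> \bar R := fun n =>
  ereal_sup [set mse P (T (j1 n) (j2 n) n)
            | P in model J0 W alpha beta M C1 C2].

Definition minimax_rate (alpha beta : R) : nat -> \bar R :=
  if d%:R / 4 <= (alpha + beta) / 2 then npow (- 1)
  else npow (- ((4 * alpha + 4 * beta) / (2 * alpha + 2 * beta + d%:R))).

Definition kmin (j1 j2 : nat -> nat) : nat -> \bar R :=
  fun n => ((minn (2 ^ (j1 n * d)) (2 ^ (j2 n * d)))%:R)%:E.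

Definition kmax (j1 j2 : nat -> nat) : nat -> \bar R :=
  fun n => ((maxn (2 ^ (j1 n * d)) (2 ^ (j2 n * d)))%:R)%:E.

(* j1, j2 encode sequences of resolutions 2^(j1 n d), 2^(j2 n d). *)
Definition levels (j1 j2 : nat -> nat) :=
  forall n, (J0 <= j1 n)%N /\ (J0 <= j2 n)%N.

Definition best_rate (risk : (nat -> nat) -> (nat -> nat) -> nat -> \bar R)
    (r : nat -> \bar R) :=
  (exists j1 j2, levels j1 j2 /\ lesssim (risk j1 j2) r)
  /\ (forall j1 j2, levels j1 j2 -> lesssim r (risk j1 j2)).

End estimators.

(* Main.v *)
From HB Require Import structures.
Require Import Defs.
From mathcomp Require Import all_boot all_order all_algebra.
From mathcomp Require Import all_classical all_reals all_analysis.
From mathcomp Require Import measurable_realfun.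
From mathcomp Require Import ring lra.

(** Why the theorem holds.

    Write Pi for the orthogonal projection onto V_k with k = kmin, and s for
    alpha + beta.  In each estimator the product of the two regression
    estimates built on the first subsample is paired against a function that
    depends on kmin only: the spaces V_k are nested, so the inner product of
    the two empirical projections is the inner product of the coarser one with
    the projection of the finer one (lemma [cross_decomp]).  Expanding around
    the means leaves a deterministic bias, two centered linear terms of
    variance O(1/n), and a degenerate quadratic term.  The latter is the scalar
    product of two centered random vectors of dimension about kmin, hence its
    second moment is O(kmin^2/n^2), by a fourth moment bound for sums of
    independent vectors ([Ex_norm4_le]).  The bias is
    <p - Pi p, b - Pi b>, at most kmin^(-s/d) by the decay of the wavelet
    coefficients ([tail_le]); for IF the first-order correction replaces
    kmin by kmax.  Averaging over the remaining subsample costs, for MC and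
    IF, a conditional variance of order (1 + kmax/n)/n; the bound on
    E phat(x)^2 bhat(x)^2 that it needs is [Ex_sqr_sqr_le].  This gives
    [uniform_mse_le], and the upper rates are then arithmetic on exponents.

    For the lower bound, consider laws under which A = p(X) and Y = b(X) are
    functions of X.  Then psi = 0, and the mean squared error is at least the
    square of the mean of the estimator.  For INT and MC this mean is the same
    expression, bilinear in (p, b):
      bias(p, b) = <p, b> - (1 - 1/n) <Pi p, Pi b> - (1/n) E[p b K(X, X)],
    with K the kernel of Pi.  Perturbing an interior point (p0, b0) of the
    model by h and h' and taking the mixed second difference over the four
    resulting laws isolates bias(h, h'), so that the maximal risk is at least
    (bias(h, h')/4)^2 ([max_risk_ge]).  Two perturbations suffice.
    - For constant h and h' the first two terms cancel up to 1/n and the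
      diagonal of K contributes -kmin/n ([bias_const]).
    - For oscillating h and h' proportional to one function G of frequency
      2^(j+r), where kmin = 2^(jd), the bias is of order
      2^(-(j+r)s) (|G|^2 - |Pi G|^2 - kmin/n).  Here G is a function of one
      coordinate, a sum of disjoint bumps.  Its signs are chosen one after the
      other so that |Pi G|^2 is at most the sum of the squared norms of the
      projections of the single bumps, which is O(2^-r) ([ridge_energy]); so
      for r a large constant the bias is of order kmin^(-s/d)
      ([ridge_bias]).  Bumps vanishing to the order S at the end points of
      their cells make G smooth enough for the Hoelder balls
      ([ridge_perturbation]).
    Since max(kmin^(-s/d), kmin/n) is at least n^(-s/(s+d)) for every kmin,
    no choice of resolutions beats n^(-2s/(s+d)) ([risk_lower_rate]), which is
    slower than the minimax rate as soon as s < d. *)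

Set Implicit Arguments.
Unset Strict Implicit.
Unset Printing Implicit Defensive.

Import Order.TTheory GRing.Theory Num.Theory.
Import numFieldNormedType.Exports.

Local Open Scope classical_set_scope.
Local Open Scope ring_scope.

(** * Bounded measurable functions and their expectations *)

Section bounded_measurable.
Context {dT : measure_display} {T : measurableType dT} {R : realType}.
Implicit Types f g : T -> R.

(** Boundedness is required everywhere rather than almost everywhere, so that sums, products and sections of such functions need no integrability side conditions. Functions of the data are brought to this form by clamping the data to the set that carries their law. *)
Definition bm f := measurable_fun setT f /\ exists C : R, forall x, `|f x| <= C.

Lemma bm_measurable f : bm f -> measurable_fun setT f. Proof. by case. Qed.

Lemma bm_bound f : bm f -> exists2 C : R, 0 < C & forall x, `|f x| <= C.
Proof.
case=> _ [C hC]; exists (`|C| + 1); first by rewrite ltr_wpDl.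
by move=> x; rewrite (le_trans (hC x))// (le_trans (ler_norm _))// lerDl.
Qed.

Lemma bm_cst (c : R) : bm (fun=> c).
Proof. by split; [exact: measurable_cst|exists `|c|]. Qed.

Lemma bmD f g : bm f -> bm g -> bm (fun x => f x + g x).
Proof.
move=> [mf [C hC]] [mg [D hD]]; split; first exact: measurable_funD.
by exists (C + D) => x; rewrite (le_trans (ler_normD _ _))// lerD.
Qed.

Lemma bmM f g : bm f -> bm g -> bm (fun x => f x * g x).
Proof.
move=> [mf [C hC]] [mg [D hD]]; split; first exact: measurable_funM.
by exists (C * D) => x; rewrite normrM ler_pM.
Qed.

Lemma bmN f : bm f -> bm (fun x => - f x).
Proof.
move=> [mf [C hC]]; split; first exact: measurableT_comp.
by exists C => x; rewrite normrN.
Qed.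

Lemma bmB f g : bm f -> bm g -> bm (fun x => f x - g x).
Proof. by move=> bf bg; apply: bmD => //; exact: bmN. Qed.

Lemma bm_norm f : bm f -> bm (fun x => `|f x|).
Proof.
move=> [mf [C hC]]; split; first exact: measurableT_comp.
by exists C => x; rewrite normr_id.
Qed.

Lemma bmX f n : bm f -> bm (fun x => f x ^+ n).
Proof.
move=> bf; elim: n => [|n ih].
  by rewrite (_ : (fun _ => _) = fun=> 1)//; exact: bm_cst.
rewrite (_ : (fun _ => _) = fun x => f x * f x ^+ n); first exact: bmM.
by apply/funext => x; rewrite exprS.
Qed.

Lemma bm_sum (I : Type) (r : seq I) (p : pred I) (F : I -> T -> R) :
  (forall i, bm (F i)) -> bm (fun x => \sum_(i <- r | p i) F i x).
Proof.
move=> bF; elim: r => [|i r ih].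
  rewrite (_ : (fun _ => _) = fun=> 0); first exact: bm_cst.
  by apply/funext => x; rewrite big_nil.
rewrite (_ : (fun _ => _) = fun x => (if p i then F i x else 0) +
  \sum_(j <- r | p j) F j x); last first.
  by apply/funext => x; rewrite big_cons; case: ifP => //; rewrite add0r.
by apply: bmD => //; case: (p i) => //; exact: bm_cst.
Qed.

Lemma bm_prod (I : Type) (r : seq I) (p : pred I) (F : I -> T -> R) :
  (forall i, bm (F i)) -> bm (fun x => \prod_(i <- r | p i) F i x).
Proof.
move=> bF; elim: r => [|i r ih].
  rewrite (_ : (fun _ => _) = fun=> 1); first exact: bm_cst.
  by apply/funext => x; rewrite big_nil.
rewrite (_ : (fun _ => _) = fun x => (if p i then F i x else 1) *
  \prod_(j <- r | p j) F j x); last first.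
  by apply/funext => x; rewrite big_cons; case: ifP => //; rewrite mul1r.
by apply: bmM => //; case: (p i) => //; exact: bm_cst.
Qed.

Lemma bm_indic (A : set T) : measurable A -> bm (\1_A : T -> R).
Proof.
move=> mA; split; first exact: measurable_indic.
by exists 1 => x; rewrite indicE; case: (_ \in _); rewrite ?normr1 ?normr0.
Qed.

End bounded_measurable.

Lemma bm_comp {d1 d2 : measure_display} {T1 : measurableType d1}
  {T2 : measurableType d2} {R : realType} (g : T1 -> T2) (f : T2 -> R) :
  measurable_fun setT g -> bm f -> bm (fun x => f (g x)).
Proof.
move=> mg [mf [C hC]]; split; first exact: measurableT_comp.
by exists C.
Qed.

Ltac bmt := repeat first
  [ assumption
  | match goal with
    | |- bm (fun _ => _ + _) => apply: bmD
    | |- bm (fun _ => - _) => apply: bmN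
    | |- bm (fun _ => _ * _) => apply: bmM
    | |- bm (fun _ => _ ^+ _) => apply: bmX
    | |- bm (fun _ => `|_|) => apply: bm_norm
    | |- bm (fun _ => \sum_(_ <- _ | _) _) => apply: bm_sum => ?
    | |- bm (fun _ => \prod_(_ <- _ | _) _) => apply: bm_prod => ?
    end
  | exact: bm_cst
  | match goal with H : forall _, bm _ |- _ => exact: H end
  | match goal with H : forall _ _, bm _ |- _ => exact: H end ].

Section expectation.
Context {dT : measure_display} {T : measurableType dT} {R : realType}.
Variable P : probability T R.
Implicit Types f g : T -> R.

Definition Ex f : R := \int[P]_x f x.

Lemma bm_integrable f : bm f -> P.-integrable setT (EFin \o f).
Proof.
move=> [mf [C hC]]; apply: (@le_integrable _ _ _ _ _ _ _ (cst C%:E)) => //.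
- exact/measurable_EFinP.
- by move=> x _ /=; rewrite lee_fin (le_trans (hC x))// ler_norm.
- exact: finite_measure_integrable_cst.
Qed.

Lemma ExE f : bm f -> (Ex f)%:E = (\int[P]_x (f x)%:E)%E.
Proof.
by move=> /bm_integrable bf; rewrite /Ex /Rintegral fineK//; exact: integrable_fin_num.
Qed.

Lemma ExD f g : bm f -> bm g -> Ex (fun x => f x + g x) = Ex f + Ex g.
Proof. by move=> bf bg; rewrite /Ex RintegralD//; exact: bm_integrable. Qed.

Lemma ExZ c f : bm f -> Ex (fun x => c * f x) = c * Ex f.
Proof. by move=> bf; rewrite /Ex RintegralZl//; exact: bm_integrable. Qed.

Lemma ExZr c f : bm f -> Ex (fun x => f x * c) = Ex f * c.
Proof. by move=> bf; rewrite /Ex RintegralZr//; exact: bm_integrable. Qed.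

Lemma ExN f : bm f -> Ex (fun x => - f x) = - Ex f.
Proof.
move=> bf; rewrite -mulN1r -ExZ//; congr Ex; apply/funext => x.
by rewrite mulN1r.
Qed.

Lemma ExB f g : bm f -> bm g -> Ex (fun x => f x - g x) = Ex f - Ex g.
Proof. by move=> bf bg; rewrite ExD// ?ExN//; exact: bmN. Qed.

Lemma Ex_cst c : Ex (fun=> c) = c.
Proof. by rewrite /Ex Rintegral_cst//= probability_setT mulr1. Qed.

Lemma Ex_sum (I : Type) (r : seq I) (p : pred I) (F : I -> T -> R) :
  (forall i, bm (F i)) ->
  Ex (fun x => \sum_(i <- r | p i) F i x) = \sum_(i <- r | p i) Ex (F i).
Proof.
move=> bF; elim: r => [|i r ih].
  rewrite big_nil (_ : (fun _ => _) = fun=> 0) ?Ex_cst//.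
  by apply/funext => x; rewrite big_nil.
rewrite big_cons -ih; case: ifP => pi; last first.
  by congr Ex; apply/funext => x; rewrite big_cons pi.
rewrite -ExD//; last by bmt.
by congr Ex; apply/funext => x; rewrite big_cons pi.
Qed.

Lemma le_Ex f g : bm f -> bm g -> (forall x, f x <= g x) -> Ex f <= Ex g.
Proof.
by move=> bf bg fg; rewrite /Ex le_Rintegral//; exact: bm_integrable.
Qed.

Lemma Ex_ge0 f : (forall x, 0 <= f x) -> 0 <= Ex f.
Proof. by move=> f0; apply: Rintegral_ge0. Qed.

Lemma ae_eq_Ex f g : bm f -> bm g -> {ae P, forall x, f x = g x} -> Ex f = Ex g.
Proof.
move=> bf bg fg; rewrite /Ex /Rintegral; congr fine.
apply: ae_eq_integral => //; [apply/measurable_EFinP; by case: bf|apply/measurable_EFinP; by case: bg|].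
by apply: filterS fg => x /= -> .
Qed.

Lemma ae_le_Ex f g : bm f -> bm g -> {ae P, forall x, f x <= g x} -> Ex f <= Ex g.
Proof.
move=> bf bg fg; rewrite -subr_ge0 -ExB//.
rewrite (_ : Ex _ = Ex (fun x => `|g x - f x|)); first by apply: Ex_ge0 => x.
apply: ae_eq_Ex; [by bmt|by bmt|].
by apply: filterS fg => x /= fg; rewrite ger0_norm// subr_ge0.
Qed.

(** Discriminant of the nonnegative quadratic form E (s f + t g)^2. *)
Lemma Ex_CS f g : bm f -> bm g ->
  Ex (fun x => f x * g x) ^+ 2 <= Ex (fun x => f x ^+ 2) * Ex (fun x => g x ^+ 2).
Proof.
move=> bf bg; set a := Ex (fun x => f x ^+ 2); set c := Ex (fun x => g x ^+ 2).
set b := Ex _.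
have a0 : 0 <= a by apply: Ex_ge0 => x; exact: sqr_ge0.
have c0 : 0 <= c by apply: Ex_ge0 => x; exact: sqr_ge0.
have q (s t : R) : 0 <= s ^+ 2 * a + 2 * s * t * b + t ^+ 2 * c.
  rewrite -!ExZ; [|by bmt|by bmt|by bmt].
  rewrite -!ExD; [|by bmt|by bmt|by bmt|by bmt].
  apply: Ex_ge0 => x.
  rewrite (_ : _ + _ = (s * f x + t * g x) ^+ 2) ?sqr_ge0//; ring.
have [a_eq0|a_neq0] := eqVneq a 0.
  rewrite a_eq0 mul0r; have := q (- (c + 1)) b; rewrite a_eq0 => h.
  have {}h : 0 <= - (c + 2) * b ^+ 2 by lra.
  by rewrite -(@nmulr_rge0 _ (- (c + 2))) //; lra.
have := q (- b) a; have : 0 < a by rewrite lt_neqAle eq_sym a_neq0.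
by move=> a_gt0; nra.
Qed.

Lemma sqr_Ex_le f : bm f -> Ex f ^+ 2 <= Ex (fun x => f x ^+ 2).
Proof.
move=> bf; have := Ex_CS bf (bm_cst 1).
rewrite (_ : (fun x => f x * 1) = f); last by apply/funext => x; rewrite mulr1.
by rewrite Ex_cst expr1n mulr1.
Qed.

End expectation.

Section expectation_image.
Context {d1 d2 : measure_display} {T1 : measurableType d1}
  {T2 : measurableType d2} {R : realType}.

Lemma Ex_distribution (P : probability T1 R) (X : {mfun T1 >-> T2}) (f : T2 -> R) :
  bm f -> Ex (distribution P X) f = Ex P (fun x => f (X x)).
Proof.
move=> bf; rewrite /Ex /Rintegral; congr fine.
rewrite integral_distribution//; first by apply/measurable_EFinP; case: bf.
by apply: (@bm_integrable _ _ _ P (fun x => f (X x))); exact: bm_comp bf.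
Qed.

Variables (P : probability T1 R) (Q : probability T2 R) (f : T1 * T2 -> R).
Hypothesis bf : bm f.

Lemma bm_pair1 x : bm (fun y => f (x, y)).
Proof. by apply: bm_comp bf; exact: measurable_pair1. Qed.

Lemma bm_pair2 y : bm (fun x => f (x, y)).
Proof. by apply: bm_comp bf; exact: measurable_pair2. Qed.

Lemma bm_Ex1 : bm (fun x => Ex Q (fun y => f (x, y))).
Proof.
split; last first.
  have [C C0 hC] := bm_bound bf; exists C => x.
  rewrite ler_norml -(Ex_cst Q C) -ExN; last exact: bm_cst.
  apply/andP; split; apply: le_Ex => //; try exact: bm_pair1; bmt.
  - by move=> y; have := hC (x, y); rewrite ler_norml => /andP[].
  - by move=> y; have := hC (x, y); rewrite ler_norml => /andP[].
apply: (@measurableT_comp _ _ _ _ _ _ (fine : \bar R -> R)) => //.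
exact: (measurable_fubini_F (bm_integrable (P \x Q)%E bf)).
Qed.

Lemma bm_Ex2 : bm (fun y => Ex P (fun x => f (x, y))).
Proof.
split; last first.
  have [C C0 hC] := bm_bound bf; exists C => x.
  rewrite ler_norml -(Ex_cst P C) -ExN; last exact: bm_cst.
  apply/andP; split; apply: le_Ex => //; try exact: bm_pair2; bmt.
  - by move=> y; have := hC (y, x); rewrite ler_norml => /andP[].
  - by move=> y; have := hC (y, x); rewrite ler_norml => /andP[].
apply: (@measurableT_comp _ _ _ _ _ _ (fine : \bar R -> R)) => //.
exact: (measurable_fubini_G (bm_integrable (P \x Q)%E bf)).
Qed.

Lemma Ex_prod : Ex (P \x Q)%E f = Ex P (fun x => Ex Q (fun y => f (x, y))).
Proof.
apply: EFin_inj; rewrite ExE// ExE; last exact: bm_Ex1.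
have := integral12_prod_meas1 (bm_integrable (P \x Q)%E bf) => <-.
by apply: eq_integral => x _; rewrite ExE//; exact: bm_pair1.
Qed.

Lemma Ex_prod2 : Ex (P \x Q)%E f = Ex Q (fun y => Ex P (fun x => f (x, y))).
Proof.
apply: EFin_inj; rewrite ExE// ExE; last exact: bm_Ex2.
have := integral21_prod_meas1 (bm_integrable (P \x Q)%E bf) => <-.
by apply: eq_integral => x _; rewrite ExE//; exact: bm_pair2.
Qed.

End expectation_image.

(** * Moments of sums over an i.i.d. sample *)

Lemma sum_CS {R : realFieldType} (I : finType) (a b : I -> R) :
  (\sum_i a i * b i) ^+ 2 <= (\sum_i a i ^+ 2) * (\sum_i b i ^+ 2).
Proof.
set A := \sum_i a i ^+ 2; set C := \sum_i b i ^+ 2; set B := \sum_i a i * b i.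
have A0 : 0 <= A by apply: sumr_ge0 => x _; exact: sqr_ge0.
have C0 : 0 <= C by apply: sumr_ge0 => x _; exact: sqr_ge0.
have q (s t : R) : 0 <= s ^+ 2 * A + 2 * s * t * B + t ^+ 2 * C.
  rewrite !big_distrr/= -!big_split/=; apply: sumr_ge0 => i _.
  rewrite (_ : _ + _ = (s * a i + t * b i) ^+ 2) ?sqr_ge0//; ring.
have [A_eq0|A_neq0] := eqVneq A 0.
  rewrite A_eq0 mul0r; have := q (- (C + 1)) B; rewrite A_eq0 => h.
  have {}h : 0 <= - (C + 2) * B ^+ 2 by lra.
  by rewrite -(@nmulr_rge0 _ (- (C + 2))) //; lra.
have := q (- B) A; have : 0 < A by rewrite lt_neqAle eq_sym A_neq0.
by move=> A_gt0; nra.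
Qed.

Section product_expectation.
Context {d1 d2 : measure_display} {T1 : measurableType d1}
  {T2 : measurableType d2} {R : realType}.
Implicit Types (f : T1 -> R) (g : T2 -> R).

Lemma bm_fst f : bm f -> bm (fun z : T1 * T2 => f z.1).
Proof. by apply: bm_comp; exact: measurable_fst. Qed.

Lemma bm_snd g : bm g -> bm (fun z : T1 * T2 => g z.2).
Proof. by apply: bm_comp; exact: measurable_snd. Qed.

Variables (P : probability T1 R) (Q : probability T2 R).

Lemma Ex_prodM f g : bm f -> bm g ->
  Ex (P \x Q)%E (fun z => f z.1 * g z.2) = Ex P f * Ex Q g.
Proof.
move=> bf bg; rewrite Ex_prod; last by apply: bmM; [exact: bm_fst|exact: bm_snd].
rewrite -ExZr//; congr Ex; by apply/funext => x /=; rewrite ExZ.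
Qed.

Lemma Ex_fst f : bm f -> Ex (P \x Q)%E (fun z => f z.1) = Ex P f.
Proof.
move=> bf; rewrite Ex_prod; last exact: bm_fst.
by congr Ex; apply/funext => x /=; rewrite Ex_cst.
Qed.

Lemma Ex_snd g : bm g -> Ex (P \x Q)%E (fun z => g z.2) = Ex Q g.
Proof. by move=> bg; rewrite Ex_prod /= ?Ex_cst//; exact: bm_snd. Qed.

End product_expectation.

Section samples.
Context {dT : measure_display} {T : measurableType dT} {R : realType}.
Implicit Types f g : T -> R.

Definition tsum n (D : n.-tuple T) f : R := \sum_(i < n) f (tnth D i).

Lemma tsum_cons n (z : T * n.-tuple T) f : tsum (tuple_cons z) f = f z.1 + tsum z.2 f.
Proof.
rewrite /tsum big_ord_recl tnth0; congr (_ + _); apply: eq_bigr => i _.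
by rewrite tnthS.
Qed.

Lemma tsum0 (D : 0.-tuple T) f : tsum D f = 0.
Proof. by rewrite /tsum big_ord0. Qed.

Lemma tsumZ n (D : n.-tuple T) c f : tsum D (fun x => c * f x) = c * tsum D f.
Proof. by rewrite /tsum big_distrr. Qed.

Lemma tsum_sum n (D : n.-tuple T) (I : finType) (F : I -> T -> R) :
  tsum D (fun x => \sum_i F i x) = \sum_i tsum D (F i).
Proof. by rewrite /tsum exchange_big. Qed.

Lemma tsum_cst n (D : n.-tuple T) c : tsum D (fun=> c) = n%:R * c.
Proof. by rewrite /tsum sumr_const card_ord mulr_natl. Qed.

Lemma bm_tsum n f : bm f -> bm (fun D : n.-tuple T => tsum D f).
Proof.
move=> bf; apply: bm_sum => i.
by apply: bm_comp bf; exact: measurable_tnth.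
Qed.

Lemma bm_tsum_snd (d' : measure_display) (T' : measurableType d') n f :
  bm f -> bm (fun z : T' * n.-tuple T => tsum z.2 f).
Proof. by move=> bf; exact: (bm_snd (bm_tsum n bf)). Qed.

Ltac bmz := repeat first
  [ progress bmt
  | match goal with
    | |- bm (fun z => ?f (fst z)) => apply: (@bm_fst _ _ _ _ _ f)
    | |- bm (fun z => ?f (snd z)) => apply: (@bm_snd _ _ _ _ _ f)
    | |- bm (fun z => tsum (snd z) _) => apply: bm_tsum_snd
    | |- bm (fun D => tsum D _) => apply: bm_tsum
    end ].

Variable P : probability T R.

Lemma Ex_iid0 (F : 0.-tuple T -> R) : bm F -> Ex (iid P 0) F = F [tuple].
Proof.
move=> [mF _]; rewrite /Ex /Rintegral/= integral_dirac//=; last exact/measurable_EFinP.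
by rewrite indicT mul1r.
Qed.

(** The iid law is defined by adding one observation at the front; every moment computation below is an induction through this identity. *)
Lemma Ex_iidS n (F : n.+1.-tuple T -> R) : bm F ->
  Ex (iid P n.+1) F = Ex (P \x iid P n)%E (fun z => F (tuple_cons z)).
Proof. by move=> bF; rewrite [LHS]Ex_distribution. Qed.

Lemma bm_tuple_cons n (F : n.+1.-tuple T -> R) : bm F -> bm (fun z => F (tuple_cons z)).
Proof. by apply: bm_comp; exact: measurable_tuple_cons. Qed.

Lemma Ex_tsum n f : bm f -> Ex (iid P n) (fun D => tsum D f) = n%:R * Ex P f.
Proof.
move=> bf; elim: n => [|n ih]; first by rewrite Ex_iid0 ?tsum0 ?mul0r//; exact: bm_tsum.
rewrite Ex_iidS; last exact: bm_tsum.
under [X in Ex _ X]eq_fun do rewrite tsum_cons.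
have bt := bm_tsum n bf.
rewrite ExD; [|exact: (bm_fst bf)|exact: (bm_snd bt)].
by rewrite (Ex_fst _ _ bf) (Ex_snd _ _ bt) ih -natr1; ring.
Qed.

Lemma Ex_tsumM n f g : bm f -> bm g ->
  Ex (iid P n) (fun D => tsum D f * tsum D g) =
  n%:R * Ex P (fun x => f x * g x) + (n%:R ^+ 2 - n%:R) * (Ex P f * Ex P g).
Proof.
move=> bf bg; elim: n => [|n ih].
  by rewrite Ex_iid0 ?tsum0; [ring|apply: bmM; exact: bm_tsum].
rewrite Ex_iidS; last by apply: bmM; exact: bm_tsum.
have btf := bm_tsum n bf; have btg := bm_tsum n bg.
rewrite (_ : (fun _ => _) = (fun z => (f z.1 * g z.1 + tsum z.2 f * tsum z.2 g) +
  (f z.1 * tsum z.2 g + g z.1 * tsum z.2 f))); last first.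
  by apply/funext => z; rewrite !tsum_cons; ring.
have b1 := bmM bf bg; have b2 := bmM btf btg.
rewrite ExD; [|bmz|bmz].
rewrite ExD; [|exact: (bm_fst b1)|exact: (bm_snd b2)].
rewrite (Ex_fst _ _ b1) (Ex_snd _ _ b2) ih.
rewrite ExD; [|bmz|bmz].
by rewrite (Ex_prodM _ _ bf btg) (Ex_prodM _ _ bg btf) !Ex_tsum// -natr1; ring.
Qed.

(** Fourth moment of the norm of a centered random walk in a Euclidean space. Adding one step f to the sum S turns |S|^2 into |S|^2 + 2<f, S> + |f|^2; in the square of this, the terms that are odd in S or in f have mean zero, and <f, S>^2 <= |f|^2 |S|^2. *)
Lemma Ex_norm4_le n (I : finType) (f : I -> T -> R) (B : R) :
  (forall m, bm (f m)) -> (forall m, Ex P (f m) = 0) ->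
  {ae P, forall x, \sum_m f m x ^+ 2 <= B} ->
  Ex (iid P n) (fun D => (\sum_m tsum D (f m) ^+ 2) ^+ 2) <= 3 * B ^+ 2 * n%:R ^+ 2.
Proof.
move=> bf f0 fB.
have bT k m : bm (fun D : k.-tuple T => tsum D (f m)) by exact: bm_tsum.
have bS k : bm (fun D : k.-tuple T => \sum_m tsum D (f m) ^+ 2).
  by apply: bm_sum => m; apply: bmX.
pose q x := \sum_m f m x ^+ 2.
have bq : bm q by apply: bm_sum => m; apply: bmX.
have q0 x : 0 <= q x by apply: sumr_ge0 => m _; exact: sqr_ge0.
have B0 : 0 <= B.
  rewrite -(Ex_cst P B) -(Ex_cst P 0); apply: ae_le_Ex; [exact: bm_cst|exact: bm_cst|].
  by apply: filterS fB => x /=; apply: le_trans; exact: q0.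
have EqB : Ex P q <= B by rewrite -(Ex_cst P B); apply: ae_le_Ex => //; exact: bm_cst.
have Eq2B : Ex P (fun x => q x ^+ 2) <= B ^+ 2.
  rewrite -(Ex_cst P (B ^+ 2)); apply: ae_le_Ex; [exact: bmX|exact: bm_cst|].
  by apply: filterS fB => x /= qB; rewrite lerXn2r ?nnegrE.
have ES k : Ex (iid P k) (fun D => \sum_m tsum D (f m) ^+ 2) <= k%:R * B.
  rewrite Ex_sum; last by move=> m; exact: (bmX 2 (bT k m)).
  rewrite (eq_bigr (fun m => k%:R * Ex P (fun x => f m x ^+ 2))); last first.
    by move=> m _; rewrite Ex_tsumM// f0; ring.
  by rewrite -big_distrr/= -Ex_sum ?ler_wpM2l//; move=> m; apply: bmX.
elim: n => [|n ih].
  rewrite Ex_iid0; last exact: bmX.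
  by rewrite big1 ?expr0n ?mulr0//= => m _; rewrite tsum0 expr0n.
rewrite Ex_iidS; last exact: bmX.
pose s (D : n.-tuple T) := \sum_m tsum D (f m) ^+ 2.
have s0 D : 0 <= s D by apply: sumr_ge0 => m _; exact: sqr_ge0.
have bs : bm s by exact: bS.
pose l (z : T * n.-tuple T) := \sum_m f m z.1 * tsum z.2 (f m).
have bl : bm l by apply: bm_sum => m; apply: bmM; [exact: bm_fst|apply: (bm_snd (bT n m))].
have bss := bmM bs bs; have bqq := bmX 2 bq.
have bq1 : bm (fun z : T * n.-tuple T => q z.1) by exact: bm_fst.
have bs2 : bm (fun z : T * n.-tuple T => s z.2) by exact: bm_snd.
have lCS z : l z ^+ 2 <= q z.1 * s z.2.
  exact: sum_CS.
have Els : Ex (P \x iid P n)%E (fun z => l z * s z.2) = 0.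
  rewrite Ex_prod2; last exact: bmM.
  rewrite -(Ex_cst (iid P n) 0); congr Ex; apply/funext => D /=.
  rewrite ExZr; last exact: (bm_pair2 bl).
  rewrite /l /= Ex_sum; last by move=> m; apply: bmM => //; exact: bm_cst.
  by rewrite big1 ?mul0r// => m _; rewrite ExZr// f0 mul0r.
have Elq : Ex (P \x iid P n)%E (fun z => l z * q z.1) = 0.
  rewrite Ex_prod; last exact: bmM.
  rewrite -(Ex_cst P 0); congr Ex; apply/funext => x /=.
  rewrite ExZr; last exact: (bm_pair1 bl).
  rewrite /l /= Ex_sum; last by move=> m; exact: (bmM (bm_cst (f m x)) (bT n m)).
  by rewrite big1 ?mul0r// => m _; rewrite (ExZ _ (f m x) (bT n m)) Ex_tsum// f0 !mulr0.
(* s = |S|^2, q = |f|^2 and l = <f, S>; 4 l^2 has been bounded by 4 q s. *)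
pose G z := (s z.2 * s z.2 + q z.1 ^+ 2 + 6 * (q z.1 * s z.2)) +
  4 * (l z * q z.1 + l z * s z.2).
have bG : bm G by rewrite /G; bmt.
apply: (@le_trans _ _ (Ex (P \x iid P n)%E G)).
  apply: le_Ex => //; first exact: (bm_tuple_cons (bmX 2 (bS n.+1))).
  move=> z; rewrite /G (_ : \sum_m _ = q z.1 + 2 * l z + s z.2); last first.
    rewrite /q /l /s big_distrr/= -!big_split/=; apply: eq_bigr => m _.
    by rewrite tsum_cons; ring.
  have := lCS z; have := q0 z.1; have := s0 z.2; nra.
have bqq1 : bm (fun z : T * n.-tuple T => q z.1 ^+ 2) by exact: (bm_fst bqq).
have bss1 : bm (fun z : T * n.-tuple T => s z.2 * s z.2) by exact: (bm_snd bss).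
have blq : bm (fun z => l z * q z.1) by bmt.
have bls : bm (fun z => l z * s z.2) by bmt.
have bqs : bm (fun z : T * n.-tuple T => q z.1 * s z.2) by bmt.
rewrite /G ExD; [|bmt|bmt].
rewrite ExZ; last by bmt.
rewrite [Ex _ (fun z => l z * q z.1 + _)]ExD// Elq Els addr0 mulr0 addr0.
rewrite ExD; [|bmt|bmt].
rewrite ExD// ExZ// Ex_prodM// (Ex_fst _ _ bqq) (Ex_snd _ _ bss).
have -> : Ex (iid P n) (fun D => s D * s D) =
  Ex (iid P n) (fun D => (\sum_m tsum D (f m) ^+ 2) ^+ 2).
  by congr Ex; apply/funext => D; rewrite expr2.
have h1 : Ex P q * Ex (iid P n) s <= B * (n%:R * B).
  by apply: ler_pM => //; exact: Ex_ge0.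
rewrite -natr1; have : 0 <= n%:R :> R by []. nra.
Qed.

Section two_nonneg_sums.
Variables (u w : T -> R) (b : R).
Hypotheses (bu : bm u) (bw : bm w) (u0 : forall x, 0 <= u x)
  (w0 : forall x, 0 <= w x) (ub : forall x, u x <= b).

Let bU n := bm_tsum n bu.
Let bW n := bm_tsum n bw.
Let U0 n (D : n.-tuple T) : 0 <= tsum D u. Proof. exact: sumr_ge0. Qed.
Let W0 n (D : n.-tuple T) : 0 <= tsum D w. Proof. exact: sumr_ge0. Qed.

Let EU2 n t := Ex (iid P n) (fun D => (t + tsum D u) ^+ 2).

Let bUt n t : bm (fun D : n.-tuple T => (t + tsum D u) ^+ 2).
Proof. by have bUn := bU n; bmt. Qed.

Let EU2S n t : EU2 n.+1 t = Ex (P \x iid P n)%E (fun z => (t + u z.1 + tsum z.2 u) ^+ 2).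
Proof.
rewrite /EU2 Ex_iidS; last exact: bUt.
by congr Ex; apply/funext => z; rewrite tsum_cons addrA.
Qed.

Let bUS n t : bm (fun z : T * n.-tuple T => (t + u z.1 + tsum z.2 u) ^+ 2).
Proof.
have bU2 : bm (fun z : T * n.-tuple T => tsum z.2 u) by exact: (bm_snd (bU n)).
have bu1 : bm (fun z : T * n.-tuple T => u z.1) by exact: bm_fst.
by bmt.
Qed.

Let le_EU2S n t : 0 <= t -> EU2 n t <= EU2 n.+1 t.
Proof.
move=> t0; rewrite EU2S -[EU2 n t](Ex_snd P _ (bUt n t)); apply: le_Ex.
- exact: (bm_snd (bUt n t)).
- exact: bUS.
- by move=> z; have := u0 z.1; have := U0 z.2; nra.
Qed.

Let le_EU2 n t t' : 0 <= t -> t <= t' -> EU2 n t <= EU2 n t'.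
Proof.
move=> t0 tt'; apply: le_Ex => //; [exact: bUt|exact: bUt|].
by move=> D; have := U0 D; nra.
Qed.

Let b0 : 0 <= b.
Proof.
rewrite -(Ex_cst P b); apply: Ex_ge0 => x; exact: le_trans (ub x).
Qed.

Let EU2_ge0 n t : 0 <= EU2 n t.
Proof. by apply: Ex_ge0 => D; exact: sqr_ge0. Qed.

Let Ew0 : 0 <= Ex P w. Proof. exact: Ex_ge0. Qed.

(** The first observation is singled out: its own term in the sum of the u is replaced by the bound b, which leaves the same statement with a larger shift t, whence the generalization over t. *)
Let mixed_moment1 n t : 0 <= t ->
  Ex (iid P n) (fun D => (t + tsum D u) ^+ 2 * tsum D w) <=
  n%:R * Ex P w * EU2 n (t + b).
Proof.
elim: n t => [|n ih] t t0.
  by rewrite Ex_iid0 ?tsum0 ?mulr0 ?mul0r//; apply: bmM => //.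
rewrite Ex_iidS; last by apply: bmM.
have bU2 : bm (fun z : T * n.-tuple T => tsum z.2 u) by exact: (bm_snd (bU n)).
have bW2 : bm (fun z : T * n.-tuple T => tsum z.2 w) by exact: (bm_snd (bW n)).
have bu1 : bm (fun z : T * n.-tuple T => u z.1) by exact: bm_fst.
have bw1 : bm (fun z : T * n.-tuple T => w z.1) by exact: bm_fst.
apply: (@le_trans _ _ (Ex (P \x iid P n)%E (fun z =>
   w z.1 * (t + b + tsum z.2 u) ^+ 2 + (t + u z.1 + tsum z.2 u) ^+ 2 * tsum z.2 w))).
  apply: le_Ex; [|bmt|].
    exact: (bm_tuple_cons (bmM (bUt n.+1 t) (bW n.+1))).
  move=> z; rewrite !tsum_cons addrA mulrDr [_ * w z.1]mulrC lerD2r ler_wpM2l//.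
  by have := u0 z.1; have := U0 z.2; have := ub z.1; nra.
rewrite ExD; [|bmt|bmt].
rewrite (Ex_prodM P (iid P n) bw (bUt n (t + b))).
have h : Ex (P \x iid P n)%E (fun z => (t + u z.1 + tsum z.2 u) ^+ 2 * tsum z.2 w) <=
    n%:R * Ex P w * EU2 n.+1 (t + b).
  rewrite Ex_prod; last by bmt.
  rewrite EU2S Ex_prod; last exact: bUS.
  rewrite -ExZ; last by apply: (@bm_Ex1 _ _ _ _ _ P (iid P n) _ (bUS n (t + b))).
  apply: le_Ex.
  - by apply: (@bm_Ex1 _ _ _ _ _ P (iid P n)
      (fun z => (t + u z.1 + tsum z.2 u) ^+ 2 * tsum z.2 w)); bmt.
  - apply: bmM; first exact: bm_cst.
    by apply: (@bm_Ex1 _ _ _ _ _ P (iid P n) _ (bUS n (t + b))).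
  - move=> x /=; apply: (le_trans (ih (t + u x) _)); first by rewrite addr_ge0.
    by rewrite [t + b + u x]addrAC.
have h2 : Ex P w * EU2 n (t + b) <= Ex P w * EU2 n.+1 (t + b).
  by rewrite ler_wpM2l// le_EU2S// addr_ge0.
by rewrite -natr1; move: h h2; rewrite /EU2; lra.
Qed.

Let mixed_moment2 n t : 0 <= t ->
  Ex (iid P n) (fun D => (t + tsum D u) ^+ 2 * tsum D w ^+ 2) <=
  (n%:R * Ex P (fun x => w x ^+ 2) + n%:R ^+ 2 * Ex P w ^+ 2) * EU2 n (t + b + b).
Proof.
elim: n t => [|n ih] t t0.
  by rewrite Ex_iid0 ?tsum0 ?mulr0 ?expr0n/= ?mul0r ?add0r ?mul0r ?mulr0//; apply: bmM => //; bmt.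
rewrite Ex_iidS; last by apply: bmM => //; bmt.
have bU2 : bm (fun z : T * n.-tuple T => tsum z.2 u) by exact: (bm_snd (bU n)).
have bW2 : bm (fun z : T * n.-tuple T => tsum z.2 w) by exact: (bm_snd (bW n)).
have bu1 : bm (fun z : T * n.-tuple T => u z.1) by exact: bm_fst.
have bw1 : bm (fun z : T * n.-tuple T => w z.1) by exact: bm_fst.
apply: (@le_trans _ _ (Ex (P \x iid P n)%E (fun z =>
   w z.1 ^+ 2 * (t + b + tsum z.2 u) ^+ 2 +
   2 * (w z.1 * ((t + b + tsum z.2 u) ^+ 2 * tsum z.2 w)) +
   (t + u z.1 + tsum z.2 u) ^+ 2 * tsum z.2 w ^+ 2))).
  apply: le_Ex; [|bmt|].
    exact: (bm_tuple_cons (bmM (bUt n.+1 t) (bmX 2 (bW n.+1)))).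
  move=> z; rewrite !tsum_cons addrA.
  have h : (t + u z.1 + tsum z.2 u) ^+ 2 <= (t + b + tsum z.2 u) ^+ 2.
    by have := u0 z.1; have := U0 z.2; have := ub z.1; nra.
  have h1 : 0 <= w z.1 ^+ 2 by exact: sqr_ge0.
  have h2 : 0 <= w z.1 * tsum z.2 w by rewrite mulr_ge0.
  by have := ler_wpM2l h1 h; have := ler_wpM2l h2 h; lra.
rewrite ExD; [|bmt|bmt].
rewrite ExD; [|bmt|bmt].
rewrite ExZ; last by bmt.
rewrite (Ex_prodM P (iid P n) (bmX 2 bw) (bUt n (t + b))).
rewrite (Ex_prodM P (iid P n) bw (bmM (bUt n (t + b)) (bW n))).
have h : Ex (P \x iid P n)%E (fun z => (t + u z.1 + tsum z.2 u) ^+ 2 * tsum z.2 w ^+ 2) <=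
    (n%:R * Ex P (fun x => w x ^+ 2) + n%:R ^+ 2 * Ex P w ^+ 2) * EU2 n.+1 (t + b + b).
  rewrite Ex_prod; last by bmt.
  rewrite EU2S Ex_prod; last exact: bUS.
  rewrite -ExZ; last by apply: (@bm_Ex1 _ _ _ _ _ P (iid P n) _ (bUS n (t + b + b))).
  apply: le_Ex.
  - by apply: (@bm_Ex1 _ _ _ _ _ P (iid P n)
      (fun z => (t + u z.1 + tsum z.2 u) ^+ 2 * tsum z.2 w ^+ 2)); bmt.
  - apply: bmM; first exact: bm_cst.
    by apply: (@bm_Ex1 _ _ _ _ _ P (iid P n) _ (bUS n (t + b + b))).
  - move=> x /=; apply: (le_trans (ih (t + u x) _)); first by rewrite addr_ge0.
    by rewrite [t + b + b + u x]addrAC [t + b + u x]addrAC.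
have tb0 : 0 <= t + b by rewrite addr_ge0.
have tbb0 : 0 <= t + b + b by rewrite addr_ge0.
have Ew20 : 0 <= Ex P (fun x => w x ^+ 2) by apply: Ex_ge0 => x; exact: sqr_ge0.
have h2 : Ex P (fun x => w x ^+ 2) * EU2 n (t + b) <=
    Ex P (fun x => w x ^+ 2) * EU2 n.+1 (t + b + b).
  by rewrite ler_wpM2l// (le_trans (le_EU2S _ _))// le_EU2// lerDl.
have h3 : Ex P w * Ex (iid P n) (fun D => (t + b + tsum D u) ^+ 2 * tsum D w) <=
    Ex P w * (n%:R * Ex P w * EU2 n.+1 (t + b + b)).
  rewrite ler_wpM2l// (le_trans (mixed_moment1 n tb0))// ler_wpM2l ?mulr_ge0//.
  exact: le_EU2S.
have h4 : 0 <= Ex P w ^+ 2 * EU2 n.+1 (t + b + b) by rewrite mulr_ge0// sqr_ge0.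
have h5 : 0 <= n%:R * (Ex P w ^+ 2 * EU2 n.+1 (t + b + b)) by rewrite mulr_ge0.
by rewrite -natr1; move: h h2 h3 h4 h5; rewrite /EU2; lra.
Qed.

(** The bound is linear in the second moment of w, although u and w are evaluated on the same sample. For this the sum of the u is bounded after giving up at most two of its terms, at the price 2b, instead of applying the Cauchy-Schwarz inequality. *)
Lemma Ex_sqr_sqr_le n :
  Ex (iid P n) (fun D => tsum D u ^+ 2 * tsum D w ^+ 2) <=
  (n%:R * Ex P (fun x => w x ^+ 2) + n%:R ^+ 2 * Ex P w ^+ 2) *
  (8 * b ^+ 2 + 2 * (n%:R * Ex P (fun x => u x ^+ 2) + n%:R ^+ 2 * Ex P u ^+ 2)).
Proof.
have Ew20 : 0 <= Ex P (fun x => w x ^+ 2) by apply: Ex_ge0 => x; exact: sqr_ge0.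
under eq_fun do rewrite -[tsum _ u]add0r.
apply: (le_trans (mixed_moment2 n (lexx 0))).
rewrite ler_wpM2l//; first by rewrite addr_ge0 ?mulr_ge0 ?sqr_ge0.
rewrite /EU2 add0r.
apply: (@le_trans _ _ (Ex (iid P n) (fun D => 8 * b ^+ 2 + 2 * (tsum D u * tsum D u)))).
  apply: le_Ex; [exact: bUt|by have bUn := bU n; bmt|].
  (* (2b + U)^2 <= 2 (2b)^2 + 2 U^2 *)
  move=> D; have := sqr_ge0 (b + b - tsum D u); lra.
rewrite ExD; [|bmt|by have bUn := bU n; bmt].
rewrite Ex_cst ExZ; last by have bUn := bU n; bmt.
rewrite Ex_tsumM// lerD2l ler_wpM2l//.
rewrite -expr2 (_ : Ex P (fun x => u x * u x) = Ex P (fun x => u x ^+ 2)); last first.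
  by congr Ex; apply/funext => x; rewrite expr2.
rewrite lerD2l ler_wpM2r ?sqr_ge0// gerBl//.
Qed.

End two_nonneg_sums.
End samples.

(** * Orthonormal families, empirical means and sample splitting *)

Section orthonormal_families.
Context {dT : measure_display} {T : measurableType dT} {R : realType}.
Variable P : probability T R.
Implicit Types f g : T -> R.

Definition dot f g : R := Ex P (fun x => f x * g x).

Definition onfamily (I : finType) (phi : I -> T -> R) :=
  forall i j, dot (phi i) (phi j) = (i == j)%:R.

Lemma dotC f g : dot f g = dot g f.
Proof. by congr Ex; apply/funext => x; rewrite mulrC. Qed.

Lemma dot_sumr (I : finType) f (a : I -> R) (phi : I -> T -> R) :
  bm f -> (forall i, bm (phi i)) ->
  dot f (fun x => \sum_i a i * phi i x) = \sum_i a i * dot f (phi i).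
Proof.
move=> bf bphi; rewrite /dot.
under eq_fun do rewrite big_distrr/=.
rewrite Ex_sum; last by move=> i; bmt.
apply: eq_bigr => i _; rewrite -ExZ; last by bmt.
by congr Ex; apply/funext => x; rewrite mulrCA.
Qed.

Lemma dot_suml (I : finType) f (a : I -> R) (phi : I -> T -> R) :
  bm f -> (forall i, bm (phi i)) ->
  dot (fun x => \sum_i a i * phi i x) f = \sum_i a i * dot (phi i) f.
Proof.
move=> bf bphi; rewrite dotC dot_sumr//.
by apply: eq_bigr => i _; rewrite dotC.
Qed.

Lemma dotDl f g h : bm f -> bm g -> bm h ->
  dot (fun x => f x + g x) h = dot f h + dot g h.
Proof.
move=> bf bg bh; rewrite /dot -ExD; [|bmt|bmt].
by congr Ex; apply/funext => x; rewrite mulrDl.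
Qed.

Lemma dotBl f g h : bm f -> bm g -> bm h ->
  dot (fun x => f x - g x) h = dot f h - dot g h.
Proof.
move=> bf bg bh; rewrite /dot -ExB; [|bmt|bmt].
by congr Ex; apply/funext => x; rewrite mulrBl.
Qed.

Lemma dotBr f g h : bm f -> bm g -> bm h ->
  dot h (fun x => f x - g x) = dot h f - dot h g.
Proof. by move=> bf bg bh; rewrite dotC dotBl// ![dot h _]dotC. Qed.

Lemma dotff f : dot f f = Ex P (fun x => f x ^+ 2).
Proof. by congr Ex; apply/funext => x; rewrite expr2. Qed.

Lemma dotff_ge0 f : 0 <= dot f f.
Proof. by rewrite dotff; apply: Ex_ge0 => x; exact: sqr_ge0. Qed.

Lemma dot_CS f g : bm f -> bm g -> dot f g ^+ 2 <= dot f f * dot g g.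
Proof. by move=> bf bg; rewrite !dotff; exact: Ex_CS. Qed.

Section one_family.
Variables (I : finType) (phi : I -> T -> R).
Hypotheses (bphi : forall i, bm (phi i)) (on : onfamily phi).

Definition l2proj f x : R := \sum_i dot f (phi i) * phi i x.

Lemma bm_lincomb (a : I -> R) : bm (fun x => \sum_i a i * phi i x).
Proof. by bmt. Qed.

Lemma bm_l2proj f : bm (l2proj f). Proof. exact: bm_lincomb. Qed.

Lemma dot_lincomb (a b : I -> R) :
  dot (fun x => \sum_i a i * phi i x) (fun x => \sum_i b i * phi i x) = \sum_i a i * b i.
Proof.
rewrite dot_sumr//; last exact: bm_lincomb.
apply: eq_bigr => i _; rewrite dot_suml// (bigD1 i)//= big1 ?addr0.
  by rewrite on eqxx mulr1 mulrC.
by move=> j ji; rewrite on (negbTE ji) mulr0.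
Qed.

Lemma dot_lincomb_basis (a : I -> R) j :
  dot (fun x => \sum_i a i * phi i x) (phi j) = a j.
Proof.
rewrite dot_suml// (bigD1 j)//= big1 ?addr0; first by rewrite on eqxx mulr1.
by move=> i ij; rewrite on (negbTE ij) mulr0.
Qed.

(** Both projections are removed at once: the cross terms reduce to the scalar product of the coefficients. *)
Lemma dot_residual f g : bm f -> bm g ->
  dot (fun x => f x - l2proj f x) (fun x => g x - l2proj g x) =
  dot f g - \sum_i dot f (phi i) * dot g (phi i).
Proof.
move=> bf bg; have bpf := bm_l2proj f; have bpg := bm_l2proj g.
rewrite dotBl; [|by []|by []|by bmt].
rewrite !dotBr// [dot (l2proj f) (l2proj g)]dot_lincomb [dot f (l2proj g)]dot_sumr//.
rewrite [dot (l2proj f) g]dot_suml//.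
rewrite (eq_bigr (fun i => dot f (phi i) * dot g (phi i))); last by move=> i _; rewrite mulrC.
rewrite [X in _ - (X - _)](eq_bigr (fun i => dot f (phi i) * dot g (phi i))).
  by rewrite subrr subr0.
by move=> i _; rewrite [dot (phi i) g]dotC.
Qed.

Lemma bessel f : bm f -> \sum_i dot f (phi i) ^+ 2 <= dot f f.
Proof.
move=> bf; rewrite -subr_ge0.
have := dot_residual bf bf.
rewrite (eq_bigr (fun i => dot f (phi i) ^+ 2)) => [<-|i _]; last by rewrite expr2.
exact: dotff_ge0.
Qed.

End one_family.

Lemma ae_eq_dot f f' g : bm f -> bm f' -> bm g -> {ae P, forall x, f x = f' x} ->
  dot f g = dot f' g.
Proof.
move=> bf bf' bg ff'; apply: ae_eq_Ex; [bmt|bmt|].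
by apply: filterS ff' => x /= ->.
Qed.

End orthonormal_families.

Section empirical_means.
Context {dT : measure_display} {T : measurableType dT} {R : realType}.
Implicit Types f g : T -> R.

Definition mean n (D : n.-tuple T) f : R := n%:R^-1 * \sum_(i < n) f (tnth D i).

Lemma mean_tsum n (D : n.-tuple T) f : mean D f = n%:R^-1 * tsum D f.
Proof. by []. Qed.

Lemma bm_mean n f : bm f -> bm (fun D : n.-tuple T => mean D f).
Proof. by move=> bf; have bt := bm_tsum n bf; rewrite /mean; bmt. Qed.

Lemma mean_sum n (D : n.-tuple T) (I : finType) (a : I -> R) (F : I -> T -> R) :
  mean D (fun x => \sum_i a i * F i x) = \sum_i a i * mean D (F i).
Proof.
rewrite mean_tsum tsum_sum big_distrr; apply: eq_bigr => i _ /=.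
by rewrite tsumZ mean_tsum mulrCA.
Qed.

Variable P : probability T R.

Definition dev n (D : n.-tuple T) f : R := mean D f - Ex P f.

Lemma bm_dev n f : bm f -> bm (fun D : n.-tuple T => dev D f).
Proof. by move=> bf; have bt := bm_mean n bf; rewrite /dev; bmt. Qed.

Lemma dev_sum n (D : n.-tuple T) (I : finType) (a : I -> R) (F : I -> T -> R) :
  (forall i, bm (F i)) ->
  dev D (fun x => \sum_i a i * F i x) = \sum_i a i * dev D (F i).
Proof.
move=> bF; rewrite /dev mean_sum Ex_sum; last by move=> i; bmt.
rewrite -sumrB; apply: eq_bigr => i _.
by rewrite ExZ// mulrBr.
Qed.

Lemma dev_tsum n (D : n.-tuple T) f : (0 < n)%N ->
  dev D f = n%:R^-1 * tsum D (fun x => f x - Ex P f).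
Proof.
move=> n0; rewrite /dev /tsum sumrB mulrBr mean_tsum; congr (_ - _).
have := tsum_cst D (Ex P f); rewrite /tsum => ->.
by rewrite mulKf// pnatr_eq0 -lt0n.
Qed.

Lemma Ex_centered f : bm f -> Ex P (fun x => f x - Ex P f) = 0.
Proof. by move=> bf; rewrite ExB// ?Ex_cst ?subrr//; exact: bm_cst. Qed.

Lemma Ex_centered_sqr f : bm f ->
  Ex P (fun x => (f x - Ex P f) ^+ 2) <= Ex P (fun x => f x ^+ 2).
Proof.
move=> bf; set e := Ex P f.
rewrite (_ : (fun _ => _) = (fun x => f x ^+ 2 + ((- 2 * e) * f x + e ^+ 2))); last first.
  by apply/funext => x; ring.
rewrite ExD; [|bmt|bmt].
rewrite ExD; [|bmt|bmt].
rewrite ExZ// Ex_cst -/e; have := sqr_ge0 e; lra.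
Qed.

Lemma Ex_dev_sqr n f : (0 < n)%N -> bm f ->
  Ex (iid P n) (fun D => dev D f ^+ 2) <= Ex P (fun x => f x ^+ 2) / n%:R.
Proof.
move=> n0 bf; pose g x := f x - Ex P f.
have bg : bm g by rewrite /g; bmt.
have g0 : Ex P g = 0 by exact: Ex_centered.
rewrite (_ : (fun _ => _) = fun D => n%:R^-1 ^+ 2 * (tsum D g * tsum D g)); last first.
  by apply/funext => D; rewrite dev_tsum// -/g; ring.
have bt := bm_tsum n bg.
rewrite ExZ; last by bmt.
rewrite Ex_tsumM// g0 !mulr0 addr0 (_ : Ex P _ = Ex P (fun x => g x ^+ 2)); last first.
  by congr Ex; apply/funext => x; rewrite expr2.
rewrite mulrA expr2 -(mulrA _ _ n%:R) mulVf ?mulr1 ?pnatr_eq0 -?lt0n//.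
by rewrite mulrC ler_wpM2r// ?invr_ge0//; exact: Ex_centered_sqr.
Qed.

(** Centering the f_m at most multiplies the bound on the squared norm by 4, and 3 * 4^2 = 48. *)
Lemma Ex_dev_norm4 n (I : finType) (f : I -> T -> R) (B : R) : (0 < n)%N ->
  (forall m, bm (f m)) -> {ae P, forall x, \sum_m f m x ^+ 2 <= B} ->
  Ex (iid P n) (fun D => (\sum_m dev D (f m) ^+ 2) ^+ 2) <= 48 * B ^+ 2 / n%:R ^+ 2.
Proof.
move=> n0 bf fB; pose g m x := f m x - Ex P (f m).
have bg m : bm (g m) by rewrite /g; bmt.
have g0 m : Ex P (g m) = 0 by exact: Ex_centered.
have bq : bm (fun x => \sum_m f m x ^+ 2) by apply: bm_sum => m; exact: bmX.
have EB : \sum_m Ex P (f m) ^+ 2 <= B.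
  apply: (@le_trans _ _ (Ex P (fun x => \sum_m f m x ^+ 2))).
    rewrite Ex_sum; last by move=> m; exact: bmX.
    by apply: ler_sum => m _; exact: sqr_Ex_le.
  rewrite -[leRHS](Ex_cst P B); apply: ae_le_Ex => //; exact: bm_cst.
have gB : {ae P, forall x, \sum_m g m x ^+ 2 <= 4 * B}.
  apply: filterS fB => x /= fB.
  apply: (@le_trans _ _ (2 * \sum_m f m x ^+ 2 + 2 * \sum_m Ex P (f m) ^+ 2)); last by lra.
  rewrite !big_distrr/= -big_split; apply: ler_sum => m _ /=.
  by rewrite /g; have := sqr_ge0 (f m x + Ex P (f m)); lra.
rewrite (_ : (fun _ => _) = fun D => n%:R^-1 ^+ 4 * (\sum_m tsum D (g m) ^+ 2) ^+ 2); last first.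
  apply/funext => D; rewrite (eq_bigr (fun m => n%:R^-1 ^+ 2 * tsum D (g m) ^+ 2)).
    by rewrite -big_distrr/= exprMn -exprM.
  by move=> m _; rewrite dev_tsum// exprMn.
have bt m := bm_tsum n (bg m).
rewrite ExZ; last by bmt.
apply: (le_trans (ler_wpM2l _ (Ex_norm4_le n bg g0 gB))); first by rewrite exprn_ge0 ?invr_ge0.
have n1 : (n%:R : R) != 0 by rewrite pnatr_eq0 -lt0n.
by rewrite le_eqVlt; apply/orP; left; apply/eqP; field.
Qed.

Lemma Ex_dev_dev n (I : finType) (f g : I -> T -> R) (B : R) : (0 < n)%N ->
  (forall m, bm (f m)) -> {ae P, forall x, \sum_m f m x ^+ 2 <= B} ->
  (forall m, bm (g m)) -> {ae P, forall x, \sum_m g m x ^+ 2 <= B} ->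
  Ex (iid P n) (fun D => (\sum_m dev D (f m) * dev D (g m)) ^+ 2) <= 48 * B ^+ 2 / n%:R ^+ 2.
Proof.
move=> n0 bf fB bg gB.
have bdf m := bm_dev n (bf m); have bdg m := bm_dev n (bg m).
apply: (@le_trans _ _ (Ex (iid P n) (fun D => 2^-1 * (\sum_m dev D (f m) ^+ 2) ^+ 2 +
    2^-1 * (\sum_m dev D (g m) ^+ 2) ^+ 2))).
  apply: le_Ex; [by bmt|by bmt|] => D.
  apply: (le_trans (sum_CS _ _)).
  set a := \sum_i _; set b := \sum_i _; have := sqr_ge0 (a - b); lra.
rewrite ExD; [|bmt|bmt].
rewrite ExZ; last by bmt.
rewrite ExZ; last by bmt.
move: (Ex_dev_norm4 n0 bf fB) (Ex_dev_norm4 n0 bg gB).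
by move: (48 * B ^+ 2 / _) (Ex _ _) (Ex _ _) => x y z; lra.
Qed.

End empirical_means.

Section three_samples.
Context {d : measure_display} {U : measurableType d} {R : realType}.
Variable mu : probability U R.

Lemma Ex_third (f : U * U -> R) : bm f ->
  Ex ((mu \x mu) \x mu)%E (fun D => f (D.1.1, D.2)) = Ex (mu \x mu)%E f.
Proof.
move=> bf; have bf3 : bm (fun D : U * U * U => f (D.1.1, D.2)).
  apply: bm_comp bf; apply: measurable_fun_pair; last exact: measurable_snd.
  by apply: measurableT_comp => //; exact: measurable_fst.
rewrite Ex_prod//= Ex_prod//.
exact: (Ex_fst mu mu (bm_Ex1 mu mu bf)).
Qed.

Lemma bm_first (f : U -> R) : bm f -> bm (fun D : U * U * U => f D.1.1).
Proof. by move=> bf; exact: (bm_fst (bm_fst bf)). Qed.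

Lemma bm_second (f : U -> R) : bm f -> bm (fun D : U * U * U => f D.1.2).
Proof. by move=> bf; exact: (bm_fst (bm_snd bf)). Qed.

Lemma Ex_first (f : U -> R) : bm f ->
  Ex ((mu \x mu) \x mu)%E (fun D => f D.1.1) = Ex mu f.
Proof.
by move=> bf; rewrite (Ex_fst (mu \x mu)%E mu (bm_fst bf)) (Ex_fst mu mu bf).
Qed.

Lemma Ex_second (f : U -> R) : bm f ->
  Ex ((mu \x mu) \x mu)%E (fun D => f D.1.2) = Ex mu f.
Proof.
by move=> bf; rewrite (Ex_fst (mu \x mu)%E mu (bm_snd bf)) (Ex_snd mu mu bf).
Qed.

End three_samples.

Section conditional_variance.
Context {d1 d2 : measure_display} {T1 : measurableType d1} {T : measurableType d2}
  {R : realType}.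
Variables (mu : probability T1 R) (P : probability T R) (F : T1 * T -> R).
Hypothesis bF : bm F.

Lemma bm_mean_pair n : bm (fun z : T1 * n.-tuple T => mean z.2 (fun x => F (z.1, x))).
Proof.
rewrite /mean; apply: bmM; first exact: bm_cst.
apply: bm_sum => i; apply: bm_comp bF; apply: measurable_fun_pair.
  exact: measurable_fst.
exact: (measurableT_comp (measurable_tnth i) measurable_snd).
Qed.

Lemma bm_Ex_pair n : bm (fun z : T1 * n.-tuple T => Ex P (fun x => F (z.1, x))).
Proof. exact: (bm_fst (bm_Ex1 mu P bF)). Qed.

(** Conditionally on the first sample the mean over the second one is an average of independent terms. *)
Lemma Ex_conditional_variance n : (0 < n)%N ->
  Ex (mu \x iid P n)%E (fun z =>
    (mean z.2 (fun x => F (z.1, x)) - Ex P (fun x => F (z.1, x))) ^+ 2) <=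
  Ex (mu \x P)%E (fun z => F z ^+ 2) / n%:R.
Proof.
move=> n0; have b1 := bm_mean_pair n; have b2 := bm_Ex_pair n.
have b3 : bm (fun z : T1 * n.-tuple T =>
    (mean z.2 (fun x => F (z.1, x)) - Ex P (fun x => F (z.1, x))) ^+ 2) by bmt.
have b4 : bm (fun z => F z ^+ 2) by bmt.
rewrite Ex_prod//= Ex_prod// -ExZr; last exact: (bm_Ex1 mu P b4).
apply: le_Ex.
- exact: (bm_Ex1 mu (iid P n) b3).
- by apply: bmM; [exact: (bm_Ex1 mu P b4)|exact: bm_cst].
- by move=> x; exact: (Ex_dev_sqr P n0 (bm_pair1 bF x)).
Qed.

End conditional_variance.

Section plug_in.
Context {dT : measure_display} {T : measurableType dT} {R : realType}.
Implicit Types (Z : T -> R).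

(** The estimates phat and bhat of the regression functions: the empirical counterpart of the projection of E[Z | X] on the span of phi. *)
Definition emp_proj Z (I : finType) (phi : I -> T -> R) n (D : n.-tuple T) x : R :=
  \sum_i mean D (fun x => Z x * phi i x) * phi i x.

Lemma bm_emp_proj Z (I : finType) (phi : I -> T -> R) n : bm Z -> (forall i, bm (phi i)) ->
  bm (fun z : n.-tuple T * T => emp_proj Z phi z.1 z.2).
Proof.
move=> bZ bphi; apply: bm_sum => i; apply: bmM; last exact: (bm_snd (bphi i)).
exact: (bm_fst (bm_mean n (bmM bZ (bphi i)))).
Qed.

Variables (P : probability T R) (A Y : T -> R) (I J : finType).
Variables (phi : I -> T -> R) (chi : J -> T -> R).
Hypotheses (bA : bm A) (bY : bm Y) (bphi : forall i, bm (phi i)) (bchi : forall j, bm (chi j)).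

(** The inner product of the two empirical projections, in terms of their coefficients. *)
Definition cross n (D : n.-tuple T) : R :=
  \sum_i \sum_j mean D (fun x => A x * phi i x) * mean D (fun x => Y x * chi j x) *
    dot P (phi i) (chi j).

Lemma bm_cross n : bm (fun D : n.-tuple T => cross D).
Proof.
have hA i := bm_mean n (bmM bA (bphi i)); have hY j := bm_mean n (bmM bY (bchi j)).
by rewrite /cross; bmt.
Qed.

Lemma dot_emp_proj n (D : n.-tuple T) :
  dot P (emp_proj A phi D) (emp_proj Y chi D) = cross D.
Proof.
rewrite dot_suml//; last exact: bm_lincomb.
apply: eq_bigr => i _; rewrite dot_sumr// big_distrr; apply: eq_bigr => j _ /=.
by rewrite mulrA.
Qed.

End plug_in.

(** * Risk of the three estimators for abstract nested orthonormal families *)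

Section estimation.
Context {dT : measure_display} {T : measurableType dT} {R : realType}.
Variable P : probability T R.
Variables (A Y p b : T -> R) (Bd : R).
Hypotheses (bA : bm A) (bY : bm Y) (bp : bm p) (bb : bm b).
Hypotheses (Bd1 : 1 <= Bd) (AB : forall x, `|A x| <= Bd) (YB : forall x, `|Y x| <= Bd).
Hypotheses (pB : dot P p p <= Bd ^+ 2) (bB : dot P b b <= Bd ^+ 2).
Variables (I J : finType) (phi : I -> T -> R) (chi : J -> T -> R).
Hypotheses (bphi : forall i, bm (phi i)) (bchi : forall j, bm (chi j)).
Hypotheses (onphi : onfamily P phi) (onchi : onfamily P chi).
Let G i j := dot P (phi i) (chi j).
Hypothesis nested : forall i, {ae P, forall x, phi i x = \sum_j G i j * chi j x}.
Hypotheses (Aphi : forall i, dot P A (phi i) = dot P p (phi i))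
  (Achi : forall j, dot P A (chi j) = dot P p (chi j))
  (Yphi : forall i, dot P Y (phi i) = dot P b (phi i))
  (Ychi : forall j, dot P Y (chi j) = dot P b (chi j)).
Variables (c k k' : R).
Hypotheses (c1 : 1 <= c) (k0 : 0 <= k) (k'0 : 0 <= k').
Let Kphi x y := \sum_i phi i x * phi i y.
Let Kchi x y := \sum_j chi j x * chi j y.
Hypotheses (Kphi_le : forall x y, `|Kphi x y| <= c * k)
  (Kphi_L1 : forall y, Ex P (fun x => `|Kphi x y|) <= c)
  (Kchi_diag : forall y, Kchi y y <= c * k')
  (Kchi_L1 : forall y, Ex P (fun x => `|Kchi x y|) <= c).

Local Notation cross := (cross P A Y phi chi).
Local Notation phatx := (emp_proj A phi).
Local Notation bhatx := (emp_proj Y chi).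

Let bAphi i : bm (fun x => A x * phi i x). Proof. exact: (bmM bA (bphi i)). Qed.
Let bYchi j : bm (fun x => Y x * chi j x). Proof. exact: (bmM bY (bchi j)). Qed.
Let mA n (D : n.-tuple T) i := mean D (fun x => A x * phi i x).
Let mY n (D : n.-tuple T) j := mean D (fun x => Y x * chi j x).
Let bmA n i : bm (fun D : n.-tuple T => mA D i).
Proof. exact: (bm_mean n (bAphi i)). Qed.
Let bmY n j : bm (fun D : n.-tuple T => mY D j).
Proof. exact: (bm_mean n (bYchi j)). Qed.

Let bm_cross n : bm (fun D : n.-tuple T => cross D) := bm_cross P bA bY bphi bchi n.

Let a i := dot P p (phi i).
Let gam j := dot P p (chi j).
Let be i := dot P b (phi i).
Let cc j := dot P b (chi j).
Let phit i x := \sum_j G i j * chi j x.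
Let bphit i : bm (phit i). Proof. exact: bm_lincomb. Qed.
Let aG j := \sum_i a i * G i j.

(** The coefficients of b on the fine family determine those on the coarse one, because the coarse functions lie in the span of the fine ones. *)
Let Gcc i : \sum_j G i j * cc j = be i.
Proof.
rewrite /be (_ : dot P b (phi i) = dot P b (phit i)); first by rewrite dot_sumr.
by rewrite [LHS]dotC [RHS]dotC; apply: ae_eq_dot.
Qed.

(** aG is the vector of the coefficients on chi of the projection of p on phi. *)
Let aG_le : \sum_j aG j ^+ 2 <= Bd ^+ 2.
Proof.
have bq : bm (l2proj P phi p) by exact: bm_l2proj.
apply: (@le_trans _ _ (dot P (l2proj P phi p) (l2proj P phi p))); last first.
  rewrite dot_lincomb//; apply: le_trans pB.
  by apply: le_trans (bessel bphi onphi bp); apply: ler_sum => i _; rewrite expr2.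
apply: le_trans (bessel bchi onchi bq); apply: ler_sum => j _.
by rewrite /l2proj dot_suml.
Qed.

(** The degenerate part of cross. Summing the fine coefficients against G before centering turns the fine family into phit, which equals phi almost everywhere: this is why only the coarse dimension enters its size. *)
Let quad n (D : n.-tuple T) := \sum_i dev P D (fun x => A x * phi i x) *
  dev P D (fun x => Y x * phit i x).

Let bYphit i : bm (fun x => Y x * phit i x). Proof. exact: (bmM bY (bphit i)). Qed.

Let bquad n : bm (fun D : n.-tuple T => quad D).
Proof.
have h1 i := bm_dev P n (bAphi i); have h2 i := bm_dev P n (bYphit i).
by rewrite /quad; bmt.
Qed.

Let sqr_weighted (I' : finType) (f : I' -> T -> R) (Z : T -> R) (B : R) x :
  `|Z x| <= Bd -> \sum_i f i x ^+ 2 <= B -> \sum_i (Z x * f i x) ^+ 2 <= Bd ^+ 2 * B.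
Proof.
move=> ZB fB; have f0 : 0 <= \sum_i f i x ^+ 2 by apply: sumr_ge0 => i _; exact: sqr_ge0.
under eq_bigr do rewrite exprMn.
rewrite -big_distrr/=; apply: ler_pM => //; first exact: sqr_ge0.
by rewrite -real_normK ?num_real// lerXn2r ?nnegrE// (le_trans _ Bd1).
Qed.

Let Kphi_diag x : \sum_i phi i x ^+ 2 <= c * k.
Proof.
apply: le_trans (Kphi_le x x); apply: le_trans (ler_norm _).
by rewrite le_eqVlt; apply/orP; left; apply/eqP/eq_bigr => i _; rewrite expr2.
Qed.

Let Ex_quad n : (0 < n)%N ->
  Ex (iid P n) (fun D => quad D ^+ 2) <= 48 * (Bd ^+ 2 * (c * k)) ^+ 2 / n%:R ^+ 2.
Proof.
move=> n0; have h x := sqr_weighted (AB x) (Kphi_diag x).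
apply: Ex_dev_dev => //; first exact: aeW.
have : {ae P, forall x, forall i, phi i x = phit i x} by apply: filter_forall.
apply: filterS => x /= e; apply: sqr_weighted => //.
by under eq_bigr do rewrite -e.
Qed.

Let Ex_dev_linear n (Z v : T -> R) (B : R) : (0 < n)%N -> bm Z -> bm v ->
  (forall x, `|Z x| <= Bd) -> dot P v v <= B ->
  Ex (iid P n) (fun D => dev P D (fun x => Z x * v x) ^+ 2) <= Bd ^+ 2 * B / n%:R.
Proof.
move=> n0 bZ bv ZB vB.
apply: (le_trans (Ex_dev_sqr P n0 (bmM bZ bv))).
rewrite ler_wpM2r ?invr_ge0//.
apply: (@le_trans _ _ (Ex P (fun x => Bd ^+ 2 * v x ^+ 2))).
  apply: le_Ex; [bmt|bmt|] => x; rewrite exprMn ler_wpM2r ?sqr_ge0//.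
  by rewrite -real_normK ?num_real// lerXn2r ?nnegrE// (le_trans _ Bd1).
by rewrite ExZ; [rewrite ler_wpM2l ?sqr_ge0// -dotff|bmt].
Qed.

Let v x := \sum_i be i * phi i x.
Let u x := \sum_j aG j * chi j x.
Let u2 x := \sum_j (aG j - gam j) * chi j x.

Let mAE n (D : n.-tuple T) i : mA D i = a i + dev P D (fun x => A x * phi i x).
Proof. by rewrite /dev -[Ex P _]/(dot P A (phi i)) Aphi addrC subrK. Qed.

Let mYE n (D : n.-tuple T) j : mY D j = cc j + dev P D (fun x => Y x * chi j x).
Proof. by rewrite /dev -[Ex P _]/(dot P Y (chi j)) Ychi addrC subrK. Qed.

Let dev_weighted n (D : n.-tuple T) (I' : finType) (w : I' -> R) (f : I' -> T -> R) (Z : T -> R) :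
  bm Z -> (forall i, bm (f i)) ->
  dev P D (fun x => Z x * (\sum_i w i * f i x)) = \sum_i w i * dev P D (fun x => Z x * f i x).
Proof.
move=> bZ bf; rewrite -dev_sum; last by move=> i; exact: (bmM bZ (bf i)).
congr dev; apply/funext => x; rewrite big_distrr/=.
by apply: eq_bigr => i _; rewrite mulrCA.
Qed.

(** Each empirical coefficient is its mean plus a centered deviation. Products of means give the deterministic part, products of one mean and one deviation collapse to a single deviation by linearity, and products of two deviations form quad. *)
Let cross_decomp n (D : n.-tuple T) : cross D = \sum_i a i * be i +
  dev P D (fun x => A x * v x) + dev P D (fun x => Y x * u x) + quad D.
Proof.
rewrite /v /u /quad !dev_weighted// /cross.
pose dA i := dev P D (fun x => A x * phi i x).
pose dY j := dev P D (fun x => Y x * chi j x).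
(* The three groups are compared inside the double sum over i and j, so the linear term in Y is first written as such a sum. *)
rewrite [X in _ + X + _](_ : _ = \sum_i \sum_j a i * G i j * dY j); last first.
  rewrite exchange_big; apply: eq_bigr => j _ /=; rewrite /aG.
  by rewrite big_distrl.
rewrite -!big_split; apply: eq_bigr => i _ /=.
rewrite dev_weighted// -Gcc !big_distrl !big_distrr/= -!big_split/=.
apply: eq_bigr => j _; rewrite -/(mA D i) -/(mY D j) mAE mYE -/(dA i) -/(dY j) -/(G i j).
ring.
Qed.

(** The first-order terms of IF subtract the linear deviation in A altogether, and leave a deterministic error that involves the fine family. *)
Let IF_decomp n (D : n.-tuple T) :
  dot P p b - \sum_i mA D i * be i - \sum_j mY D j * gam j + cross D =
  dot P p b - \sum_j cc j * gam j + dev P D (fun x => Y x * u2 x) + quad D.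
Proof.
rewrite cross_decomp /v /u2 /u !dev_weighted//.
under eq_bigr do rewrite mAE mulrDl.
under [\sum_j mY D j * _]eq_bigr do rewrite mYE mulrDl.
rewrite !big_split/=.
under [X in _ = _ + X + _]eq_bigr do rewrite mulrBl.
rewrite sumrB.
rewrite [\sum_i dev _ _ _ * be i](eq_bigr (fun i => be i * dev P D (fun x => A x * phi i x))); last first.
  by move=> i _; rewrite mulrC.
rewrite [\sum_j dev _ _ _ * gam j](eq_bigr (fun j => gam j * dev P D (fun x => Y x * chi j x))); last first.
  by move=> i _; rewrite mulrC.
by ring.
Qed.

Let v_le : dot P v v <= Bd ^+ 2.
Proof.
rewrite dot_lincomb//; apply: le_trans bB; apply: le_trans (bessel bphi onphi bb).
by apply: ler_sum => i _; rewrite expr2.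
Qed.

Let u_le : dot P u u <= Bd ^+ 2.
Proof. by rewrite dot_lincomb//; apply: le_trans aG_le; apply: ler_sum => i _; rewrite expr2. Qed.

Let u2_le : dot P u2 u2 <= 4 * Bd ^+ 2.
Proof.
rewrite dot_lincomb//.
apply: (@le_trans _ _ (2 * \sum_j aG j ^+ 2 + 2 * \sum_j gam j ^+ 2)).
  rewrite !big_distrr/= -big_split; apply: ler_sum => j _ /=.
  by have := sqr_ge0 (aG j + gam j); lra.
have := aG_le; have := le_trans (bessel bchi onchi bp) pB; rewrite -/(gam _); lra.
Qed.

Let bv : bm v. Proof. exact: bm_lincomb. Qed.
Let bu : bm u. Proof. exact: bm_lincomb. Qed.
Let bu2 : bm u2. Proof. exact: bm_lincomb. Qed.

(** Mean squared error of cross as an estimator of <p, b>. *)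
Lemma Ex_cross n : (0 < n)%N ->
  Ex (iid P n) (fun D => (cross D - dot P p b) ^+ 2) <=
  4 * ((dot P p b - \sum_i dot P p (phi i) * dot P b (phi i)) ^+ 2 +
       2 * Bd ^+ 4 / n%:R + 48 * Bd ^+ 4 * (c * k) ^+ 2 / n%:R ^+ 2).
Proof.
move=> n0; have bAv := bm_dev P n (bmM bA bv); have bYu := bm_dev P n (bmM bY bu).
have bq := bquad n; have bc := bm_cross n.
apply: (@le_trans _ _ (Ex (iid P n) (fun D => 4 * ((dot P p b - \sum_i a i * be i) ^+ 2 +
   (dev P D (fun x => A x * v x) ^+ 2 + (dev P D (fun x => Y x * u x) ^+ 2 +
    quad D ^+ 2)))))).
  apply: le_Ex; [by bmt|by bmt|] => D; rewrite cross_decomp.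
  set x := dot P p b - _; set y := dev _ _ _; set z := dev _ _ _; set t := quad D.
  rewrite (_ : _ - _ = y + z + t - x); last by rewrite /x; ring.
  have := sqr_ge0 (y - z); have := sqr_ge0 (y - t); have := sqr_ge0 (y + x).
  have := sqr_ge0 (z - t); have := sqr_ge0 (z + x); have := sqr_ge0 (t + x); lra.
rewrite ExZ; last by bmt.
rewrite ler_wpM2l// ExD; [|bmt|bmt].
rewrite Ex_cst -addrA lerD2l ExD; [|bmt|bmt].
rewrite ExD; [|bmt|bmt].
have h1 := Ex_dev_linear n0 bA bv AB v_le; have h2 := Ex_dev_linear n0 bY bu YB u_le.
have h3 := Ex_quad n0.
rewrite (_ : 2 * _ / _ = Bd ^+ 2 * Bd ^+ 2 / n%:R + Bd ^+ 2 * Bd ^+ 2 / n%:R); last by ring.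
rewrite -addrA; apply: lerD; [exact: h1|apply: lerD; [exact: h2|apply: (le_trans h3)]].
by rewrite le_eqVlt; apply/orP; left; apply/eqP; ring.
Qed.

Lemma Ex_IFbias n : (0 < n)%N ->
  Ex (iid P n) (fun D => (dot P p b - \sum_i mean D (fun x => A x * phi i x) * dot P b (phi i)
    - \sum_j mean D (fun x => Y x * chi j x) * dot P p (chi j) + cross D) ^+ 2) <=
  3 * ((dot P p b - \sum_j dot P p (chi j) * dot P b (chi j)) ^+ 2 +
       4 * Bd ^+ 4 / n%:R + 48 * Bd ^+ 4 * (c * k) ^+ 2 / n%:R ^+ 2).
Proof.
move=> n0; have bYu2 := bm_dev P n (bmM bY bu2).
have bq := bquad n; have bc := bm_cross n; have bmA' := bmA n; have bmY' := bmY n.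
apply: (@le_trans _ _ (Ex (iid P n) (fun D => 3 * ((dot P p b - \sum_j gam j * cc j) ^+ 2 +
   (dev P D (fun x => Y x * u2 x) ^+ 2 + quad D ^+ 2))))).
  apply: le_Ex; [by bmt|by bmt|] => D; rewrite [_ + cross D]IF_decomp.
  rewrite (eq_bigr (fun j => gam j * cc j)); last by move=> j _; rewrite mulrC.
  set x := dot P p b - _; set y := dev _ _ _; set t := quad D.
  have := sqr_ge0 (x - y); have := sqr_ge0 (x - t); have := sqr_ge0 (y - t); lra.
rewrite ExZ; last by bmt.
rewrite ler_wpM2l// ExD; [|bmt|bmt].
rewrite Ex_cst -addrA lerD2l ExD; [|bmt|bmt].
have h1 := Ex_dev_linear n0 bY bu2 YB u2_le.
have h3 := Ex_quad n0.
rewrite lerD//; [apply: (le_trans h1)|apply: (le_trans h3)].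
  by rewrite le_eqVlt; apply/orP; left; apply/eqP; ring.
by rewrite le_eqVlt; apply/orP; left; apply/eqP; ring.
Qed.

Let bph n : bm (fun z : n.-tuple T * T => phatx z.1 z.2) := bm_emp_proj n bA bphi.
Let bbh n : bm (fun z : n.-tuple T * T => bhatx z.1 z.2) := bm_emp_proj n bY bchi.

(** An empirical projection at x is an average of Z times the kernel at x. *)
Let Kbound (I' : finType) (f : I' -> T -> R) (Z : T -> R) n (D : n.-tuple T) x :
  (forall x, `|Z x| <= Bd) ->
  (\sum_i mean D (fun x => Z x * f i x) * f i x) ^+ 2 <=
  n%:R^-1 ^+ 2 * Bd ^+ 2 * tsum D (fun t => `|\sum_i f i t * f i x|) ^+ 2.
Proof.
move=> ZB; set S := \sum_i _.
have Bd0 : 0 <= Bd by apply: le_trans Bd1.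
have -> : S = n%:R^-1 * tsum D (fun t => Z t * \sum_i f i t * f i x).
  rewrite /S; under eq_bigr do rewrite mulrC.
  rewrite -mean_sum; congr (_ * _); apply: eq_bigr => j _.
  by rewrite big_distrr; apply: eq_bigr => i _ /=; ring.
rewrite exprMn -mulrA ler_wpM2l ?sqr_ge0// -exprMn -real_normK ?num_real//.
rewrite lerXn2r ?nnegrE// ?mulr_ge0//; first by apply: sumr_ge0.
apply: le_trans (ler_norm_sum _ _ _) _; rewrite /tsum big_distrr/=.
by apply: ler_sum => j _; rewrite normrM ler_wpM2r.
Qed.

Let bKphi x : bm (fun t => `|Kphi t x|). Proof. by rewrite /Kphi; bmt. Qed.
Let bKchi x : bm (fun t => `|Kchi t x|). Proof. by rewrite /Kchi; bmt. Qed.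

(** The reproducing property: the kernel at x has squared norm equal to its diagonal value. *)
Let EKsqr (I' : finType) (f : I' -> T -> R) x : (forall i, bm (f i)) -> onfamily P f ->
  Ex P (fun t => `|\sum_i f i t * f i x| ^+ 2) = \sum_i f i x ^+ 2.
Proof.
move=> bf onf; under eq_fun do rewrite real_normK ?num_real//.
rewrite (_ : (fun _ => _) = fun t => (\sum_i f i x * f i t) ^+ 2); last first.
  by apply/funext => t; congr (_ ^+ 2); apply: eq_bigr => i _; rewrite mulrC.
by rewrite -dotff dot_lincomb//; apply: eq_bigr => i _; rewrite expr2.
Qed.

Section rates.
Variable n : nat.
Hypotheses (n0 : (0 < n)%N) (kn : k <= c * n%:R).
Let nR : 0 < n%:R :> R. Proof. by rewrite ltr0n. Qed.
Let nne : n%:R != 0 :> R. Proof. by rewrite pnatr_eq0 -lt0n. Qed.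

Let c0 : 0 <= c. Proof. exact: le_trans c1. Qed.
Let Bd0 : 0 <= Bd. Proof. exact: le_trans Bd1. Qed.

Let sqr_hat_le (I' : finType) (f : I' -> T -> R) (Z : T -> R) (kk : R) x :
  (forall i, bm (f i)) -> onfamily P f -> bm Z -> (forall x, `|Z x| <= Bd) ->
  \sum_i f i x ^+ 2 <= c * kk -> Ex P (fun t => `|\sum_i f i t * f i x|) <= c ->
  Ex (iid P n) (fun D => (\sum_i mean D (fun x => Z x * f i x) * f i x) ^+ 2) <=
  Bd ^+ 2 * (c * kk / n%:R + c ^+ 2).
Proof.
move=> bf onf bZ ZB diag L1.
have bK : bm (fun t => `|\sum_i f i t * f i x|) by bmt.
have bKt := bm_tsum n bK.
have bm' i : bm (fun D : n.-tuple T => mean D (fun x => Z x * f i x)).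
  by apply: bm_mean; exact: (bmM bZ (bf i)).
apply: (@le_trans _ _ (Ex (iid P n) (fun D => n%:R^-1 ^+ 2 * Bd ^+ 2 *
    (tsum D (fun t => `|\sum_i f i t * f i x|) * tsum D (fun t => `|\sum_i f i t * f i x|))))).
  by apply: le_Ex; [bmt|bmt|] => D; rewrite -expr2; exact: Kbound.
rewrite ExZ; last by bmt.
rewrite Ex_tsumM//.
rewrite (_ : Ex P (fun x0 => _ * _) = \sum_i f i x ^+ 2); last first.
  by rewrite -EKsqr//; congr Ex; apply/funext => t; rewrite expr2.
rewrite [_ * Bd ^+ 2]mulrC -[leLHS]mulrA ler_wpM2l ?sqr_ge0// mulrC.
set e := Ex P _ in L1 *; have e0 : 0 <= e by apply: Ex_ge0.
have -> : c * kk / n%:R + c ^+ 2 = (n%:R * (c * kk) + n%:R ^+ 2 * c ^+ 2) * n%:R^-1 ^+ 2.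
  by field.
rewrite ler_wpM2r ?sqr_ge0// lerD ?ler_wpM2l//.
apply: ler_pM; rewrite ?mulr_ge0//; last by rewrite expr2 ler_pM.
  by rewrite subr_ge0 expr2 ler_peMl// ler1n.
by rewrite gerBl.
Qed.

Let Ephat2 : Ex (iid P n \x P)%E (fun z => phatx z.1 z.2 ^+ 2) <=
  Bd ^+ 2 * (c * k / n%:R + c ^+ 2).
Proof.
have b2 := bmX 2 (bph n).
rewrite Ex_prod2// -[leRHS](Ex_cst P); apply: le_Ex.
- exact: (bm_Ex2 (iid P n) P b2).
- exact: bm_cst.
- by move=> x; apply: sqr_hat_le => //; exact: Kphi_L1.
Qed.

Let Kchi_diag' x : \sum_j chi j x ^+ 2 <= c * k'.
Proof. by apply: le_trans (Kchi_diag x); apply: ler_sum => j _; rewrite expr2. Qed.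

Let Ebhat2 : Ex (iid P n \x P)%E (fun z => bhatx z.1 z.2 ^+ 2) <=
  Bd ^+ 2 * (c * k' / n%:R + c ^+ 2).
Proof.
have b2 := bmX 2 (bbh n).
rewrite Ex_prod2// -[leRHS](Ex_cst P); apply: le_Ex.
- exact: (bm_Ex2 (iid P n) P b2).
- exact: bm_cst.
- by move=> x; apply: sqr_hat_le => //; exact: Kchi_L1.
Qed.

(** Here k = O(n) is used: the sum over the sample of the coarse kernel at x is then of order n, as if its terms were bounded. *)
Let Ehat4 : Ex (iid P n \x P)%E (fun z => phatx z.1 z.2 ^+ 2 * bhatx z.1 z.2 ^+ 2) <=
  12 * (Bd ^+ 4 * c ^+ 6) * (1 + k' / n%:R).
Proof.
have b2 := bmM (bmX 2 (bph n)) (bmX 2 (bbh n)).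
rewrite Ex_prod2// -[leRHS](Ex_cst P); apply: le_Ex.
- exact: (bm_Ex2 (iid P n) P b2).
- exact: bm_cst.
move=> x /=.
have bK1 := bm_tsum n (bKphi x); have bK2 := bm_tsum n (bKchi x).
apply: (@le_trans _ _ (Ex (iid P n) (fun D => n%:R^-1 ^+ 4 * Bd ^+ 4 *
    (tsum D (fun t => `|Kphi t x|) ^+ 2 * tsum D (fun t => `|Kchi t x|) ^+ 2)))).
  apply: le_Ex; [exact: (bm_pair2 b2)|bmt|] => D.
  have h1 := Kbound phi D x AB; have h2 := Kbound chi D x YB.
  rewrite [leRHS](_ : _ = (n%:R^-1 ^+ 2 * Bd ^+ 2 * tsum D (fun t => `|Kphi t x|) ^+ 2) *
     (n%:R^-1 ^+ 2 * Bd ^+ 2 * tsum D (fun t => `|Kchi t x|) ^+ 2)); last by ring.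
  by apply: ler_pM; rewrite ?sqr_ge0.
rewrite ExZ; last by bmt.
have := @Ex_sqr_sqr_le _ _ _ P _ _ (c * k) (bKphi x) (bKchi x)
  (fun t => normr_ge0 _) (fun t => normr_ge0 _) (fun t => Kphi_le t x) n.
rewrite !EKsqr//; set e := Ex (iid P n) _ => h.
have h1 := Kphi_L1 x; have h2 := Kchi_L1 x.
set e1 := Ex P (fun t => `|Kphi t x|) in h h1; set e2 := Ex P (fun t => `|Kchi t x|) in h h2.
have e10 : 0 <= e1 by exact: Ex_ge0.
have e20 : 0 <= e2 by exact: Ex_ge0.
have h3 : n%:R * \sum_i chi i x ^+ 2 + n%:R ^+ 2 * e2 ^+ 2 <= c ^+ 2 * n%:R ^+ 2 * (1 + k' / n%:R).
  have : n%:R * \sum_i chi i x ^+ 2 <= n%:R * (c ^+ 2 * k').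
    rewrite ler_wpM2l// (le_trans (Kchi_diag' x))// ler_wpM2r// expr2 ler_peMl//.
  have : n%:R ^+ 2 * e2 ^+ 2 <= n%:R ^+ 2 * c ^+ 2.
    by rewrite ler_wpM2l ?sqr_ge0// lerXn2r ?nnegrE.
  have -> : c ^+ 2 * n%:R ^+ 2 * (1 + k' / n%:R) = n%:R ^+ 2 * c ^+ 2 + n%:R * (c ^+ 2 * k').
    by field.
  by lra.
have ckn : c * k <= c ^+ 2 * n%:R by rewrite expr2 -mulrA ler_wpM2l.
have ck0 : 0 <= c * k by rewrite mulr_ge0.
have c2 : 1 <= c ^+ 2 by rewrite expr_ge1.
have h4 : 8 * (c * k) ^+ 2 + 2 * (n%:R * \sum_i phi i x ^+ 2 + n%:R ^+ 2 * e1 ^+ 2) <=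
    12 * c ^+ 4 * n%:R ^+ 2.
  have g1 : (c * k) ^+ 2 <= (c ^+ 2 * n%:R) ^+ 2 by rewrite lerXn2r ?nnegrE// mulr_ge0// sqr_ge0.
  have g2 : n%:R * \sum_i phi i x ^+ 2 <= c ^+ 4 * n%:R ^+ 2.
    apply: (@le_trans _ _ (n%:R * (c ^+ 2 * n%:R))).
      by rewrite ler_wpM2l// (le_trans (Kphi_diag x)).
    rewrite (_ : n%:R * _ = c ^+ 2 * n%:R ^+ 2); last by ring.
    by rewrite ler_wpM2r ?sqr_ge0// ler_weXn2l.
  have g3 : n%:R ^+ 2 * e1 ^+ 2 <= c ^+ 4 * n%:R ^+ 2.
    rewrite mulrC ler_wpM2r ?sqr_ge0// (@le_trans _ _ (c ^+ 2))//.
      by rewrite lerXn2r ?nnegrE.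
    by rewrite ler_weXn2l.
  have -> : 12 * c ^+ 4 * n%:R ^+ 2 = 8 * (c ^+ 2 * n%:R) ^+ 2 + 2 * (c ^+ 4 * n%:R ^+ 2 + c ^+ 4 * n%:R ^+ 2) by ring.
  by lra.
have {}h : e <= c ^+ 2 * n%:R ^+ 2 * (1 + k' / n%:R) * (12 * c ^+ 4 * n%:R ^+ 2).
  apply: (le_trans h); apply: ler_pM => //.
    by rewrite addr_ge0// mulr_ge0 ?sqr_ge0// sumr_ge0// => i _; rewrite sqr_ge0.
  rewrite addr_ge0 ?mulr_ge0 ?sqr_ge0// addr_ge0 ?mulr_ge0 ?sqr_ge0//.
  by rewrite sumr_ge0// => i _; rewrite sqr_ge0.
apply: (@le_trans _ _ (n%:R^-1 ^+ 4 * Bd ^+ 4 *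
  (c ^+ 2 * n%:R ^+ 2 * (1 + k' / n%:R) * (12 * c ^+ 4 * n%:R ^+ 2)))).
  by rewrite ler_wpM2l// mulr_ge0// exprn_ge0// invr_ge0.
by rewrite le_eqVlt; apply/orP; left; apply/eqP; field.
Qed.

Let Q := ((iid P n \x iid P n) \x iid P n)%E.
Let tau := Ex P (fun x => A x * Y x) - dot P p b.
Let del := dot P p b - \sum_i dot P p (phi i) * dot P b (phi i).
Let del' := dot P p b - \sum_j dot P p (chi j) * dot P b (chi j).
Let bAY : bm (fun x => A x * Y x). Proof. exact: bmM. Qed.

Let devAY : Ex (iid P n) (fun D => dev P D (fun x => A x * Y x) ^+ 2) <= Bd ^+ 4 / n%:R.
Proof.
apply: (@le_trans _ _ (Bd ^+ 2 * Bd ^+ 2 / n%:R)).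
  apply: Ex_dev_linear => //; rewrite dotff -[leRHS](Ex_cst P); apply: le_Ex; [bmt|exact: bm_cst|] => x.
  by rewrite -real_normK ?num_real// lerXn2r ?nnegrE.
by rewrite -exprD.
Qed.

Let Bd4 : 0 <= Bd ^+ 4. Proof. exact: exprn_ge0. Qed.
Let c2ge : 1 <= c ^+ 2. Proof. by rewrite expr_ge1. Qed.
Let c6ge : c ^+ 2 <= c ^+ 6. Proof. by rewrite ler_weXn2l. Qed.
Let Bd4ge : 1 <= Bd ^+ 4. Proof. by rewrite expr_ge1. Qed.
Let rk0 : 0 <= k ^+ 2 / n%:R ^+ 2. Proof. by rewrite mulr_ge0 ?sqr_ge0// invr_ge0 sqr_ge0. Qed.
Let rn0 : 0 <= n%:R^-1 :> R. Proof. by rewrite invr_ge0. Qed.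

Let cross_le : Ex (iid P n) (fun D => (cross D - dot P p b) ^+ 2) <=
  200 * (Bd ^+ 4 * c ^+ 2) * (n%:R^-1 + k ^+ 2 / n%:R ^+ 2 + del ^+ 2).
Proof.
apply: (le_trans (Ex_cross n0)); rewrite -/del.
rewrite (_ : 48 * _ * _ / _ = 48 * (Bd ^+ 4 * c ^+ 2 * (k ^+ 2 / n%:R ^+ 2))); last by ring.
rewrite (_ : 2 * _ / _ = 2 * (Bd ^+ 4 * n%:R^-1)); last by ring.
have h1 : Bd ^+ 4 * n%:R^-1 <= Bd ^+ 4 * c ^+ 2 * n%:R^-1.
  by rewrite ler_wpM2r// ler_peMr.
have h2 : del ^+ 2 <= Bd ^+ 4 * c ^+ 2 * del ^+ 2.
  by rewrite ler_peMl ?sqr_ge0// mulr_ege1.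
have h3 : 0 <= Bd ^+ 4 * c ^+ 2 by rewrite mulr_ge0// sqr_ge0.
have h4 := mulr_ge0 h3 rk0; have h5 := mulr_ge0 h3 rn0; have h6 := mulr_ge0 h3 (sqr_ge0 del).
by lra.
Qed.

Let devAY_le : Ex (iid P n) (fun D => dev P D (fun x => A x * Y x) ^+ 2) <=
  Bd ^+ 4 * c ^+ 2 * n%:R^-1.
Proof. by apply: (le_trans devAY); rewrite ler_wpM2r// ler_peMr. Qed.

Lemma INT_risk : Ex Q (fun D =>
    (mean D.1.2 (fun x => A x * Y x) - cross D.1.1 - tau) ^+ 2) <=
  402 * (Bd ^+ 4 * c ^+ 2) * (n%:R^-1 + k ^+ 2 / n%:R ^+ 2 + del ^+ 2).
Proof.
have bd := bm_dev P n bAY; have bc := bm_cross n; have bm' := bm_mean n bAY.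
have b1 : bm (fun D : n.-tuple T * n.-tuple T * n.-tuple T =>
  dev P D.1.2 (fun x => A x * Y x) ^+ 2) by exact: (bm_second (bmX 2 bd)).
have b2 : bm (fun D : n.-tuple T * n.-tuple T * n.-tuple T =>
  (cross D.1.1 - dot P p b) ^+ 2).
  exact: (bm_first (bmX 2 (bmB bc (bm_cst (dot P p b))))).
have b3 := bm_second bm'; have b4 := bm_first bc.
apply: (@le_trans _ _ (Ex Q (fun D => 2 * dev P D.1.2 (fun x => A x * Y x) ^+ 2 +
   2 * (cross D.1.1 - dot P p b) ^+ 2))).
  apply: le_Ex; [bmt|bmt|] => D.
  rewrite /tau /dev; set x := mean _ _; set y := cross _; set z := dot _ _ _; set t := Ex _ _.
  have := sqr_ge0 (x - t + (y - z)); lra.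
rewrite ExD; [|bmt|bmt].
rewrite ExZ// ExZ//.
rewrite (Ex_second (iid P n) (bmX 2 bd)).
rewrite (Ex_first (iid P n) (bmX 2 (bmB bc (bm_cst (dot P p b))))).
have h3 : 0 <= Bd ^+ 4 * c ^+ 2 by rewrite mulr_ge0// sqr_ge0.
have h4 := mulr_ge0 h3 rk0; have h5 := mulr_ge0 h3 rn0; have h6 := mulr_ge0 h3 (sqr_ge0 del).
move: cross_le devAY_le h4 h5 h6; move: (Ex _ _) (Ex _ _) => e1 e2.
by move: (n%:R^-1) (Bd ^+ 4 * c ^+ 2) (k ^+ 2 / _) (del ^+ 2) => *; lra.
Qed.

Let bF : bm (fun z : n.-tuple T * T => phatx z.1 z.2 * bhatx z.1 z.2).
Proof. exact: (bmM (bph n) (bbh n)). Qed.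

Let E_phat_bhat (D : n.-tuple T) : Ex P (fun x => phatx D x * bhatx D x) = cross D :=
  dot_emp_proj P A Y bphi bchi D.

Lemma MC_risk : Ex Q (fun D =>
    (mean D.1.2 (fun x => A x * Y x) - mean D.2 (fun x => phatx D.1.1 x * bhatx D.1.1 x)
     - tau) ^+ 2) <=
  700 * (Bd ^+ 4 * c ^+ 6) * (n%:R^-1 * (1 + k' / n%:R) + k ^+ 2 / n%:R ^+ 2 + del ^+ 2).
Proof.
have bd := bm_dev P n bAY; have bc := bm_cross n; have bm' := bm_mean n bAY.
have b1 : bm (fun D : n.-tuple T * n.-tuple T * n.-tuple T =>
  dev P D.1.2 (fun x => A x * Y x) ^+ 2) by exact: (bm_second (bmX 2 bd)).
have b2 : bm (fun D : n.-tuple T * n.-tuple T * n.-tuple T =>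
  (cross D.1.1 - dot P p b) ^+ 2).
  exact: (bm_first (bmX 2 (bmB bc (bm_cst (dot P p b))))).
have b3 := bm_second bm'.
pose H (z : n.-tuple T * n.-tuple T) := (mean z.2 (fun x => phatx z.1 x * bhatx z.1 x) -
  Ex P (fun x => phatx z.1 x * bhatx z.1 x)) ^+ 2.
have bM : bm (fun z : n.-tuple T * n.-tuple T =>
  mean z.2 (fun x => phatx z.1 x * bhatx z.1 x)) := bm_mean_pair bF n.
have bE : bm (fun z : n.-tuple T * n.-tuple T =>
  Ex P (fun x => phatx z.1 x * bhatx z.1 x)) := bm_Ex_pair (iid P n) P bF n.
have bH : bm H by rewrite /H; bmt.
have m13 : measurable_fun setT (fun D : n.-tuple T * n.-tuple T * n.-tuple T => (D.1.1, D.2)).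
  apply: measurable_fun_pair; last exact: measurable_snd.
  by apply: measurableT_comp => //; exact: measurable_fst.
have bM3 := bm_comp m13 bM; have bH3 := bm_comp m13 bH.
apply: (@le_trans _ _ (Ex Q (fun D => 3 * dev P D.1.2 (fun x => A x * Y x) ^+ 2 +
   (3 * H (D.1.1, D.2) + 3 * (cross D.1.1 - dot P p b) ^+ 2)))).
  apply: le_Ex; [bmt|bmt|] => D.
  rewrite /H /= E_phat_bhat /tau /dev.
  set x := mean _ _; set y := cross _; set z := dot _ _ _; set t := Ex _ _; set w := mean _ _.
  have := sqr_ge0 (x - t + (w - y)); have := sqr_ge0 (x - t + (y - z)).
  have := sqr_ge0 ((w - y) - (y - z)); lra.
rewrite ExD; [|bmt|bmt].
rewrite ExD; [|bmt|bmt].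
rewrite ExZ// ExZ// ExZ//.
rewrite (Ex_second (iid P n) (bmX 2 bd)).
rewrite (Ex_first (iid P n) (bmX 2 (bmB bc (bm_cst (dot P p b))))).
rewrite (Ex_third (iid P n) bH).
have hH : Ex (iid P n \x iid P n)%E H <= 12 * (Bd ^+ 4 * c ^+ 6) * (1 + k' / n%:R) * n%:R^-1.
  apply: (le_trans (Ex_conditional_variance (iid P n) P bF n0)); rewrite ler_wpM2r//.
  by under eq_fun do rewrite exprMn.
have h3 : 0 <= Bd ^+ 4 * c ^+ 6 by rewrite mulr_ge0// exprn_ge0.
have h4 := mulr_ge0 h3 rk0; have h5 := mulr_ge0 h3 rn0; have h6 := mulr_ge0 h3 (sqr_ge0 del).
have h7 : 0 <= Bd ^+ 4 * c ^+ 6 * (n%:R^-1 * (k' / n%:R)) by rewrite mulr_ge0// mulr_ge0// divr_ge0.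
have h8 : Bd ^+ 4 * c ^+ 2 <= Bd ^+ 4 * c ^+ 6 by rewrite ler_wpM2l.
have h9 : Bd ^+ 4 * c ^+ 2 * n%:R^-1 <= Bd ^+ 4 * c ^+ 6 * n%:R^-1 by rewrite ler_wpM2r.
have h10 : Bd ^+ 4 * c ^+ 2 * (n%:R^-1 + k ^+ 2 / n%:R ^+ 2 + del ^+ 2) <=
  Bd ^+ 4 * c ^+ 6 * (n%:R^-1 + k ^+ 2 / n%:R ^+ 2 + del ^+ 2).
  by rewrite ler_wpM2r// addr_ge0 ?sqr_ge0// addr_ge0.
have h11 := cross_le; have h12 := devAY_le.
move: (Ex _ _) (Ex _ _) (Ex _ _) hH h11 h12 => e1 e2 e3 hH h11 h12.
move: h4 h5 h6 h7 h9 h10 hH h11 h12.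
by move: (n%:R^-1) (Bd ^+ 4 * c ^+ 2) (Bd ^+ 4 * c ^+ 6) (k ^+ 2 / _) (del ^+ 2) (k' / _) => *; lra.
Qed.

Let bGf : bm (fun z : n.-tuple T * T => (A z.2 - phatx z.1 z.2) * (Y z.2 - bhatx z.1 z.2)).
Proof.
have h1 : bm (fun z : n.-tuple T * T => A z.2) by exact: bm_snd.
have h2 : bm (fun z : n.-tuple T * T => Y z.2) by exact: bm_snd.
by apply: bmM; apply: bmB.
Qed.

Let E_IF (D : n.-tuple T) : Ex P (fun x => (A x - phatx D x) * (Y x - bhatx D x)) - tau =
  dot P p b - \sum_i mean D (fun x => A x * phi i x) * dot P b (phi i)
    - \sum_j mean D (fun x => Y x * chi j x) * dot P p (chi j) + cross D.
Proof.
have b1 : bm (phatx D) by exact: bm_lincomb.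
have b2 : bm (bhatx D) by exact: bm_lincomb.
rewrite -[Ex _ _]/(dot P (fun x => A x - phatx D x) (fun x => Y x - bhatx D x)).
rewrite dotBl; [|by []|by []|by bmt].
rewrite !dotBr// -[dot P (phatx D) (bhatx D)]/(Ex P (fun x => phatx D x * bhatx D x)).
rewrite E_phat_bhat /tau -/(dot P A Y) [dot P A (bhatx D)]dot_sumr// [dot P (phatx D) Y]dot_suml//.
under [X in _ - X - _ + _ = _]eq_bigr do rewrite Achi.
under [X in _ - _ - (X - _) - _ = _]eq_bigr do rewrite dotC Yphi.
by ring.
Qed.

Lemma IF_risk : Ex Q (fun D =>
    (mean D.1.2 (fun x => (A x - phatx D.1.1 x) * (Y x - bhatx D.1.1 x)) - tau) ^+ 2) <=
  700 * (Bd ^+ 4 * c ^+ 6) * (n%:R^-1 * (1 + k' / n%:R) + k ^+ 2 / n%:R ^+ 2 + del' ^+ 2).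
Proof.
pose H (z : n.-tuple T * n.-tuple T) :=
  (mean z.2 (fun x => (A x - phatx z.1 x) * (Y x - bhatx z.1 x)) -
  Ex P (fun x => (A x - phatx z.1 x) * (Y x - bhatx z.1 x))) ^+ 2.
pose L (D : n.-tuple T) := dot P p b - \sum_i mean D (fun x => A x * phi i x) * dot P b (phi i)
    - \sum_j mean D (fun x => Y x * chi j x) * dot P p (chi j) + cross D.
have bc := bm_cross n; have bmA' := bmA n; have bmY' := bmY n.
have bL : bm L by rewrite /L; bmt.
have bM : bm (fun z : n.-tuple T * n.-tuple T =>
  mean z.2 (fun x => (A x - phatx z.1 x) * (Y x - bhatx z.1 x))) := bm_mean_pair bGf n.
have bE : bm (fun z : n.-tuple T * n.-tuple T =>
  Ex P (fun x => (A x - phatx z.1 x) * (Y x - bhatx z.1 x))) := bm_Ex_pair (iid P n) P bGf n.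
have bH : bm H by rewrite /H; bmt.
have bL1 : bm (fun z : n.-tuple T * n.-tuple T => L z.1 ^+ 2) by exact: (bm_fst (bmX 2 bL)).
have bM12 : bm (fun z : n.-tuple T * n.-tuple T =>
    (mean z.2 (fun x => (A x - phatx z.1 x) * (Y x - bhatx z.1 x)) - tau) ^+ 2).
  by bmt.
rewrite /Q (Ex_fst _ (iid P n) bM12).
apply: (@le_trans _ _ (Ex (iid P n \x iid P n)%E (fun z => 2 * H z + 2 * L z.1 ^+ 2))).
  apply: le_Ex; [bmt|bmt|] => z; rewrite /H /L -E_IF.
  set x := mean _ _; set y := Ex _ _.
  have := sqr_ge0 (x - y - (y - tau)); lra.
rewrite ExD; [|bmt|bmt].
rewrite ExZ// ExZ// (Ex_fst _ _ (bmX 2 bL)).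
have hH : Ex (iid P n \x iid P n)%E H <= 64 * (Bd ^+ 4 * c ^+ 6) * (1 + k' / n%:R) * n%:R^-1.
  apply: (le_trans (Ex_conditional_variance (iid P n) P bGf n0)); rewrite ler_wpM2r//.
  have b1 := bmX 2 (bph n); have b2 := bmX 2 (bbh n).
  apply: (@le_trans _ _ (Ex (iid P n \x P)%E (fun z => 4 * (Bd ^+ 4 + (Bd ^+ 2 * phatx z.1 z.2 ^+ 2 +
    (Bd ^+ 2 * bhatx z.1 z.2 ^+ 2 + phatx z.1 z.2 ^+ 2 * bhatx z.1 z.2 ^+ 2)))))).
    apply: le_Ex; [exact: (bmX 2 bGf)|bmt|] => z.
    have hA : A z.2 ^+ 2 <= Bd ^+ 2 by rewrite -real_normK ?num_real// lerXn2r ?nnegrE.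
    have hY : Y z.2 ^+ 2 <= Bd ^+ 2 by rewrite -real_normK ?num_real// lerXn2r ?nnegrE.
    set x := phatx _ _; set y := bhatx _ _.
    have g1 : (A z.2 - x) ^+ 2 <= 2 * (Bd ^+ 2 + x ^+ 2) by have := sqr_ge0 (A z.2 + x); lra.
    have g2 : (Y z.2 - y) ^+ 2 <= 2 * (Bd ^+ 2 + y ^+ 2) by have := sqr_ge0 (Y z.2 + y); lra.
    rewrite exprMn; apply: (le_trans (ler_pM (sqr_ge0 _) (sqr_ge0 _) g1 g2)).
    by rewrite le_eqVlt; apply/orP; left; apply/eqP; ring.
  rewrite ExZ; last by bmt.
  rewrite ExD; [|bmt|bmt].
  rewrite ExD; [|bmt|bmt].
  rewrite ExD; [|bmt|bmt].
  rewrite ExZ// ExZ// Ex_cst.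
  have g1 : Bd ^+ 2 * Ex (iid P n \x P)%E (fun z => phatx z.1 z.2 ^+ 2) <= Bd ^+ 4 * c ^+ 6 * 2.
    apply: (le_trans (ler_wpM2l (sqr_ge0 _) Ephat2)); rewrite mulrA -exprD -[leRHS]mulrA ler_wpM2l//.
    have : c * k / n%:R <= c ^+ 2.
      by rewrite ler_pdivrMr// expr2 -mulrA ler_wpM2l.
    by have := c6ge; lra.
  have kk0 : 0 <= k' / n%:R by rewrite divr_ge0.
  have g2 : Bd ^+ 2 * Ex (iid P n \x P)%E (fun z => bhatx z.1 z.2 ^+ 2) <=
      Bd ^+ 4 * c ^+ 6 * (1 + k' / n%:R).
    apply: (le_trans (ler_wpM2l (sqr_ge0 _) Ebhat2)); rewrite mulrA -exprD -[leRHS]mulrA ler_wpM2l//.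
    have : c * k' / n%:R <= c ^+ 6 * (k' / n%:R).
      by rewrite -mulrA ler_wpM2r// ler_eXnr.
    by have := c6ge; lra.
  have g3 : Bd ^+ 4 <= Bd ^+ 4 * c ^+ 6 by rewrite ler_peMr// expr_ge1.
  have g4 := Ehat4.
  have g5 : 0 <= Bd ^+ 4 * c ^+ 6 * (k' / n%:R) by rewrite mulr_ge0// mulr_ge0// exprn_ge0.
  move: g1 g2 g3 g4 g5; move: (Ex _ _) (Ex _ _) (Ex _ _) => e1 e2 e3.
  by move: (Bd ^+ 4) (Bd ^+ 4 * c ^+ 6) (k' / _) => *; lra.
have h3 : 0 <= Bd ^+ 4 * c ^+ 6 by rewrite mulr_ge0// exprn_ge0.
have h4 := mulr_ge0 h3 rk0; have h5 := mulr_ge0 h3 rn0; have h6 := mulr_ge0 h3 (sqr_ge0 del').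
have h7 : 0 <= Bd ^+ 4 * c ^+ 6 * (n%:R^-1 * (k' / n%:R)) by rewrite mulr_ge0// mulr_ge0// divr_ge0.
have h8 := Ex_IFbias n0; rewrite -/(L _) -/del' in h8.
have h9 : Ex (iid P n) (fun D => L D ^+ 2) <= 3 * (Bd ^+ 4 * c ^+ 6 * del' ^+ 2 +
   4 * (Bd ^+ 4 * c ^+ 6 * n%:R^-1) + 48 * (Bd ^+ 4 * c ^+ 6 * (k ^+ 2 / n%:R ^+ 2))).
  apply: (le_trans h8); rewrite ler_wpM2l//; apply: lerD; first apply: lerD.
  - by rewrite ler_peMl ?sqr_ge0// mulr_ege1// expr_ge1.
  - by rewrite -mulrA ler_wpM2l// ler_wpM2r// ler_peMr// expr_ge1.
  - rewrite (_ : 48 * _ * _ / _ = 48 * (Bd ^+ 4 * c ^+ 2 * (k ^+ 2 / n%:R ^+ 2))); last by ring.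
    by rewrite ler_wpM2l// ler_wpM2r// ler_wpM2l.
move: h4 h5 h6 h7 hH h9; move: (Ex _ _) (Ex _ _) => e1 e2.
by move: (n%:R^-1) (Bd ^+ 4 * c ^+ 6) (k ^+ 2 / _) (del' ^+ 2) (k' / _) => *; lra.
Qed.

End rates.
End estimation.

(** * The uniform law on the cube *)

Section almost_everywhere.
Context {dT : measure_display} {T : measurableType dT} {R : realType}.
Variable P : probability T R.

Lemma Ex_indic (A : set T) : measurable A -> (Ex P (\1_A))%:E = P A.
Proof.
move=> mA; rewrite ExE; last exact: bm_indic.
by rewrite integral_indic// setIT.
Qed.

Lemma prob1_ae (A : set T) : measurable A -> P A = 1%E -> {ae P, forall x, A x}.
Proof.
move=> mA PA; exists (~` A); split; first exact: measurableC.
  by rewrite probability_setC// PA subee.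
by [].
Qed.

Lemma Ex_indic_ae (A : set T) : measurable A -> Ex P (\1_A) = 1 -> {ae P, forall x, A x}.
Proof. by move=> mA EA; apply: prob1_ae => //; rewrite -Ex_indic// EA. Qed.

Lemma Ex_iid_prod n (f : 'I_n -> T -> R) : (forall i, bm (f i)) ->
  Ex (iid P n) (fun x => \prod_i f i (tnth x i)) = \prod_i Ex P (f i).
Proof.
elim: n f => [|n ih] f bf.
  by rewrite big_ord0 (_ : (fun _ => _) = fun=> 1) ?Ex_cst//; apply/funext => x; rewrite big_ord0.
have b m (g : 'I_m -> T -> R) : (forall i, bm (g i)) ->
    bm (fun x : m.-tuple T => \prod_i g i (tnth x i)).
  by move=> bg; apply: bm_prod => i; apply: bm_comp (bg i); exact: measurable_tnth.
rewrite Ex_iidS; last exact: b.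
under eq_fun => z.
  rewrite big_ord_recl tnth0.
  under eq_bigr do rewrite tnthS.
  over.
rewrite (Ex_prodM P (iid P n) (bf ord0) (b _ _ (fun i => bf (lift ord0 i)))).
by rewrite big_ord_recl; congr (_ * _); apply: (ih (fun i => f (lift ord0 i))) => i.
Qed.

End almost_everywhere.

Section uniform01.
Context {R : realType}.
Local Notation U01 := (uniform_prob (@ltr01 R)).

Lemma uniform01_le (A : set (measurableTypeR R)) : measurable A ->
  (U01 A <= lebesgue_measure A)%E.
Proof.
move=> mA; rewrite /uniform_prob -(mul1e (lebesgue_measure A)) -integral_cst//.
apply: ge0_le_integral => //.
- by move=> x _; rewrite lee_fin uniform_pdf_ge0.
- by apply/measurable_EFinP/measurable_funTS; exact: measurable_uniform_pdf.
- by move=> x _; rewrite lee_fin /uniform_pdf; case: ifP => //; rewrite subr0 invr1.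
Qed.

Lemma uniform01_eq (A : set (measurableTypeR R)) : measurable A -> A `<=` `[0, 1] ->
  U01 A = lebesgue_measure A.
Proof.
move=> mA A01; rewrite /uniform_prob -(mul1e (lebesgue_measure A)) -integral_cst//.
apply: eq_integral => x; rewrite inE => Ax; rewrite /uniform_pdf.
by have := A01 x Ax; rewrite /= in_itv/= => ->; rewrite subr0 invr1.
Qed.

Lemma Ex_uniform01_itv (a r : R) : 0 <= r ->
  Ex U01 (\1_(`[a - r, a + r])) <= 2 * r.
Proof.
move=> r0; rewrite -lee_fin Ex_indic//; apply: (le_trans (uniform01_le _)) => //.
rewrite lebesgue_measure_itv/= lte_fin; case: ifP => // _; rewrite -?EFinD ?lee_fin; lra.
Qed.

Lemma Ex_uniform01_01 : Ex U01 (\1_(`[0, 1])) = 1.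
Proof.
apply: EFin_inj; rewrite Ex_indic//; apply: etrans; first exact: uniform01_eq.
by rewrite lebesgue_measure_itv/= lte_fin ltr01 oppr0 adde0.
Qed.

End uniform01.

Section cube.
Context {R : realType} {d : nat}.
Local Notation vec := (vec R d).
Local Notation unif := (unif R d).
Local Notation cube := (@unit_cube R d).

Definition clamp (a b t : R) : R := Num.max a (Num.min t b).

Lemma clamp_id a b t : a <= t <= b -> clamp a b t = t.
Proof. by rewrite /clamp => /andP[at_ tb]; rewrite min_l// max_r. Qed.

Lemma clamp_itv a b t : a <= b -> a <= clamp a b t <= b.
Proof.
move=> ab; rewrite /clamp le_max lexx/= ge_max ab/=.
by rewrite ge_min lexx orbT.
Qed.

Lemma measurable_clamp a b : measurable_fun setT (clamp a b).
Proof. by apply: measurable_maxr => //; apply: measurable_minr. Qed.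

(** The retraction of R^d onto the cube. Composition with it turns statements that hold on the cube into statements that hold everywhere, without changing anything almost surely. *)
Definition clampv (x : vec) : vec := [tuple clamp 0 1 (tnth x i) | i < d].

Lemma clampv_cube x : cube (clampv x).
Proof. by move=> i; rewrite tnth_mktuple clamp_itv. Qed.

Lemma clampv_id x : cube x -> clampv x = x.
Proof. by move=> cx; apply: eq_from_tnth => i; rewrite tnth_mktuple clamp_id. Qed.

Lemma measurable_clampv : measurable_fun setT clampv.
Proof.
apply/measurable_fun_tnthP => i.
rewrite (_ : _ \o _ = fun x => clamp 0 1 (tnth x i)).
  by apply: measurableT_comp; [exact: measurable_clamp|exact: measurable_tnth].
by apply/funext => x /=; rewrite tnth_mktuple.
Qed.

Lemma measurable_cube : measurable cube.
Proof.
rewrite (_ : cube = \bigcap_(i in [set: 'I_d]) ((fun x : vec => tnth x i) @^-1` `[0, 1])).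
  apply: fin_bigcap_measurable => // i _.
  rewrite -[X in measurable X]setTI; exact: (measurable_tnth i).
apply/seteqP; split => [x cx i _ /=|x cx i]; first by rewrite in_itv/= cx.
by have := cx i I; rewrite /= in_itv.
Qed.

Lemma cube_ae : {ae unif, forall x, cube x}.
Proof.
apply: Ex_indic_ae; first exact: measurable_cube.
rewrite (_ : \1_cube = fun x : vec => \prod_i \1_(`[0, 1]%classic : set R) (tnth x i)).
  apply: etrans.
    by apply: (@Ex_iid_prod _ _ _ (uniform_prob ltr01) _ (fun=> \1_(`[0, 1]))) => i; exact: bm_indic.
  by rewrite big1// => i _; exact: Ex_uniform01_01.
apply/funext => x; rewrite indicE; case: (asboolP (cube x)) => cx.
  rewrite mem_set// big1// => i _; rewrite indicE mem_set//= in_itv/=; exact: cx.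
rewrite memNset//=.
have [i hi] : exists i, ~ (0 <= tnth x i <= 1) by apply/existsNP.
by rewrite (bigD1 i)//= indicE memNset ?mul0r//= in_itv.
Qed.

Definition cl (f : vec -> R) x := f (clampv x).

Lemma cl_ae (f : vec -> R) : {ae unif, forall x, f x = cl f x}.
Proof. by apply: filterS cube_ae => x /= cx; rewrite /cl clampv_id. Qed.

Lemma innerE (f g : vec -> R) : bm (cl f) -> bm (cl g) ->
  inner f g = dot unif (cl f) (cl g).
Proof.
move=> bf bg; rewrite /inner /dot /Ex Rintegral_mkcond; rewrite /Rintegral; congr fine.
have bfg := bmM bf bg.
rewrite (_ : (fun x => _) = fun x => ((cl f x * cl g x) * \1_cube x)%:E); last first.
  apply/funext => x; congr EFin; rewrite patchE indicE; case: ifPn => //.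
    by rewrite inE => cx; rewrite mulr1 /cl clampv_id.
  by rewrite mulr0.
have bi : bm (\1_cube : vec -> R) by apply: bm_indic; exact: measurable_cube.
apply: ae_eq_integral => //.
- by apply/measurable_EFinP; apply: bm_measurable; exact: (bmM bfg bi).
- by apply/measurable_EFinP; apply: bm_measurable.
- by apply: filterS cube_ae => x cx _ /=; rewrite indicE mem_set// mulr1.
Qed.

Lemma Ex_box_le (a : 'I_d -> R) (r : R) : 0 <= r ->
  Ex unif (fun x => \prod_i \1_(`[a i - r, a i + r]%classic : set R) (tnth x i)) <= (2 * r) ^+ d.
Proof.
move=> r0; rewrite [leLHS](@Ex_iid_prod _ _ _ (uniform_prob ltr01) _
  (fun i => \1_(`[a i - r, a i + r]))); last by move=> i; exact: bm_indic.
rewrite -[X in _ <= _ ^+ X](card_ord d) -prodr_const.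
apply: ler_prod => i _; rewrite Ex_uniform01_itv// andbT.
by apply: Ex_ge0 => x; rewrite indicE.
Qed.

End cube.

(** * Localization and approximation properties of the wavelet basis *)

Section wavelet_facts.
Context {R : realType} {d S J0 : nat} {W : wavelet_system R d}.
Hypothesis W_cdv : cdv_basis S J0 W.
Local Notation vec := (vec R d).
Local Notation unif := (unif R d).
Local Notation cube := (@unit_cube R d).

(** The resolution k = 2^(jd). *)
Definition scale (j : nat) : R := 2 ^+ (j * d).

Lemma scale_gt0 j : 0 < scale j. Proof. by rewrite exprn_gt0. Qed.

Lemma powR_half_scale j : (2 `^ (j%:R * d%:R / 2)) ^+ 2 = scale j.
Proof.
by rewrite -powR_mulrn ?powR_ge0// -powRrM divfK// -natrM powR_mulrn.
Qed.

Section localized_family.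
Variables (C : R) (j : nat) (Z : finType) (f : Z -> vec -> R).
Hypotheses (mf : forall m, measurable_fun setT (f m)) (loc : localized C j f).
Hypothesis C0 : 0 <= C.

Lemma bm_cl_localized m : bm (cl (f m)).
Proof.
have [h _ _] := loc; split.
  by apply: (measurableT_comp (mf m)); exact: measurable_clampv.
exists (C * 2 `^ (j%:R * d%:R / 2)) => x; exact: (h m _ (clampv_cube x)).
Qed.

(** A function of height 2^(jd/2) supported in a cube of side 2^(-j). *)
Lemma localized_L1 m : Ex unif (fun x => `|cl (f m) x|) <=
  C * (2 * C) ^+ d * (2 `^ (j%:R * d%:R / 2))^-1.
Proof.
have [h1 [a h2] _] := loc; set s := 2 `^ _.
have s0 : 0 < s by rewrite powR_gt0.
pose r := C * 2 ^- j.
have r0 : 0 <= r by rewrite mulr_ge0// invr_ge0 exprn_ge0.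
pose box x : R := \prod_i \1_(`[tnth (a m) i - r, tnth (a m) i + r]%classic : set R) (tnth x i).
have bbox : bm (fun x : vec => box (clampv x)).
  apply: (bm_comp measurable_clampv); apply: bm_prod => i.
  by apply: (@bm_comp _ _ _ _ _ _ (\1_(`[tnth (a m) i - r, tnth (a m) i + r]%classic : set (measurableTypeR R))) (measurable_tnth i)); exact: bm_indic.
have box0 x : 0 <= box x by apply: prodr_ge0 => i _; rewrite indicE.
have bf := bm_norm (bm_cl_localized m).
apply: (@le_trans _ _ (Ex unif (fun x => (C * s) * box (clampv x)))).
  apply: le_Ex; [by []|bmt|] => x; rewrite /cl.
  have cx := clampv_cube x.
  have [->|fx] := eqVneq (f m (clampv x)) 0.
    by rewrite normr0 mulr_ge0// mulr_ge0// ltW.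
  rewrite (_ : box _ = 1) ?mulr1; first exact: h1.
  rewrite /box big1// => i _; rewrite indicE mem_set//= in_itv/=.
  by have := h2 m _ cx fx i; rewrite ler_norml => /andP[]; rewrite -/r; lra.
rewrite ExZ//.
rewrite (_ : Ex _ _ = Ex unif box); last first.
  apply/esym/ae_eq_Ex => //; last by apply: filterS cube_ae => x cx; rewrite clampv_id.
  apply: bm_prod => i.
  by apply: (@bm_comp _ _ _ _ _ _ (\1_(`[tnth (a m) i - r, tnth (a m) i + r]%classic : set (measurableTypeR R))) (measurable_tnth i)); exact: bm_indic.
have /(ler_wpM2l (_ : 0 <= C * s)) := Ex_box_le (fun i => tnth (a m) i) r0.
rewrite mulr_ge0 ?(ltW s0)// => /(_ isT) h; apply: (le_trans h).
rewrite /r mulrA exprMn.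
rewrite (_ : (2 ^- j) ^+ d = s^-1 ^+ 2); last first.
  by rewrite exprVn [RHS]exprVn powR_half_scale /scale exprM.
rewrite le_eqVlt; apply/orP; left; apply/eqP; field; exact: lt0r_neq0.
Qed.

Lemma localized_card x : (#|[pred m | cl (f m) x != 0]|)%:R <= C.
Proof. by have [_ _ h] := loc; exact: (h _ (clampv_cube x)). Qed.

Lemma localized_sum_le (g : Z -> R) (B : R) x : 0 <= B ->
  (forall m, 0 <= g m <= B) ->
  \sum_m `|cl (f m) x| * g m <= C * (C * 2 `^ (j%:R * d%:R / 2)) * B.
Proof.
move=> B0 gB; have [h1 _ _] := loc.
rewrite (bigID (fun m => cl (f m) x == 0))/= big1 ?add0r; last first.
  by move=> m /eqP ->; rewrite normr0 mul0r.
apply: (@le_trans _ _ (\sum_(m | cl (f m) x != 0) (C * 2 `^ (j%:R * d%:R / 2) * B))).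
  apply: ler_sum => m _; have /andP[g0 g1] := gB m.
  by rewrite ler_pM//; exact: (h1 m _ (clampv_cube x)).
rewrite (eq_bigl [in [pred m | cl (f m) x != 0]])// sumr_const.
rewrite -[_ *+ #|_|]mulr_natl -[leRHS]mulrA ler_wpM2r//; last exact: localized_card.
by rewrite mulr_ge0// mulr_ge0// powR_ge0.
Qed.

Lemma localized_kernel_le x y :
  `|\sum_m cl (f m) x * cl (f m) y| <= C ^+ 3 * scale j.
Proof.
have [h1 _ _] := loc.
apply: (le_trans (ler_norm_sum _ _ _)).
under eq_bigr do rewrite normrM.
apply: (le_trans (localized_sum_le (g := fun m => `|cl (f m) y|)
  (B := C * 2 `^ (j%:R * d%:R / 2)) x _ _)).
- by rewrite mulr_ge0// powR_ge0.
- by move=> m; rewrite normr_ge0 (h1 m _ (clampv_cube y)).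
by rewrite -powR_half_scale le_eqVlt; apply/orP; left; apply/eqP; ring.
Qed.

(** At a given y at most C of the functions f m do not vanish; each contributes the product of its height and of its L^1 norm, and these are inverse to each other up to constants. *)
Lemma localized_kernel_L1 y :
  Ex unif (fun x => `|\sum_m cl (f m) x * cl (f m) y|) <= C ^+ 3 * (2 * C) ^+ d.
Proof.
have bf := bm_cl_localized.
set s : R := 2 `^ (j%:R * d%:R / 2); have s0 : 0 < s by rewrite powR_gt0.
apply: (@le_trans _ _ (Ex unif (fun x => \sum_m `|cl (f m) y| * `|cl (f m) x|))).
  apply: le_Ex; [bmt|bmt|] => x; apply: (le_trans (ler_norm_sum _ _ _)).
  by apply: ler_sum => m _; rewrite normrM mulrC.
rewrite Ex_sum; last by move=> m; bmt.
rewrite (eq_bigr (fun m => `|cl (f m) y| * Ex unif (fun x => `|cl (f m) x|))); last first.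
  by move=> m _; rewrite ExZ//; exact: bm_norm.
apply: (le_trans (localized_sum_le (B := C * (2 * C) ^+ d * s^-1) y _ _)).
- by rewrite !mulr_ge0// ?exprn_ge0 ?mulr_ge0// invr_ge0 ltW.
- by move=> m; rewrite localized_L1 andbT; apply: Ex_ge0.
rewrite le_eqVlt; apply/orP; left; apply/eqP; rewrite -/s; field; exact: lt0r_neq0.
Qed.

End localized_family.

(** One constant serves all levels and both families, and can be taken at least 1, so that its powers can be compared. *)
Lemma localization_const : exists2 C : R, 1 <= C & forall j, (J0 <= j)%N ->
  localized C j (@Phi _ _ W j) /\ forall e, localized C j (@Psi _ _ W j e).
Proof.
have [C hC] := Phi_Psi_localized W_cdv.
exists (Num.max 1 C); first by rewrite le_max lexx.
have mono j (Z : finType) (f : Z -> vec -> R) : localized C j f -> localized (Num.max 1 C) j f.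
  move=> [h1 [a h2] h3]; split.
  - by move=> m x cx; apply: (le_trans (h1 m x cx)); rewrite ler_wpM2r ?powR_ge0// le_max lexx orbT.
  - exists a => m x cx fx i; apply: (le_trans (h2 m x cx fx i)).
    by rewrite ler_wpM2r ?invr_ge0 ?exprn_ge0// le_max lexx orbT.
  - by move=> x cx; apply: (le_trans (h3 x cx)); rewrite le_max lexx orbT.
by move=> j /hC[h1 h2]; split; [exact: mono|move=> e; exact: mono].
Qed.

Lemma bm_Phi j (m : Zidx W j) : (J0 <= j)%N -> bm (cl (Phi m)).
Proof.
have [C _ hC] := localization_const; move=> /hC[h _].
exact: (bm_cl_localized (@Phi_measurable _ _ _ _ _ W_cdv j) h).
Qed.

Lemma bm_Psi j e (m : Zidx W j) : (J0 <= j)%N -> bm (cl (Psi e m)).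
Proof.
have [C _ hC] := localization_const; move=> /hC[_ h].
exact: (bm_cl_localized (@Psi_measurable _ _ _ _ _ W_cdv j e) (h e)).
Qed.

Definition cPhi j (m : Zidx W j) := cl (Phi m).
Definition cPsi j (em : orient d * Zidx W j) := cl (Psi em.1 em.2).

Lemma orthonormal_Phi j : (J0 <= j)%N -> onfamily unif (@cPhi j).
Proof.
move=> Jj m m'; rewrite -(Phi_orthonormal W_cdv)// innerE//; exact: bm_Phi.
Qed.

Lemma orthonormal_Psi j : (J0 <= j)%N -> onfamily unif (@cPsi j).
Proof.
move=> Jj [e m] [e' m']; rewrite -pair_eqE/= -(Psi_orthonormal W_cdv)// innerE//; exact: bm_Psi.
Qed.

Lemma ae_cl (f g : vec -> R) : (\forall x \ae unif, f x = g x) -> {ae unif, forall x, cl f x = cl g x}.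
Proof.
move=> fg; apply: filterS2 fg (cube_ae (d := d)) => x fgx cx.
by rewrite /cl clampv_id.
Qed.

(** In an expansion over an orthonormal family the coefficients can only be the inner products. *)
Lemma ae_dot_coef (I : finType) (phi : I -> vec -> R) (f : vec -> R) (c : I -> R) :
  (forall i, bm (phi i)) -> onfamily unif phi -> bm f ->
  {ae unif, forall x, f x = \sum_i c i * phi i x} ->
  {ae unif, forall x, f x = \sum_i dot unif f (phi i) * phi i x}.
Proof.
move=> bphi on bf fE.
have fE' := fE; apply: filterS fE => x ->; apply: eq_bigr => i _; congr (_ * _).
rewrite -[LHS](dot_lincomb_basis bphi on c i).
apply: ae_eq_dot => //; first exact: bm_lincomb.
by apply: filterS fE' => y ->.
Qed.

Lemma Phi_nested_le j j' (m : Zidx W j) : (J0 <= j)%N -> (j <= j')%N ->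
  {ae unif, forall x, cPhi m x = \sum_m' dot unif (cPhi m) (@cPhi j' m') * cPhi m' x}.
Proof.
move=> Jj jj'; have Jj' := leq_trans Jj jj'.
suff [c hc] : exists c : Zidx W j' -> R,
    {ae unif, forall x, cPhi m x = \sum_m' c m' * cPhi m' x}.
  apply: (ae_dot_coef _ _ _ hc); [by move=> i; exact: bm_Phi|exact: orthonormal_Phi|exact: bm_Phi].
rewrite -(subnKC jj'); elim: (j' - j)%N => [|i [c hc]].
  rewrite addn0; exists (fun m' => (m' == m)%:R); apply: aeW => x.
  by rewrite (bigD1 m)//= eqxx mul1r big1 ?addr0// => i /negbTE ->; rewrite mul0r.
rewrite addnS.
have /choice[c' hc'] : forall m' : Zidx W (j + i), exists c' : Zidx W (j + i).+1 -> R,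
    \forall x \ae unif, Phi m' x = \sum_m'' c' m'' * Phi m'' x.
  by move=> m'; apply: (Phi_nested W_cdv); rewrite (leq_trans Jj)// leq_addr.
exists (fun m'' => \sum_m' c m' * c' m' m'').
have h : {ae unif, forall x, forall m' : Zidx W (j + i), cPhi m' x = \sum_m'' c' m' m'' * cPhi m'' x}.
  by apply: filter_forall => m'; exact: (ae_cl (hc' m')).
apply: filterS2 hc h => x -> h.
under eq_bigr do rewrite h big_distrr/=.
rewrite exchange_big/=; apply: eq_bigr => m'' _; rewrite big_distrl/=.
by apply: eq_bigr => m' _; rewrite mulrA.
Qed.

(** If every u i is in the span of v then the inner products of h with u are those of the projection of h on v; apply the Bessel inequality to that projection. *)
Lemma span_energy (I I' : finType) (u : I -> vec -> R) (v : I' -> vec -> R) (h : vec -> R) :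
  (forall i, bm (u i)) -> (forall i, bm (v i)) -> onfamily unif u -> onfamily unif v -> bm h ->
  (forall i, exists c : I' -> R, {ae unif, forall x, u i x = \sum_i' c i' * v i' x}) ->
  \sum_i dot unif h (u i) ^+ 2 <= \sum_i dot unif h (v i) ^+ 2.
Proof.
move=> bu bv onu onv bh span.
pose q := l2proj unif v h; have bq : bm q by exact: bm_l2proj.
rewrite (eq_bigr (fun i => dot unif q (u i) ^+ 2)); last first.
  move=> i _; congr (_ ^+ 2); have [c hc] := span i.
  have bc : bm (fun x => \sum_i' c i' * v i' x) by exact: bm_lincomb.
  rewrite dotC (ae_eq_dot (bu i) bc bh hc) [RHS]dotC (ae_eq_dot (bu i) bc bq hc).
  rewrite dot_lincomb// dot_suml//.
  by apply: eq_bigr => i' _; rewrite dotC.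
apply: (le_trans (bessel bu onu bq)).
by rewrite dot_lincomb//; apply: ler_sum => i _; rewrite expr2.
Qed.

(** The squared norm of the projection of h on V_j. *)
Definition energy (h : vec -> R) j : R := \sum_m dot unif h (@cPhi j m) ^+ 2.

Lemma energy_mono h j j' : bm h -> (J0 <= j)%N -> (j <= j')%N -> energy h j <= energy h j'.
Proof.
move=> bh Jj jj'; have Jj' := leq_trans Jj jj'.
apply: span_energy => //; try (by move=> m; exact: bm_Phi); try exact: orthonormal_Phi.
by move=> m; eexists; exact: Phi_nested_le.
Qed.

Lemma Phi_split_ae j (m : Zidx W j.+1) : (J0 <= j)%N ->
  exists (c : Zidx W j -> R) (c' : orient d * Zidx W j -> R),
    {ae unif, forall x, cPhi m x = \sum_m' c m' * cPhi m' x + \sum_em c' em * @cPsi j em x}.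
Proof.
move=> Jj; have [c [c' hc]] := Phi_split W_cdv m Jj.
exists c, (fun em => c' em.1 em.2); apply: filterS (ae_cl hc) => x hx.
rewrite [LHS]hx /cl; congr (_ + _).
by rewrite pair_bigA.
Qed.

Lemma Psi_orth_levels l l' em em' : (J0 <= l)%N -> (J0 <= l')%N -> l != l' ->
  dot unif (@cPsi l em) (@cPsi l' em') = 0.
Proof.
move=> Jl Jl' ll'; rewrite -(Psi_orthogonal_levels W_cdv em.1 em'.1 em.2 em'.2 Jl Jl' ll').
by rewrite innerE//; exact: bm_Psi.
Qed.

(** The basis only provides this at the coarsest level; it is propagated upwards since a scaling function of level j+1 is a combination of scaling functions and wavelets of level j. *)
Lemma Phi_Psi_orth j l (m : Zidx W j) em : (J0 <= j)%N -> (j <= l)%N ->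
  dot unif (cPhi m) (@cPsi l em) = 0.
Proof.
move=> Jj; rewrite -(subnKC Jj) in m *; elim: (j - J0)%N l m em => [|i ih] l m em jl.
  rewrite addn0 in m jl *; rewrite -(Phi_Psi_orthogonal W_cdv em.1 m em.2 jl).
  by rewrite innerE//; [exact: bm_Phi|exact: bm_Psi].
rewrite addnS in m jl *.
have Ji : (J0 <= J0 + i)%N by exact: leq_addr.
have Jl : (J0 <= l)%N by rewrite (leq_trans Ji)// ltnW.
have [c [c' hc]] := Phi_split_ae m Ji.
have bm1 (m' : Zidx W (J0 + i)) : bm (cPhi m') by exact: bm_Phi.
have bm2 em' : bm (@cPsi (J0 + i) em') by exact: bm_Psi.
have b3 : bm (@cPsi l em) by exact: bm_Psi.
have bl1 := bm_lincomb bm1 c; have bl2 := bm_lincomb bm2 c'.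
rewrite (ae_eq_dot _ (bmD bl1 bl2) b3 hc); last by apply: bm_Phi; rewrite (leq_trans Ji).
rewrite dotDl// dot_suml// dot_suml// big1 ?add0r; last first.
  by move=> m' _; rewrite ih ?mulr0// ltnW.
by rewrite big1// => em' _; rewrite Psi_orth_levels ?mulr0// ltn_eqF.
Qed.

(** Scaling functions and wavelets of level j form together an orthonormal family whose span contains V_(j+1). *)
Lemma energy_succ h j : bm h -> (J0 <= j)%N ->
  energy h j.+1 <= energy h j + \sum_em dot unif h (@cPsi j em) ^+ 2.
Proof.
move=> bh Jj.
pose v (i : Zidx W j + orient d * Zidx W j) : vec -> R :=
  match i with inl m => cPhi m | inr em => cPsi em end.
have bv i : bm (v i) by case: i => [m|em]; [exact: bm_Phi|exact: bm_Psi].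
have onv : onfamily unif v.
  move=> [m|em] [m'|em'] /=; first by rewrite orthonormal_Phi.
  - by rewrite Phi_Psi_orth.
  - by rewrite dotC Phi_Psi_orth.
  - by rewrite orthonormal_Psi.
have -> : energy h j + \sum_em dot unif h (@cPsi j em) ^+ 2 = \sum_i dot unif h (v i) ^+ 2.
  by rewrite big_sumType.
have Jj1 : (J0 <= j.+1)%N by rewrite ltnW.
apply: span_energy => //; [by move=> m; exact: bm_Phi|exact: orthonormal_Phi|] => m.
have [c [c' hc]] := Phi_split_ae m Jj.
exists (fun i => match i with inl m => c m | inr em => c' em end).
by apply: filterS hc => x ->; rewrite big_sumType.
Qed.

(** The projection on V_J is the best approximation in V_J, so it does at least as well as the approximation given by density. *)
Lemma energy_dense h eps : bm h -> 0 < eps ->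
  exists2 J, (J0 <= J)%N & dot unif h h - energy h J < eps.
Proof.
move=> bh eps0.
have bh2 := bmX 2 bh.
have [|J JJ [c hc]] := Phi_dense W_cdv (bm_measurable bh) _ eps0.
  by rewrite -ExE// ltry.
exists J => //; apply: le_lt_trans hc.
have bphi (m : Zidx W J) : bm (cPhi m) by exact: bm_Phi.
have bl := bm_lincomb bphi c.
rewrite (_ : Rintegral _ _ _ = Ex unif (fun x => (h x - \sum_m c m * @cPhi J m x) ^+ 2)); last first.
  rewrite /Ex /Rintegral; congr fine; apply: ae_eq_integral => //.
  - apply/measurable_EFinP; apply: measurable_funX; apply: measurable_funB; first exact: bm_measurable.
    apply: measurable_sum => m; apply: measurable_funM => //.
    exact: Phi_measurable W_cdv _ _.
  - by apply/measurable_EFinP; apply: bm_measurable; bmt.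
  - apply: filterS cube_ae => x cx _ /=; congr (_ ^+ 2)%:E; congr (_ - _).
    by apply: eq_bigr => m _; rewrite /cPhi /cl clampv_id.
rewrite -dotff dotBl//; last by bmt.
rewrite !dotBr// dot_lincomb//; last exact: orthonormal_Phi.
have e1 : dot unif (fun x => \sum_m c m * @cPhi J m x) h =
  \sum_m c m * dot unif h (@cPhi J m) by rewrite dotC dot_sumr.
rewrite e1 dot_sumr// /energy.
have : 0 <= \sum_m (c m - dot unif h (@cPhi J m)) ^+ 2.
  by apply: sumr_ge0 => m _; exact: sqr_ge0.
rewrite (eq_bigr (fun m => c m * c m - c m * dot unif h (@cPhi J m) -
   (c m * dot unif h (@cPhi J m) - dot unif h (@cPhi J m) ^+ 2))); last by move=> m _; ring.
rewrite !sumrB; lra.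
Qed.

Section tail.
Variables (alpha M : R).
Hypotheses (alpha0 : 0 < alpha) (M0 : 0 <= M).
Let q : R := 2 `^ (- (2 * alpha)).

Let q0 : 0 < q. Proof. exact: powR_gt0. Qed.
Let q1 : q < 1.
Proof.
rewrite /q powRN invf_lt1 ?powR_gt0//.
have := @gt0_ltr_powR _ (2 * alpha) (mulr_gt0 (ltr0Sn _ 1) alpha0) 1 2.
by rewrite powR1; apply; rewrite ?nnegrE// ltr1n.
Qed.

(** The part of the Hoelder condition that concerns the wavelet coefficients. *)
Definition coef_bound (h : vec -> R) := forall l em, (J0 <= l)%N ->
  2 `^ (l%:R * (alpha + d%:R / 2)) * `|dot unif h (@cPsi l em)| <= M.

(** There are O(2^(ld)) wavelets of level l and each squared coefficient is O(2^(-l(2 alpha + d))): the energy gained from level l to level l+1 is O(2^(-2 alpha l)). These gains form a geometric series, and by density they add up to the squared norm of h. *)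
Lemma tail_le : exists2 C : R, 0 < C & forall h j, bm h -> coef_bound h -> (J0 <= j)%N ->
  dot unif h h - energy h j <= C * q ^+ j.
Proof.
have [c0 [Cc [c00 card]]] := card_Zidx W_cdv.
have Cc0 : 0 <= Cc.
  have /andP[h1 h2] := card J0 (leqnn _); have := le_trans h1 h2.
  rewrite ler_pM2r ?exprn_gt0//; apply: le_trans; exact: ltW.
pose D := #|{: orient d}|%:R * Cc * M ^+ 2.
have D0 : 0 <= D by rewrite mulr_ge0 ?sqr_ge0// mulr_ge0.
have detail h l : coef_bound h -> (J0 <= l)%N -> \sum_em dot unif h (@cPsi l em) ^+ 2 <= D * q ^+ l.
  move=> hM Jl; set s := 2 `^ (l%:R * (alpha + d%:R / 2)).
  have s0 : 0 < s by exact: powR_gt0.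
  have s2 : s ^+ 2 = (q ^+ l)^-1 * scale l.
    rewrite /s /q -powR_mulrn ?powR_ge0// -powRrM -powR_mulrn ?powR_ge0// -powRrM.
    rewrite -powRN /scale -[2 ^+ _]powR_mulrn// -powRD; last by rewrite pnatr_eq0 implybT.
    by congr (_ `^ _); rewrite natrM; field.
  apply: (@le_trans _ _ (\sum_(em : orient d * Zidx W l) (M / s) ^+ 2)).
    apply: ler_sum => em _; rewrite -[X in X <= _]real_normK ?num_real// lerXn2r ?nnegrE//.
      by rewrite divr_ge0// ltW.
    by rewrite ler_pdivlMr// mulrC; exact: hM.
  rewrite sumr_const card_prod -[_ *+ _]mulr_natl natrM expr_div_n s2.
  have /andP[_ hc] := card l Jl.
  rewrite invfM invrK; have sc := scale_gt0 l.
  apply: (@le_trans _ _ (#|{: orient d}|%:R * (Cc * scale l) * (M ^+ 2 * (q ^+ l / scale l)))).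
    rewrite ler_wpM2r//; last by rewrite ler_wpM2l.
    by rewrite mulr_ge0 ?sqr_ge0// mulr_ge0 ?invr_ge0 ?exprn_ge0// ltW.
  rewrite le_eqVlt; apply/orP; left; apply/eqP; rewrite /D; field; exact: lt0r_neq0.
have q1' : 0 < 1 - q by rewrite subr_gt0.
(* Partial sums of the geometric series. *)
have up h j n : bm h -> coef_bound h -> (J0 <= j)%N ->
    energy h (j + n) <= energy h j + D * q ^+ j * ((1 - q ^+ n) / (1 - q)).
  move=> bh hM Jj; elim: n => [|n ih]; first by rewrite addn0 expr0 subrr mul0r mulr0 addr0.
  have Jn : (J0 <= j + n)%N by rewrite (leq_trans Jj)// leq_addr.
  rewrite addnS; apply: (le_trans (energy_succ bh Jn)).
  have := detail h (j + n)%N hM Jn.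
  rewrite (_ : D * q ^+ j * ((1 - q ^+ n.+1) / (1 - q)) =
    D * q ^+ j * ((1 - q ^+ n) / (1 - q)) + D * q ^+ (j + n)); first by lra.
  by rewrite exprD exprS; field; exact: lt0r_neq0.
exists (D / (1 - q) + 1); first by rewrite ltr_wpDl// divr_ge0// ltW.
move=> h j bh hM Jj; rewrite mulrDl; apply: (@le_trans _ _ (D / (1 - q) * q ^+ j + q ^+ j)); last by rewrite mul1r.
have [J JJ hJ] := energy_dense bh (exprn_gt0 j q0).
have qn : D * q ^+ j * ((1 - q ^+ J) / (1 - q)) <= D / (1 - q) * q ^+ j.
  rewrite (_ : D / (1 - q) * q ^+ j = D * q ^+ j * (1 / (1 - q))); last by ring.
  apply: ler_wpM2l; first by rewrite mulr_ge0// exprn_ge0// ltW.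
  apply: ler_wpM2r; first by rewrite invr_ge0 ltW.
  by rewrite lerBlDr lerDl exprn_ge0// ltW.
have := up h j J bh hM Jj.
have := energy_mono bh JJ (leq_addl j J : (J <= j + J)%N).
move: hJ qn; set e1 := D * _ * _; set e2 := D / _ * _; lra.
Qed.

End tail.

End wavelet_facts.

(** * Conditional expectations and the functional *)

Section step_approximation.
Context {dT : measure_display} {T : measurableType dT} {R : realType}.

(** Round the values of f down to multiples of e. *)
Lemma bm_step_approx (f : T -> R) (e : R) : bm f -> 0 < e ->
  exists (n : nat) (v : 'I_n -> R) (B : 'I_n -> set T),
    (forall i, measurable (B i)) /\
    forall x, `|f x - \sum_i v i * \1_(B i) x| <= e.
Proof.
move=> bf e0; have [C C0 hC] := bm_bound bf.
pose t x := (f x + C) / e.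
have t0 x : 0 <= t x.
  by rewrite divr_ge0 ?(ltW e0)//; have := hC x; rewrite ler_norml => /andP[]; lra.
pose N := (Num.truncn (2 * C / e)).+1.
have tN x : (Num.truncn (t x) < N)%N.
  rewrite truncn_lt_nat//; apply: le_lt_trans (truncnS_gt _).
  apply: ler_wpM2r; first by rewrite invr_ge0 ltW.
  by have := hC x; rewrite ler_norml => /andP[]; lra.
exists N, (fun i => i%:R * e - C), (fun i => t @^-1` `[i%:R, i.+1%:R[); split.
  move=> i; rewrite -[X in measurable X]setTI.
  have mt : measurable_fun setT t.
    by apply: bm_measurable; apply: bmM; [apply: bmD => //; exact: bm_cst|exact: bm_cst].
  by apply: mt.
move=> x; have itv := truncn_itv (t0 x).
rewrite (bigD1 (Ordinal (tN x)))//= indicE mem_set/=; last by rewrite in_itv/=.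
rewrite big1 ?addr0 ?mulr1; last first.
  move=> i ix; rewrite indicE memNset ?mulr0//= in_itv/= => /truncn_def h.
  by move/eqP: ix; apply; apply: val_inj => /=; rewrite h.
have /andP[h1 h2] := itv.
have fE : f x = t x * e - C by rewrite /t divfK ?gt_eqF// addrK.
rewrite {1}fE ler_norml -natr1 in h2 *.
have g1 := ler_wpM2r (ltW e0) h1; have g2 := ler_wpM2r (ltW e0) (ltW h2).
by move: g1 g2; rewrite mulrDl mul1r; lra.
Qed.

End step_approximation.

Section almost_everywhere_products.
Context {d1 d2 : measure_display} {T1 : measurableType d1}
  {T2 : measurableType d2} {R : realType}.

Lemma ae_fst (P : probability T1 R) (Q : probability T2 R) (A : T1 -> Prop) :
  {ae P, forall x, A x} -> {ae (P \x Q)%E, forall z, A z.1}.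
Proof.
move=> [N [mN PN AN]]; exists (N `*` setT); split.
- exact: measurableX.
- by rewrite product_measure1E//= PN mul0e.
- by move=> [x y] /= h; split => //; exact: AN.
Qed.

Lemma ae_snd (P : probability T1 R) (Q : probability T2 R) (A : T2 -> Prop) :
  {ae Q, forall x, A x} -> {ae (P \x Q)%E, forall z, A z.2}.
Proof.
move=> [N [mN PN AN]]; exists (setT `*` N); split.
- exact: measurableX.
- by rewrite product_measure1E//= PN mule0.
- by move=> [x y] /= h; split => //; exact: AN.
Qed.

End almost_everywhere_products.

Section ae_samples.
Context {dT : measure_display} {T : measurableType dT} {R : realType}.
Variable P : probability T R.

Lemma ae_iid n (G : set T) : measurable G -> {ae P, forall x, G x} ->
  {ae (iid P n), forall D : n.-tuple T, forall i, G (tnth D i)}.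
Proof.
move=> mG PG.
have EG : Ex P (\1_G) = 1.
  rewrite -(Ex_cst P 1); apply: ae_eq_Ex; [exact: bm_indic|exact: bm_cst|].
  by apply: filterS PG => x Gx /=; rewrite indicE mem_set.
pose A := \bigcap_(i in [set: 'I_n]) ((fun D : n.-tuple T => tnth D i) @^-1` G).
have mA : measurable A.
  apply: fin_bigcap_measurable => // i _.
  by rewrite -[X in measurable X]setTI; exact: (measurable_tnth i).
suff : {ae (iid P n), forall D, A D} by apply: filterS => D AD i; exact: AD.
apply: Ex_indic_ae => //.
rewrite (_ : \1_A = fun D : n.-tuple T => \prod_i \1_G (tnth D i)).
  by rewrite (Ex_iid_prod P (f := fun=> \1_G)) ?big1// => i; exact: bm_indic.
apply/funext => D; rewrite indicE; case: (asboolP (A D)) => AD.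
  by rewrite mem_set// big1// => i _; rewrite indicE mem_set//; exact: AD.
rewrite memNset//=.
have [i hi] : exists i, ~ G (tnth D i).
  by apply/existsNP => h; apply: AD => i _; exact: h.
by rewrite (bigD1 i)//= indicE memNset ?mul0r.
Qed.

End ae_samples.

Section model_facts.
Context {R : realType} {d : nat}.
Local Notation vec := (vec R d).
Local Notation obs := (obs R d).
Local Notation unif := (unif R d).
Local Notation obsX := (@obsX R d).
Local Notation obsA := (@obsA R d).
Local Notation obsY := (@obsY R d).

Lemma measurable_obsX : measurable_fun setT obsX.
Proof. by apply: (measurableT_comp measurable_fst); exact: measurable_fst. Qed.

Lemma measurable_obsA : measurable_fun setT obsA.
Proof. by apply: (measurableT_comp measurable_snd); exact: measurable_fst. Qed.

Lemma measurable_obsY : measurable_fun setT obsY.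
Proof. exact: measurable_snd. Qed.

HB.instance Definition _ := isMeasurableFun.Build _ _ _ _ obsX measurable_obsX.

Variable P : probability obs R.

Section condexp.
Variables (F Fb : obs -> R).
Hypotheses (mF : measurable_fun setT F) (bF : bm Fb) (FE : {ae P, forall o, F o = Fb o}).

Let int_eq (B : set obs) : measurable B ->
  (\int[P]_(o in B) (F o)%:E = \int[P]_(o in B) (Fb o)%:E)%E.
Proof.
move=> mB; apply: ae_eq_integral => //.
- by apply/measurable_EFinP; exact: measurable_funTS.
- by apply/measurable_EFinP; apply: measurable_funTS; exact: bm_measurable.
- by apply: filterS FE => o /= -> _.
Qed.

(** The signed measure B |-> E[F; X in B] is absolutely continuous with respect to the law of X; take its Radon-Nikodym derivative. *)
Lemma condexp_exists : exists g, is_condexp P F g.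
Proof.
have intF := bm_integrable P bF.
pose nu : {charge set vec -> \bar R} := pushforward (induced_charge intF) obsX.
pose nu' := nu measurable_obsX.
pose mu : {sigma_finite_measure set vec -> \bar R} := distribution P obsX.
have dom : nu' `<< mu.
  apply/null_content_dominatesP => A mA /= muA.
  rewrite /nu' /nu /pushforward /induced_charge /=.
  apply: null_set_integral => //.
  - by rewrite -[X in measurable X]setTI; exact: measurable_obsX.
  - by apply: measurable_funTS; apply/measurable_EFinP; exact: bm_measurable.
have := Radon_Nikodym_integral dom; have := Radon_Nikodym_integrable dom.
have := fun x => Radon_Nikodym_fin_num x dom.
set f := Radon_Nikodym _ _ => ffin fint fE.
have mf : measurable_fun setT f by exact: measurable_int fint.
have intfX : P.-integrable setT (f \o obsX).
  apply/integrableP; split; first exact: measurableT_comp.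
  have /integrableP[_] := fint; rewrite ge0_integral_distribution//.
  exact: measurableT_comp.
have ffE o : ((fine (f (obsX o)))%:E = f (obsX o))%E by rewrite fineK.
exists (fine \o f); split.
- exact: (measurableT_comp _ mf).
- by apply: eq_integrable intfX => // o _ /=; rewrite ffE.
- move=> B mB; have mXB : measurable (obsX @^-1` B).
    by rewrite -[X in measurable X]setTI; exact: measurable_obsX.
  rewrite int_eq//; apply: (etrans (fE B mB)).
  rewrite [LHS](integral_pushforward measurable_obsX mf _ mB).
    by apply: eq_integral => o _ /=; rewrite ffE.
  exact: (integrableS measurableT mXB (@subsetT _ _) intfX).
Qed.

Lemma condexpP : is_condexp P F (condexp P F).
Proof. exact: (xgetPex _ condexp_exists). Qed.

(** The defining property of a conditional expectation is this identity for indicator functions; it extends to bounded functions through uniform approximation by step functions. *)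
Lemma Ex_condexp_mul (g gb phi : vec -> R) : is_condexp P F g ->
  bm gb -> {ae P, forall o, g (obsX o) = gb (obsX o)} -> bm phi ->
  Ex P (fun o => Fb o * phi (obsX o)) = Ex P (fun o => gb (obsX o) * phi (obsX o)).
Proof.
move=> [mg ig gE] bgb ggb bphi.
have bgX : bm (fun o => gb (obsX o)) by exact: bm_comp measurable_obsX bgb.
pose D o := Fb o - gb (obsX o).
have bD : bm D by exact: bmB.
have bDn := bm_norm bD.
have bpX : bm (fun o => phi (obsX o)) by exact: bm_comp measurable_obsX bphi.
have D0 B : measurable B -> Ex P (fun o => D o * \1_B (obsX o)) = 0.
  move=> mB; have mXB : measurable (obsX @^-1` B).
    by rewrite -[X in measurable X]setTI; exact: measurable_obsX.
  have b1 : bm (fun o => \1_B (obsX o) : R) by exact: bm_comp measurable_obsX (bm_indic mB).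
  have -> : (fun o => D o * \1_B (obsX o)) =
      (fun o => Fb o * \1_B (obsX o) - gb (obsX o) * \1_B (obsX o)).
    by apply/funext => o; rewrite /D mulrBl.
  rewrite ExB; [|bmt|bmt].
  apply/eqP; rewrite subr_eq0; apply/eqP/EFin_inj; rewrite ExE; [|bmt].
  rewrite ExE; [|bmt].
  have pat (h : obs -> R) : (\int[P]_o (h o * \1_B (obsX o))%:E = \int[P]_(o in obsX @^-1` B) (h o)%:E)%E.
    rewrite [RHS]integral_mkcond; apply: eq_integral => o _.
    rewrite patchE indicE; case: ifPn; rewrite ?inE/= => hB.
      by rewrite mem_set// mulr1.
    by move: hB; rewrite notin_setE => hB; rewrite memNset ?mulr0.
  rewrite !pat -int_eq// gE//; apply: ae_eq_integral => //.
  - by apply/measurable_EFinP/measurable_funTS; apply: measurableT_comp.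
  - by apply/measurable_EFinP/measurable_funTS; exact: bm_measurable.
  - by apply: filterS ggb => o /= -> _.
(* D is the residual; it is orthogonal to indicator functions of X, hence to step functions. *)
suff : Ex P (fun o => D o * phi (obsX o)) = 0.
  rewrite (_ : (fun o => D o * phi (obsX o)) =
    (fun o => Fb o * phi (obsX o) - gb (obsX o) * phi (obsX o))).
    by rewrite ExB; [move/eqP; rewrite subr_eq0 => /eqP|bmt|bmt].
  by apply/funext => o; rewrite /D mulrBl.
set I := Ex P _; pose K := Ex P (fun o => `|D o|).
have K0 : 0 <= K by exact: Ex_ge0.
have IK e : 0 < e -> `|I| <= e * K.
  move=> e0; have [n [v [B [mB hB]]]] := bm_step_approx bphi e0.
  pose s o := \sum_i v i * \1_(B i) (obsX o).
  have b1 i : bm (fun o => \1_(B i) (obsX o) : R).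
    by exact: bm_comp measurable_obsX (bm_indic (mB i)).
  have bs : bm s by rewrite /s; bmt.
  have sD : Ex P (fun o => D o * s o) = 0.
    rewrite -[LHS]/(dot P D s) dot_sumr// big1// => i _.
    by rewrite /dot D0 ?mulr0.
  have -> : I = Ex P (fun o => D o * (phi (obsX o) - s o)).
    rewrite (_ : (fun o => D o * (phi (obsX o) - s o)) =
      (fun o => D o * phi (obsX o) - D o * s o)); last by apply/funext => o; rewrite mulrBr.
    by rewrite ExB ?sD ?subr0//; bmt.
  have h o : `|D o * (phi (obsX o) - s o)| <= e * `|D o|.
    by rewrite normrM mulrC ler_wpM2r//; exact: hB.
  rewrite ler_norml /K -ExZ// -ExN; last by bmt.
  apply/andP; split; apply: le_Ex; try (by bmt); move=> o;
    by have := h o; rewrite ler_norml => /andP[].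
apply/eqP; rewrite -normr_le0; apply/ler_addgt0Pl => e e0.
rewrite addr0; apply: (le_trans (IK (e / (K + 1)) _)); first by rewrite divr_gt0// ltr_wpDl.
by rewrite mulrAC ler_pdivrMr ?ltr_wpDl// ler_wpM2l ?(ltW e0)// lerDl.
Qed.

Lemma condexp_unique g1 g2 : is_condexp P F g1 -> is_condexp P F g2 ->
  {ae P, forall o, g1 (obsX o) = g2 (obsX o)}.
Proof.
move=> [mg1 ig1 h1] [mg2 ig2 h2].
have mE1 : measurable_fun setT (EFin \o g1) by exact/measurable_EFinP.
have mE2 : measurable_fun setT (EFin \o g2) by exact/measurable_EFinP.
have [N [mN N0 NP]] : ae_eq (distribution P obsX) setT (EFin \o g1) (EFin \o g2).
  apply: integral_ae_eq => //.
    exact: (integrable_pushforward measurable_obsX mE1).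
  move=> B _ mB; have mXB : measurable (obsX @^-1` B).
    by rewrite -[X in measurable X]setTI; exact: measurable_obsX.
  rewrite [LHS](integral_pushforward measurable_obsX mE1 _ mB); last exact: (integrableS measurableT mXB (@subsetT _ _) ig1).
  rewrite [RHS](integral_pushforward measurable_obsX mE2 _ mB); last exact: (integrableS measurableT mXB (@subsetT _ _) ig2).
  by rewrite -h1// -h2.
exists (obsX @^-1` N); split => //.
  by rewrite -[X in measurable X]setTI; exact: measurable_obsX.
move=> o /= h; apply: NP => /= h'; apply: h.
by have := h' I => -[].
Qed.

End condexp.

Hypothesis PX : forall B, measurable B -> P (obsX @^-1` B) = unif B.

Lemma Ex_obsX (f : vec -> R) : bm f -> Ex P (fun o => f (obsX o)) = Ex unif f.
Proof.
move=> bf; rewrite -(Ex_distribution P obsX bf) /Ex /Rintegral; congr fine.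
by apply: eq_measure_integral => A mA _; exact: PX.
Qed.

Lemma ae_obsX (A : vec -> Prop) : {ae unif, forall x, A x} -> {ae P, forall o, A (obsX o)}.
Proof.
move=> [N [mN N0 AN]]; exists (obsX @^-1` N); split.
- by rewrite -[X in measurable X]setTI; exact: measurable_obsX.
- by rewrite PX.
- by move=> o /= h; exact: AN.
Qed.

Lemma dot_obsX (f g : vec -> R) : bm f -> bm g ->
  dot P (fun o => f (obsX o)) (fun o => g (obsX o)) = dot unif f g.
Proof. by move=> bf bg; rewrite /dot -Ex_obsX//; exact: bmM. Qed.

Lemma bm_obsX (f : vec -> R) : bm f -> bm (fun o => f (obsX o)).
Proof. exact: bm_comp measurable_obsX. Qed.

Variables (C1 C2 : R).
Hypothesis rangeAY : {ae P, forall o, C1 <= obsA o <= C2 /\ C1 <= obsY o <= C2}.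

(** An almost surely equal version of A that is bounded everywhere. *)
Definition clampA (o : obs) := clamp C1 C2 (obsA o).
Definition clampY (o : obs) := clamp C1 C2 (obsY o).

Lemma clamp_le t : `|clamp C1 C2 t| <= `|C1| + `|C2| + 1.
Proof.
rewrite /clamp /Order.max /Order.min; have := normr_ge0 C1; have := normr_ge0 C2.
have := ler_norm C1; have := ler_norm C2; have := ler_norm (- C1); have := ler_norm (- C2).
rewrite !normrN ler_norml.
by case: (ltP t C2) => ?; case: (ltP C1 _) => ?; lra.
Qed.

Lemma bm_clampA : bm clampA.
Proof.
split; last by exists (`|C1| + `|C2| + 1) => o; exact: clamp_le.
by apply: (measurableT_comp (@measurable_clamp _ C1 C2)); exact: measurable_obsA.
Qed.

Lemma bm_clampY : bm clampY.
Proof.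
split; last by exists (`|C1| + `|C2| + 1) => o; exact: clamp_le.
by apply: (measurableT_comp (@measurable_clamp _ C1 C2)); exact: measurable_obsY.
Qed.

Lemma clampA_ae : {ae P, forall o, obsA o = clampA o}.
Proof. by apply: filterS rangeAY => o [h _]; rewrite /clampA clamp_id. Qed.

Lemma clampY_ae : {ae P, forall o, obsY o = clampY o}.
Proof. by apply: filterS rangeAY => o [_ h]; rewrite /clampY clamp_id. Qed.

Variables (p b : vec -> R).
Hypotheses (ucp : bm (cl p)) (ucb : bm (cl b)).
Hypotheses (Ap : is_condexp P obsA p) (Yb : is_condexp P obsY b).

Let pX o := cl p (obsX o).
Let bX o := cl b (obsX o).

Lemma cond_A (f : vec -> R) : bm f -> dot P clampA (fun o => f (obsX o)) = dot unif (cl p) f.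
Proof.
move=> bf; rewrite -dot_obsX//.
apply: (Ex_condexp_mul measurable_obsA bm_clampA clampA_ae Ap) => //.
exact: (ae_obsX (cl_ae p)).
Qed.

Lemma cond_Y (f : vec -> R) : bm f -> dot P clampY (fun o => f (obsX o)) = dot unif (cl b) f.
Proof.
move=> bf; rewrite -dot_obsX//.
apply: (Ex_condexp_mul measurable_obsY bm_clampY clampY_ae Yb) => //.
exact: (ae_obsX (cl_ae b)).
Qed.

(** Test the conditional expectation against g itself: E g^2 = E Z g, and the Cauchy-Schwarz inequality bounds the right-hand side by B |g|. *)
Lemma regression_L2 (Z : obs -> R) (g : vec -> R) : bm Z -> bm g ->
  (forall o, `|Z o| <= `|C1| + `|C2| + 1) ->
  (forall f, bm f -> dot P Z (fun o => f (obsX o)) = dot unif g f) ->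
  dot unif g g <= (`|C1| + `|C2| + 1) ^+ 2.
Proof.
move=> bZ bg ZB Zg; set B := `|C1| + `|C2| + 1.
have B0 : 0 <= B by rewrite !addr_ge0.
have bgX := bm_obsX bg.
have h := dot_CS P bZ bgX; rewrite Zg// dot_obsX// in h.
have ZZ : dot P Z Z <= B ^+ 2.
  rewrite dotff -[leRHS](Ex_cst P); apply: le_Ex; [bmt|exact: bm_cst|] => o.
  by rewrite -real_normK ?num_real// lerXn2r ?nnegrE.
have g0 := dotff_ge0 unif g.
have [->|gn0] := eqVneq (dot unif g g) 0; first exact: sqr_ge0.
have gp : 0 < dot unif g g by rewrite lt_neqAle eq_sym gn0.
apply: le_trans ZZ; move: h; rewrite expr2 ler_pM2r//.
Qed.

(** E Cov(A, Y | X) = E[AY] - E[E[A|X] E[Y|X]], the form that the estimators imitate. *)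
Lemma psiE : psi P = Ex P (fun o => clampA o * clampY o) - dot unif (cl p) (cl b).
Proof.
have bA := bm_clampA; have bY := bm_clampY.
have cAE := clampA_ae; have cYE := clampY_ae.
have hA := condexpP measurable_obsA bA cAE.
have hY := condexpP measurable_obsY bY cYE.
have pA : {ae P, forall o, condexp P obsA (obsX o) = pX o}.
  apply: filterS2 (condexp_unique hA Ap) (ae_obsX (cl_ae p)) => o -> ->; by [].
have pY : {ae P, forall o, condexp P obsY (obsX o) = bX o}.
  apply: filterS2 (condexp_unique hY Yb) (ae_obsX (cl_ae b)) => o -> ->; by [].
have bpX : bm pX by exact: bm_obsX. have bbX : bm bX by exact: bm_obsX.
pose F o := (obsA o - condexp P obsA (obsX o)) * (obsY o - condexp P obsY (obsX o)).
pose Fb o := (clampA o - pX o) * (clampY o - bX o).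
have bFb : bm Fb by rewrite /Fb; bmt.
have mF : measurable_fun setT F.
  have [m1 _ _] := hA; have [m2 _ _] := hY.
  apply: measurable_funM; apply: measurable_funB.
  - exact: measurable_obsA.
  - by apply: (measurableT_comp m1); exact: measurable_obsX.
  - exact: measurable_obsY.
  - by apply: (measurableT_comp m2); exact: measurable_obsX.
have FE : {ae P, forall o, F o = Fb o}.
  apply: filterS2 (filterI cAE cYE) (filterI pA pY) => o [h1 h2] [h3 h4].
  by rewrite /F /Fb h3 h4 -h1 -h2.
have [_ _ hF] := condexpP mF bFb FE.
have := hF setT measurableT; rewrite preimage_setT => hFT.
transitivity (Ex P Fb).
  rewrite /psi /condcov /Rintegral -hFT /Ex /Rintegral; congr fine.
  apply: ae_eq_integral => //.
  - exact/measurable_EFinP.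
  - by apply/measurable_EFinP; exact: bm_measurable.
  - by apply: filterS FE => o /= -> _.
rewrite -[LHS]/(dot P (fun o => clampA o - pX o) (fun o => clampY o - bX o)).
rewrite dotBl; [|by []|by []|by bmt].
rewrite !dotBr// cond_A// dot_obsX// [dot P pX clampY]dotC cond_Y//.
by rewrite [dot unif (cl b) _]dotC subrr subr0.
Qed.

End model_facts.

(** * The estimators as bounded functions of the sample *)

Section uniform_continuity.
Context {R : realType} {d : nat}.
Local Notation vec := (vec R d).
Local Notation cube := (@unit_cube R d).
Variable h : vec -> R.
Hypothesis uc : unif_continuous_on_cube h.

(** On a grid of mesh smaller than the modulus of continuity, take in each cell the value of h at its lower corner. *)
Lemma unif_continuous_step (e : R) : 0 < e ->
  exists2 s : vec -> R, bm s & forall x, `|cl h x - s x| <= e.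
Proof.
move=> e0; have [r r0 hr] := uc e0.
pose N := (Num.truncn r^-1).+1.
have N0 : 0 < N%:R :> R by rewrite ltr0n.
have Nr : N%:R^-1 < r.
  by rewrite invf_plt ?posrE//; exact: truncnS_gt.
pose c (x : vec) (i : 'I_d) : R := N%:R * clamp 0 1 (tnth x i).
have c0 x i : 0 <= c x i.
  by rewrite mulr_ge0 ?(ltW N0)//; have /andP[] := @clamp_itv R 0 1 (tnth x i) ler01.
have cN x i : c x i <= N%:R.
  by rewrite -[leRHS]mulr1 ler_wpM2l ?(ltW N0)//; have /andP[] := @clamp_itv R 0 1 (tnth x i) ler01.
pose corner (g : {ffun 'I_d -> 'I_N.+1}) : vec := [tuple (g i)%:R / N%:R | i < d].
have corner_cube g : cube (corner g).
  move=> i; rewrite tnth_mktuple divr_ge0 ?(ltW N0)//= ler_pdivrMr// mul1r ler_nat.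
  by rewrite -ltnS ltn_ord.
pose cell (g : {ffun 'I_d -> 'I_N.+1}) x : R :=
  \prod_i \1_(`[(g i)%:R, (g i).+1%:R[%classic : set R) (c x i).
pose s x := \sum_g h (corner g) * cell g x.
exists s.
  apply: bm_sum => g; apply: bmM; first exact: bm_cst.
  apply: bm_prod => i.
  apply: (@bm_comp _ _ _ (measurableTypeR R) _ (fun x => c x i)
    (\1_(`[(g i)%:R, (g i).+1%:R[%classic : set (measurableTypeR R)))); last exact: bm_indic.
  apply: measurable_funM; first exact: measurable_cst.
  by apply: (measurableT_comp (@measurable_clamp R 0 1)); exact: measurable_tnth.
move=> x; have tN i : (Num.truncn (c x i) < N.+1)%N.
  by rewrite ltnS -(ler_nat R); have /andP[h1 _] := truncn_itv (c0 x i); exact: le_trans (cN x i).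
pose g0 : {ffun 'I_d -> 'I_N.+1} := [ffun i => Ordinal (tN i)].
rewrite /s (bigD1 g0)//= big1 ?addr0; last first.
  move=> g gg0; have [i gi] : exists i, g i != g0 i.
    by apply/existsP; rewrite -negb_forall; apply: contra gg0 => /forallP hg; apply/eqP/ffunP => i; apply/eqP.
  rewrite /cell (bigD1 i)//= indicE memNset ?mul0r ?mulr0//= in_itv/= => /truncn_def ht.
  by move/eqP: gi; apply; apply: val_inj; rewrite /= ffunE /= ht.
rewrite /cell big1 ?mulr1; last first.
  by move=> i _; rewrite indicE mem_set//= in_itv/= ffunE; exact: truncn_itv.
apply/ltW/hr; [exact: clampv_cube|exact: corner_cube|] => i.
rewrite !tnth_mktuple ffunE /=; apply: le_lt_trans Nr.
have /andP[h1 h2] := truncn_itv (c0 x i).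
have -> : clamp 0 1 (tnth x i) = c x i / N%:R by rewrite /c mulrC mulKf// gt_eqF.
have iN0 : 0 <= N%:R^-1 :> R by rewrite invr_ge0 ltW.
rewrite -mulrBl normrM [X in _ * X]ger0_norm// -[leRHS]mul1r ler_wpM2r//.
by rewrite -natr1 in h2; rewrite ger0_norm; lra.
Qed.

(** Nothing is assumed about the measurability of h; it follows since h is on the cube a uniform limit of step functions. *)
Lemma bm_cl_unif_continuous : bm (cl h).
Proof.
have st (n : nat) : exists s : vec -> R, bm s /\ forall x, `|cl h x - s x| <= n.+1%:R^-1.
  have [|s bs hs] := @unif_continuous_step n.+1%:R^-1; first by rewrite invr_gt0.
  by exists s.
have [s hs] := choice st.
split.
  apply: (@measurable_fun_cvg _ _ R setT s) => [n|x _].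
    by apply: bm_measurable; case: (hs n).
  apply/cvgrPdist_le => /= e e0; near=> n.
  apply: le_trans ((hs n).2 x) _.
  by apply: ltW; near: n; exact: near_infty_natSinv_lt (PosNum e0).
have [C C0 hC] := bm_bound (hs 0).1; exists (1 + C) => x.
rewrite -[cl h x](subrK (s 0 x)) (le_trans (ler_normD _ _))// lerD//.
by have := (hs 0).2 x; rewrite invr1.
Unshelve. all: by end_near. Qed.

End uniform_continuity.

Section mse_link.
Context {R : realType} {d S J0 : nat} {W : wavelet_system R d}.
Hypothesis W_cdv : cdv_basis S J0 W.
Local Notation vec := (vec R d).
Local Notation obs := (obs R d).
Local Notation unif := (unif R d).
Local Notation cube := (@unit_cube R d).
Local Notation obsX := (@obsX R d).
Local Notation obsA := (@obsA R d).
Local Notation obsY := (@obsY R d).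

(** The scaling functions, seen as functions of the observation. *)
Definition oPhi j (m : Zidx W j) (o : obs) : R := cPhi m (obsX o).

(** Only the almost sure value of an estimator matters for its mean squared error, so it may be replaced by a bounded version. *)
Lemma mseE (P : probability obs R) n (T T' : sample R d n -> R) :
  measurable_fun setT T -> bm T' ->
  {ae ((iid P n \x iid P n) \x iid P n)%E, forall D, T D = T' D} ->
  mse P T = (Ex ((iid P n \x iid P n) \x iid P n)%E (fun D => (T' D - psi P) ^+ 2))%:E.
Proof.
move=> mT bT' TT'; rewrite /mse unlock ExE; last exact: (bmX 2 (bmB bT' (bm_cst (psi P)))).
have bT'2 : bm (fun D => (T' D - psi P) ^+ 2) by exact: (bmX 2 (bmB bT' (bm_cst (psi P)))).
have mT2 : measurable_fun setT (fun D => (T D - psi P) ^+ 2).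
  by apply: measurable_funX; apply: measurable_funB => //; exact: measurable_cst.
apply: ae_eq_integral.
- exact: measurableT.
- exact/measurable_EFinP.
- by apply/measurable_EFinP; exact: bm_measurable.
- by apply: filterS TT' => D /= -> _.
Qed.

Lemma measurable_avg {d' : measure_display} {U : measurableType d'} n (D : U -> n.-tuple obs)
  (f : U * obs -> R) :
  measurable_fun setT D -> measurable_fun setT f ->
  measurable_fun setT (fun u => avg (D u) (fun o => f (u, o))).
Proof.
move=> mD mf; apply: measurable_funM; first exact: measurable_cst.
apply: measurable_sum => i; apply: (measurableT_comp mf).
apply: measurable_fun_pair => //.
exact: (measurableT_comp (measurable_tnth i) mD).
Qed.

Lemma measurable_D1 n : measurable_fun setT (@D1 R d n).
Proof. exact: (measurableT_comp measurable_fst measurable_fst). Qed.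
Lemma measurable_D2 n : measurable_fun setT (@D2 R d n).
Proof. exact: (measurableT_comp measurable_snd measurable_fst). Qed.
Lemma measurable_D3 n : measurable_fun setT (@D3 R d n).
Proof. exact: measurable_snd. Qed.

Lemma measurable_PhiX j (m : Zidx W j) : measurable_fun setT (fun o : obs => Phi m (obsX o)).
Proof.
exact: (measurableT_comp (Phi_measurable W_cdv m) (@measurable_obsX R d)).
Qed.

Lemma phat_sum n (D : n.-tuple obs) j x :
  phat W D j x = \sum_m avg D (fun o => obsA o * Phi m (obsX o)) * @Phi _ _ W j m x.
Proof.
rewrite /phat /avg /proj_kernel.
under [RHS]eq_bigr do rewrite -mulrA mulr_suml.
rewrite -mulr_sumr exchange_big; congr (_ * _); apply: eq_bigr => i _.
by rewrite mulr_sumr; apply: eq_bigr => m _; rewrite mulrA.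
Qed.

Lemma bhat_sum n (D : n.-tuple obs) j x :
  bhat W D j x = \sum_m avg D (fun o => obsY o * Phi m (obsX o)) * @Phi _ _ W j m x.
Proof.
rewrite /bhat /avg /proj_kernel.
under [RHS]eq_bigr do rewrite -mulrA mulr_suml.
rewrite -mulr_sumr exchange_big; congr (_ * _); apply: eq_bigr => i _.
by rewrite mulr_sumr; apply: eq_bigr => m _; rewrite mulrA.
Qed.

Lemma inner_hat n (D : n.-tuple obs) j1 j2 : (J0 <= j1)%N -> (J0 <= j2)%N ->
  inner (phat W D j1) (bhat W D j2) =
  \sum_(m : Zidx W j1) \sum_(m' : Zidx W j2) avg D (fun o => obsA o * Phi m (obsX o)) *
    avg D (fun o => obsY o * Phi m' (obsX o)) * dot unif (cPhi m) (cPhi m').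
Proof.
move=> J1 J2.
have b1 (m : Zidx W j1) : bm (cPhi m) by exact: bm_Phi W_cdv _ _ J1.
have b2 (m : Zidx W j2) : bm (cPhi m) by exact: bm_Phi W_cdv _ _ J2.
have e1 : cl (phat W D j1) = fun x => \sum_(m : Zidx W j1) avg D (fun o => obsA o * Phi m (obsX o)) * cPhi m x.
  by apply/funext => x; rewrite /cl phat_sum.
have e2 : cl (bhat W D j2) = fun x => \sum_(m : Zidx W j2) avg D (fun o => obsY o * Phi m (obsX o)) * cPhi m x.
  by apply/funext => x; rewrite /cl bhat_sum.
rewrite innerE ?e1 ?e2; [|exact: bm_lincomb|exact: bm_lincomb].
rewrite dot_suml//; last exact: bm_lincomb.
apply: eq_bigr => m _; rewrite dot_sumr// mulr_sumr; apply: eq_bigr => m' _.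
by rewrite mulrA.
Qed.

Let mA2 {d' : measure_display} {U : measurableType d'} : measurable_fun setT (fun z : U * obs => obsA z.2).
Proof. exact: (measurableT_comp (@measurable_obsA R d) measurable_snd). Qed.

Let mY2 {d' : measure_display} {U : measurableType d'} : measurable_fun setT (fun z : U * obs => obsY z.2).
Proof. exact: (measurableT_comp (@measurable_obsY R d) measurable_snd). Qed.

Let mX2 {d' : measure_display} {U : measurableType d'} : measurable_fun setT (fun z : U * obs => obsX z.2).
Proof. exact: (measurableT_comp (@measurable_obsX R d) measurable_snd). Qed.

Let mPhi2 {d' : measure_display} {U : measurableType d'} j (m : Zidx W j) :
  measurable_fun setT (fun z : U * obs => Phi m (obsX z.2)).
Proof. exact: (measurableT_comp (measurable_PhiX m) measurable_snd). Qed.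

Let mAPhi {d' : measure_display} {U : measurableType d'} n (D : U -> n.-tuple obs) j (m : Zidx W j) :
  measurable_fun setT D -> measurable_fun setT (fun u => avg (D u) (fun o => obsA o * Phi m (obsX o))).
Proof. by move=> mD; exact: (measurable_avg mD (measurable_funM mA2 (mPhi2 m))). Qed.

Let mYPhi {d' : measure_display} {U : measurableType d'} n (D : U -> n.-tuple obs) j (m : Zidx W j) :
  measurable_fun setT D -> measurable_fun setT (fun u => avg (D u) (fun o => obsY o * Phi m (obsX o))).
Proof. by move=> mD; exact: (measurable_avg mD (measurable_funM mY2 (mPhi2 m))). Qed.

Let mAY n : measurable_fun setT (fun D : sample R d n => avg (D2 D) (fun o => obsA o * obsY o)).
Proof. exact: (measurable_avg (@measurable_D2 n) (measurable_funM mA2 mY2)). Qed.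

Lemma measurable_psi_INT j1 j2 n : (J0 <= j1)%N -> (J0 <= j2)%N ->
  measurable_fun setT (@psi_INT R d W j1 j2 n).
Proof.
move=> J1 J2; apply: measurable_funB; first exact: mAY.
under eq_fun do rewrite inner_hat//.
apply: measurable_sum => m; apply: measurable_sum => m'.
apply: measurable_funM; last exact: measurable_cst.
by apply: measurable_funM; [apply: mAPhi|apply: mYPhi]; exact: measurable_D1.
Qed.

Lemma measurable_phatX {d' : measure_display} {U : measurableType d'} n (D : U -> n.-tuple obs)
  (X : U -> vec) j : measurable_fun setT D -> measurable_fun setT X ->
  measurable_fun setT (fun u => phat W (D u) j (X u)).
Proof.
move=> mD mX; under eq_fun do rewrite phat_sum.
apply: measurable_sum => m; apply: measurable_funM; first exact: mAPhi.
exact: (measurableT_comp (Phi_measurable W_cdv m) mX).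
Qed.

Lemma measurable_bhatX {d' : measure_display} {U : measurableType d'} n (D : U -> n.-tuple obs)
  (X : U -> vec) j : measurable_fun setT D -> measurable_fun setT X ->
  measurable_fun setT (fun u => bhat W (D u) j (X u)).
Proof.
move=> mD mX; under eq_fun do rewrite bhat_sum.
apply: measurable_sum => m; apply: measurable_funM; first exact: mYPhi.
exact: (measurableT_comp (Phi_measurable W_cdv m) mX).
Qed.

Let mD1z n : measurable_fun setT (fun z : sample R d n * obs => D1 z.1).
Proof. exact: (measurableT_comp (@measurable_D1 n) measurable_fst). Qed.

Lemma measurable_psi_MC j1 j2 n : measurable_fun setT (@psi_MC R d W j1 j2 n).
Proof.
apply: measurable_funB; first exact: mAY.
exact: (measurable_avg (@measurable_D3 n)
  (measurable_funM (measurable_phatX j1 (@mD1z n) mX2) (measurable_bhatX j2 (@mD1z n) mX2))).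
Qed.

Lemma measurable_psi_IF j1 j2 n : measurable_fun setT (@psi_IF R d W j1 j2 n).
Proof.
exact: (measurable_avg (@measurable_D2 n) (measurable_funM
  (measurable_funB mA2 (measurable_phatX j1 (@mD1z n) mX2))
  (measurable_funB mY2 (measurable_bhatX j2 (@mD1z n) mX2)))).
Qed.

Section fixed_law.
Variables (P : probability obs R) (C1 C2 : R).
Hypothesis PX : forall B, measurable B -> P (obsX @^-1` B) = unif B.
Hypothesis rangeAY : {ae P, forall o, C1 <= obsA o <= C2 /\ C1 <= obsY o <= C2}.
Local Notation A := (clampA C1 C2).
Local Notation Y := (clampY C1 C2).

(** The set of observations, of probability one, on which clamping changes nothing. *)
Definition good (o : obs) := cube (obsX o) /\ (C1 <= obsA o <= C2 /\ C1 <= obsY o <= C2).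

Lemma good_sample_ae n : {ae ((iid P n \x iid P n) \x iid P n)%E,
  forall D : sample R d n, forall i, good (tnth (D1 D) i) /\ good (tnth (D2 D) i) /\ good (tnth (D3 D) i)}.
Proof.
have mG : measurable [set o : obs | good o].
  rewrite (_ : [set o | good o] = obsX @^-1` cube `&` (obsA @^-1` `[C1, C2] `&` obsY @^-1` `[C1, C2])).
    apply: measurableI.
      rewrite -[X in measurable X]setTI; apply: measurable_obsX => //; exact: measurable_cube.
    apply: measurableI; rewrite -[X in measurable X]setTI.
      by apply: measurable_obsA.
    by apply: measurable_obsY.
  by apply/seteqP; split => o /=; rewrite /good !in_itv.
have PG : {ae P, forall o, [set o | good o] o}.
  by apply: filterS2 (ae_obsX PX (cube_ae (d := d))) rangeAY => o ? ?.
have h := ae_iid n mG PG.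
have h12 : {ae (iid P n \x iid P n)%E, forall z : n.-tuple obs * n.-tuple obs,
    (forall i, good (tnth z.1 i)) /\ (forall i, good (tnth z.2 i))}.
  exact: (filterI (ae_fst (iid P n) h) (ae_snd (iid P n) h)).
have h3 : {ae ((iid P n \x iid P n) \x iid P n)%E, forall D : sample R d n,
    forall i, good (tnth D.2 i)} by exact: (ae_snd (iid P n \x iid P n)%E h).
have h4 : {ae ((iid P n \x iid P n) \x iid P n)%E, forall D : sample R d n,
    (forall i, good (tnth D.1.1 i)) /\ (forall i, good (tnth D.1.2 i))}.
  exact: (ae_fst (iid P n) h12).
apply: filterS2 h4 h3 => D [g1 g2] g3 i.
by split; [exact: g1|split; [exact: g2|exact: g3]].
Qed.

Lemma goodA o : good o -> obsA o = A o.
Proof. by move=> [_ [h _]]; rewrite /clampA clamp_id. Qed.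
Lemma goodY o : good o -> obsY o = Y o.
Proof. by move=> [_ [_ h]]; rewrite /clampY clamp_id. Qed.
Lemma goodPhi j (m : Zidx W j) o : good o -> Phi m (obsX o) = oPhi m o.
Proof. by move=> [h _]; rewrite /oPhi /cPhi /cl clampv_id. Qed.

Lemma avg_good n (D : n.-tuple obs) (f g : obs -> R) : (forall i, good (tnth D i)) ->
  (forall o, good o -> f o = g o) -> avg D f = mean D g.
Proof. by move=> gD fg; congr (_ * _); apply: eq_bigr => i _; exact: fg. Qed.

Lemma phat_good n (D : n.-tuple obs) j o : (forall i, good (tnth D i)) -> good o ->
  phat W D j (obsX o) = emp_proj A (@oPhi j) D o.
Proof.
move=> gD go; rewrite phat_sum; apply: eq_bigr => m _.
rewrite goodPhi//; congr (_ * _); apply: avg_good => // o' go'.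
by rewrite goodA// goodPhi.
Qed.

Lemma bhat_good n (D : n.-tuple obs) j o : (forall i, good (tnth D i)) -> good o ->
  bhat W D j (obsX o) = emp_proj Y (@oPhi j) D o.
Proof.
move=> gD go; rewrite bhat_sum; apply: eq_bigr => m _.
rewrite goodPhi//; congr (_ * _); apply: avg_good => // o' go'.
by rewrite goodY// goodPhi.
Qed.

Variables (j1 j2 : nat).
Hypotheses (J1 : (J0 <= j1)%N) (J2 : (J0 <= j2)%N).

Lemma bm_oPhi j (m : Zidx W j) : (J0 <= j)%N -> bm (oPhi m).
Proof. by move=> J; apply: bm_obsX; exact: (bm_Phi W_cdv m J). Qed.

Lemma dot_oPhi j j' (m : Zidx W j) (m' : Zidx W j') : (J0 <= j)%N -> (J0 <= j')%N ->
  dot P (oPhi m) (oPhi m') = dot unif (cPhi m) (cPhi m').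
Proof.
by move=> J J'; apply: dot_obsX => //; [exact: (bm_Phi W_cdv m J)|exact: (bm_Phi W_cdv m' J')].
Qed.

Lemma INT_ae n : {ae ((iid P n \x iid P n) \x iid P n)%E, forall D : sample R d n,
  psi_INT W j1 j2 D = mean D.1.2 (fun o => A o * Y o) - cross P A Y (@oPhi j1) (@oPhi j2) D.1.1}.
Proof.
apply: filterS (good_sample_ae n) => D gD.
have g1 i := (gD i).1; have g2 i := (gD i).2.1.
rewrite /psi_INT; congr (_ - _).
  by apply: avg_good => // o go; rewrite goodA// goodY.
rewrite inner_hat//; apply: eq_bigr => m _; apply: eq_bigr => m' _.
rewrite dot_oPhi//; congr (_ * _ * _); apply: avg_good => // o go.
  by rewrite goodA// goodPhi.
by rewrite goodY// goodPhi.
Qed.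

Lemma MC_ae n : {ae ((iid P n \x iid P n) \x iid P n)%E, forall D : sample R d n,
  psi_MC W j1 j2 D = mean D.1.2 (fun o => A o * Y o) -
    mean D.2 (fun o => emp_proj A (@oPhi j1) D.1.1 o * emp_proj Y (@oPhi j2) D.1.1 o)}.
Proof.
apply: filterS (good_sample_ae n) => D gD.
have g1 i := (gD i).1; have g2 i := (gD i).2.1; have g3 i := (gD i).2.2.
rewrite /psi_MC; congr (_ - _).
  by apply: avg_good => // o go; rewrite goodA// goodY.
by apply: avg_good => // o go; rewrite phat_good// bhat_good.
Qed.

Lemma IF_ae n : {ae ((iid P n \x iid P n) \x iid P n)%E, forall D : sample R d n,
  psi_IF W j1 j2 D = mean D.1.2 (fun o => (A o - emp_proj A (@oPhi j1) D.1.1 o) *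
     (Y o - emp_proj Y (@oPhi j2) D.1.1 o))}.
Proof.
apply: filterS (good_sample_ae n) => D gD.
have g1 i := (gD i).1; have g2 i := (gD i).2.1.
by apply: avg_good => // o go; rewrite phat_good// bhat_good// goodA// goodY.
Qed.

End fixed_law.
End mse_link.

(** * Uniform upper bounds on the risk *)

Section upper_bounds.
Context {R : realType} {d S J0 : nat} {W : wavelet_system R d}.
Hypothesis W_cdv : cdv_basis S J0 W.
Local Notation vec := (vec R d).
Local Notation obs := (obs R d).
Local Notation unif := (unif R d).
Local Notation obsX := (@obsX R d).
Local Notation scale := (@scale R d).

(** The rate 2^(-2sj) = k^(-2s/d) of the squared bias at the resolution k = 2^(jd). *)
Definition decay (s : R) (j : nat) : R := (2 `^ (- (2 * s))) ^+ j.

Lemma decayD s t j : decay s j * decay t j = decay (s + t) j.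
Proof.
rewrite /decay -exprMn -powRD; last by rewrite pnatr_eq0 implybT.
by congr (_ `^ _ ^+ _); rewrite mulrDr opprD.
Qed.

Lemma decay_ge0 s j : 0 <= decay s j. Proof. by rewrite exprn_ge0// powR_ge0. Qed.

Lemma holder_coef_bound (alpha M : R) (h : vec -> R) : bm (cl h) ->
  (holder_norm J0 W alpha h <= M%:E)%E -> @coef_bound R d J0 W alpha M (cl h).
Proof.
move=> bh hM l [e m] Jl.
rewrite -[dot _ _ _]/(dot unif (cl h) (cl (Psi e m))) -innerE//; last exact: (bm_Psi W_cdv e m Jl).
rewrite -lee_fin; apply: le_trans hM.
rewrite /holder_norm -[leLHS]add0e; apply: leeD.
  rewrite lee_fin mulr_ge0 ?powR_ge0//.
  by elim/big_ind : _ => // x y x0 y0; rewrite le_max x0.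
by apply: ereal_sup_ubound; exists l, m, e.
Qed.

Section core.
Variables (P : probability obs R).
Hypothesis PX : forall B, measurable B -> P (obsX @^-1` B) = unif B.
Variables (Z1 Z2 : obs -> R) (g1 g2 : vec -> R) (Bd : R).
Hypotheses (bZ1 : bm Z1) (bZ2 : bm Z2) (bg1 : bm g1) (bg2 : bm g2) (Bd1 : 1 <= Bd).
Hypotheses (Z1B : forall o, `|Z1 o| <= Bd) (Z2B : forall o, `|Z2 o| <= Bd).
Hypotheses (c1E : forall f, bm f -> dot P Z1 (fun o => f (obsX o)) = dot unif g1 f)
  (c2E : forall f, bm f -> dot P Z2 (fun o => f (obsX o)) = dot unif g2 f).
Hypotheses (g1B : dot unif g1 g1 <= Bd ^+ 2) (g2B : dot unif g2 g2 <= Bd ^+ 2).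
Variables (s1 s2 T1 T2 : R).
Hypotheses (T10 : 0 <= T1) (T20 : 0 <= T2).
Hypotheses (tail1 : forall j, (J0 <= j)%N -> dot unif g1 g1 - @energy R d W g1 j <= T1 * decay s1 j)
  (tail2 : forall j, (J0 <= j)%N -> dot unif g2 g2 - @energy R d W g2 j <= T2 * decay s2 j).
Variables (j j' : nat).
Hypotheses (Jj : (J0 <= j)%N) (jj' : (j <= j')%N).
Variable c : R.
Hypothesis c1 : 1 <= c.
Hypotheses (Kle : forall i, (J0 <= i)%N -> forall x y : vec,
    `|\sum_(m : Zidx W i) cPhi m x * cPhi m y| <= c * scale i)
  (KL1 : forall i, (J0 <= i)%N -> forall y : vec,
    Ex unif (fun x => `|\sum_(m : Zidx W i) cPhi m x * cPhi m y|) <= c).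
Let Jj' : (J0 <= j')%N. Proof. exact: leq_trans jj'. Qed.

Let p o := g1 (obsX o).
Let b o := g2 (obsX o).
Let bp : bm p. Proof. exact: bm_obsX. Qed.
Let bb : bm b. Proof. exact: bm_obsX. Qed.
Let pB : dot P p p <= Bd ^+ 2. Proof. by rewrite dot_obsX. Qed.
Let bB : dot P b b <= Bd ^+ 2. Proof. by rewrite dot_obsX. Qed.
Let bphi i : (J0 <= i)%N -> forall m : Zidx W i, bm (oPhi m).
Proof. by move=> Ji m; exact: (bm_oPhi W_cdv m Ji). Qed.
Let bcphi i : (J0 <= i)%N -> forall m : Zidx W i, bm (cPhi m).
Proof. by move=> Ji m; exact: (bm_Phi W_cdv m Ji). Qed.

Let on i : (J0 <= i)%N -> onfamily P (@oPhi R d W i).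
Proof. by move=> Ji m m'; rewrite (dot_oPhi W_cdv PX)//; exact: (orthonormal_Phi W_cdv Ji). Qed.

Let nested (m : Zidx W j) : {ae P, forall o, oPhi m o = \sum_m' dot P (oPhi m) (@oPhi R d W j' m') * oPhi m' o}.
Proof.
apply: filterS (ae_obsX PX (Phi_nested_le W_cdv m Jj jj')) => o h.
rewrite [LHS]h; apply: eq_bigr => m' _; by rewrite (dot_oPhi W_cdv PX).
Qed.

Let pull1 i (m : Zidx W i) : (J0 <= i)%N -> dot P Z1 (oPhi m) = dot P p (oPhi m).
Proof. by move=> Ji; rewrite c1E ?dot_obsX//; exact: bcphi. Qed.
Let pull2 i (m : Zidx W i) : (J0 <= i)%N -> dot P Z2 (oPhi m) = dot P b (oPhi m).
Proof. by move=> Ji; rewrite c2E ?dot_obsX//; exact: bcphi. Qed.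

Let KPle i : (J0 <= i)%N -> forall x y : obs, `|\sum_(m : Zidx W i) oPhi m x * oPhi m y| <= c * scale i.
Proof. by move=> Ji x y; exact: Kle. Qed.

Let KPL1 i : (J0 <= i)%N -> forall y : obs,
  Ex P (fun x => `|\sum_(m : Zidx W i) oPhi m x * oPhi m y|) <= c.
Proof.
move=> Ji y; have bc := bcphi Ji.
by rewrite (Ex_obsX PX (f := fun x => `|\sum_(m : Zidx W i) cPhi m x * oPhi m y|)) ?KL1//; bmt.
Qed.

Let delta_le i : (J0 <= i)%N ->
  (dot P p b - \sum_(m : Zidx W i) dot P p (oPhi m) * dot P b (oPhi m)) ^+ 2 <=
  T1 * T2 * decay (s1 + s2) i.
Proof.
move=> Ji; have bc := bcphi Ji; have onc := orthonormal_Phi W_cdv Ji.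
rewrite dot_obsX// (eq_bigr (fun m => dot unif g1 (@cPhi R d W i m) * dot unif g2 (cPhi m))); last first.
  by move=> m _; rewrite !dot_obsX.
rewrite -(dot_residual bc onc bg1 bg2).
have b1 := bm_l2proj unif bc g1; have b2 := bm_l2proj unif bc g2.
apply: (le_trans (dot_CS unif (bmB bg1 b1) (bmB bg2 b2))).
rewrite -decayD (_ : T1 * T2 * _ = (T1 * decay s1 i) * (T2 * decay s2 i)); last by ring.
apply: ler_pM; rewrite ?dotff_ge0//.
  rewrite (dot_residual bc onc bg1 bg1); apply: le_trans (tail1 Ji).
  by rewrite lerD2l lerN2 /energy; apply: ler_sum => m _; rewrite expr2.
rewrite (dot_residual bc onc bg2 bg2); apply: le_trans (tail2 Ji).
by rewrite lerD2l lerN2 /energy; apply: ler_sum => m _; rewrite expr2.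
Qed.

Variable n : nat.
Hypothesis n0 : (0 < n)%N.
Let Q := ((iid P n \x iid P n) \x iid P n)%E.
Let tau := Ex P (fun o => Z1 o * Z2 o) - dot unif g1 g2.
Let T := T1 * T2 + 1.
Let rate i := n%:R^-1 * (1 + scale j' / n%:R) + scale j ^+ 2 / n%:R ^+ 2 + decay (s1 + s2) i.

Let T_le i : (J0 <= i)%N -> (dot P p b - \sum_(m : Zidx W i) dot P p (oPhi m) * dot P b (oPhi m)) ^+ 2 <=
  T * decay (s1 + s2) i.
Proof.
move=> Ji; apply: (le_trans (delta_le Ji)).
by rewrite ler_wpM2r ?decay_ge0// lerDl.
Qed.

Let T1' : 1 <= T. Proof. by rewrite lerDr mulr_ge0. Qed.

Let absorb (x y z K : R) i : (J0 <= i)%N -> 0 <= K -> 0 <= x -> 0 <= y -> z <= T * decay (s1 + s2) i ->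
  K * (x + y + z) <= K * T * (x + y + decay (s1 + s2) i).
Proof.
move=> Ji K0 x0 y0 zT; rewrite -mulrA ler_wpM2l// !mulrDr lerD// lerD//.
  by rewrite ler_peMl.
by rewrite ler_peMl.
Qed.

Let rn0 : 0 <= n%:R^-1 :> R. Proof. by rewrite invr_ge0. Qed.
Let rk0 : 0 <= scale j ^+ 2 / n%:R ^+ 2 :> R.
Proof. by rewrite mulr_ge0 ?sqr_ge0// invr_ge0 sqr_ge0. Qed.
Let Bd0 : 0 <= Bd. Proof. exact: le_trans Bd1. Qed.
Let c0 : 0 <= c. Proof. exact: le_trans c1. Qed.
Let s0 i : 0 <= scale i. Proof. by rewrite ltW// scale_gt0. Qed.

Let K0 (a : R) i : 0 <= a -> 0 <= a * (Bd ^+ 4 * c ^+ i).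
Proof. by move=> a0; apply: mulr_ge0 => //; apply: mulr_ge0; apply: exprn_ge0. Qed.
Let r0 : 0 <= n%:R^-1 * (1 + scale j' / n%:R) :> R.
Proof. by apply: mulr_ge0 => //; apply: addr_ge0 => //; apply: divr_ge0. Qed.

(** Specialization of the abstract bound to scaling functions of two levels j <= j'. The two factors are kept symmetric, since either of them may be the one with the coarser resolution. *)
Lemma INT_risk_ordered : Ex Q (fun D => (mean D.1.2 (fun o => Z1 o * Z2 o) -
    cross P Z1 Z2 (@oPhi R d W j) (@oPhi R d W j') D.1.1 - tau) ^+ 2) <=
  402 * (Bd ^+ 4 * c ^+ 2) * T * (n%:R^-1 + scale j ^+ 2 / n%:R ^+ 2 + decay (s1 + s2) j).
Proof.
have := INT_risk bZ1 bZ2 bp bb Bd1 Z1B Z2B pB bB (bphi Jj) (bphi Jj') (on Jj) (on Jj')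
  nested (fun m => pull1 m Jj) (fun m => pull2 m Jj') c1 (KPle Jj) n0.
rewrite {1}dot_obsX// => h; apply: (le_trans h).
exact: (absorb Jj (K0 2 (ler0n _ 402)) rn0 rk0 (T_le Jj)).
Qed.

Hypothesis kn : scale j <= c * n%:R.

Let diag (y : obs) : \sum_(m : Zidx W j') oPhi m y * oPhi m y <= c * scale j'.
Proof. by apply: le_trans (ler_norm _) (KPle Jj' y y). Qed.

Lemma MC_risk_ordered : Ex Q (fun D => (mean D.1.2 (fun o => Z1 o * Z2 o) -
    mean D.2 (fun o => emp_proj Z1 (@oPhi R d W j) D.1.1 o * emp_proj Z2 (@oPhi R d W j') D.1.1 o) - tau) ^+ 2) <=
  700 * (Bd ^+ 4 * c ^+ 6) * T * rate j.
Proof.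
have := MC_risk bZ1 bZ2 bp bb Bd1 Z1B Z2B pB bB (bphi Jj) (bphi Jj') (on Jj) (on Jj')
  nested (fun m => pull1 m Jj) (fun m => pull2 m Jj') c1 (s0 j) (s0 j') (KPle Jj) (KPL1 Jj)
  diag (KPL1 Jj') n0 kn.
rewrite {1}dot_obsX// => h; apply: (le_trans h).
exact: (absorb Jj (K0 6 (ler0n _ 700)) r0 rk0 (T_le Jj)).
Qed.

Lemma IF_risk_ordered : Ex Q (fun D => (mean D.1.2 (fun o => (Z1 o - emp_proj Z1 (@oPhi R d W j) D.1.1 o) *
     (Z2 o - emp_proj Z2 (@oPhi R d W j') D.1.1 o)) - tau) ^+ 2) <=
  700 * (Bd ^+ 4 * c ^+ 6) * T * rate j'.
Proof.
have := IF_risk bZ1 bZ2 bp bb Bd1 Z1B Z2B pB (bphi Jj) (bphi Jj') (on Jj) (on Jj')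
  nested (fun m => pull1 m Jj) (fun m => pull1 m Jj') (fun m => pull2 m Jj) (fun m => pull2 m Jj')
  c1 (s0 j) (s0 j') (KPle Jj) (KPL1 Jj) diag (KPL1 Jj') n0 kn.
rewrite {1}dot_obsX// => h; apply: (le_trans h).
exact: (absorb Jj' (K0 6 (ler0n _ 700)) r0 rk0 (T_le Jj')).
Qed.

End core.

Lemma crossC (P : probability obs R) (Z1 Z2 : obs -> R) (I J : finType) (f : I -> obs -> R)
  (g : J -> obs -> R) n (D : n.-tuple obs) : cross P Z1 Z2 f g D = cross P Z2 Z1 g f D.
Proof.
rewrite /cross exchange_big; apply: eq_bigr => j _; apply: eq_bigr => i _ /=.
by rewrite [mean D _ * mean D _]mulrC dotC.
Qed.

Lemma wavelet_kernel_const : exists2 c : R, 1 <= c & forall i, (J0 <= i)%N ->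
  (forall x y : vec, `|\sum_(m : Zidx W i) cPhi m x * cPhi m y| <= c * scale i) /\
  (forall y : vec, Ex unif (fun x => `|\sum_(m : Zidx W i) cPhi m x * cPhi m y|) <= c).
Proof.
have [C C1 hC] := localization_const W_cdv.
have C0 : 0 <= C by exact: le_trans C1.
have e1 : 1 <= C ^+ 3 by exact: exprn_ege1.
have e2 : 1 <= (2 * C) ^+ d by apply: exprn_ege1; lra.
exists (C ^+ 3 * (2 * C) ^+ d); first exact: mulr_ege1.
move=> i Ji; have [loc _] := hC i Ji; split.
  move=> x y; apply: (le_trans (localized_kernel_le loc C0 x y)).
  by rewrite ler_wpM2r ?(ltW (scale_gt0 _))// ler_peMr// (le_trans _ e1).
by move=> y; exact: (localized_kernel_L1 (@Phi_measurable _ _ _ _ _ W_cdv i) loc C0 y).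
Qed.

Section uniform_risk.
Variables (alpha beta M C1 C2 C0 : R).
Hypotheses (alpha0 : 0 < alpha) (beta0 : 0 < beta) (M0 : 0 <= M) (C00 : 0 <= C0).
Local Notation Model := (model J0 W alpha beta M C1 C2).

Let rate (n j1 j2 i : nat) : R := n%:R^-1 * (1 + scale (maxn j1 j2) / n%:R) +
  scale (minn j1 j2) ^+ 2 / n%:R ^+ 2 + decay (alpha + beta) i.

(** The constant depends on the wavelet basis, on the model and on the ratio C0 of the coarse resolution to n, but not on the law, on n or on the levels. *)
Lemma uniform_mse_le : exists2 K : R, 0 < K & forall P, Model P -> forall n j1 j2,
  (0 < n)%N -> (J0 <= j1)%N -> (J0 <= j2)%N ->
  [/\ (mse P (@psi_INT R d W j1 j2 n) <= (K * (n%:R^-1 + scale (minn j1 j2) ^+ 2 / n%:R ^+ 2 +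
         decay (alpha + beta) (minn j1 j2)))%:E)%E,
      scale (minn j1 j2) <= C0 * n%:R ->
        (mse P (@psi_MC R d W j1 j2 n) <= (K * rate n j1 j2 (minn j1 j2))%:E)%E
    & scale (minn j1 j2) <= C0 * n%:R ->
        (mse P (@psi_IF R d W j1 j2 n) <= (K * rate n j1 j2 (maxn j1 j2))%:E)%E].
Proof.
have [c c1 hc] := wavelet_kernel_const.
have [T1 T10 tail1] := tail_le W_cdv alpha0 M0.
have [T2 T20 tail2] := tail_le W_cdv beta0 M0.
pose B := `|C1| + `|C2| + 1.
have B1 : 1 <= B by rewrite lerDr addr_ge0.
have B0 : 0 <= B by exact: le_trans B1.
(* The abstract bounds use one constant for the kernels and for the ratio of k to n. *)
pose c' := c + C0.
have c'1 : 1 <= c' by rewrite (le_trans c1)// lerDl.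
have cc' : c <= c' by rewrite lerDl.
pose T := T1 * T2 + 1.
have T0 : 0 < T by rewrite ltr_wpDl// mulr_ge0// ltW.
have Bc0 i : 0 < B ^+ 4 * c' ^+ i.
  by rewrite mulr_gt0// exprn_gt0// (lt_le_trans ltr01).
have h700 : 0 < 700 :> R by rewrite ltr0n.
exists (700 * (B ^+ 4 * c' ^+ 6) * T); first exact: (mulr_gt0 (mulr_gt0 h700 (Bc0 6)) T0).
move=> P [PX rangeAY [p [ucp hp] Ap] [b [ucb hb] Yb]] n j1 j2 n0 J1 J2.
have bp := bm_cl_unif_continuous ucp; have bb := bm_cl_unif_continuous ucb.
have tp j (Jj : (J0 <= j)%N) := tail1 _ j bp (holder_coef_bound bp hp) Jj.
have tb j (Jj : (J0 <= j)%N) := tail2 _ j bb (holder_coef_bound bb hb) Jj.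
have bA := @bm_clampA R d C1 C2; have bY := @bm_clampY R d C1 C2.
have cE1 f (bf : bm f) := cond_A PX rangeAY bp Ap bf.
have cE2 f (bf : bm f) := cond_Y PX rangeAY bb Yb bf.
have AB (o : obs) : `|clampA C1 C2 o| <= B by exact: clamp_le.
have YB (o : obs) : `|clampY C1 C2 o| <= B by exact: clamp_le.
have g1B := regression_L2 PX bA bp AB cE1.
have g2B := regression_L2 PX bY bb YB cE2.
have Kle i (Ji : (J0 <= i)%N) x y : `|\sum_(m : Zidx W i) cPhi m x * cPhi m y| <= c' * scale i.
  by apply: (le_trans ((hc i Ji).1 x y)); rewrite ler_wpM2r// ltW// scale_gt0.
have KL1 i (Ji : (J0 <= i)%N) y : Ex unif (fun x => `|\sum_(m : Zidx W i) cPhi m x * cPhi m y|) <= c'.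
  exact: le_trans ((hc i Ji).2 y) cc'.
have psE := psiE PX rangeAY bp bb Ap Yb.
have Cc : C0 * n%:R <= c' * n%:R by rewrite ler_wpM2r// lerDr (le_trans _ c1).
have bo i (Ji : (J0 <= i)%N) (m : Zidx W i) : bm (oPhi m) := bm_oPhi W_cdv m Ji.
have bmA : forall i (Ji : (J0 <= i)%N) (m : Zidx W i), bm (fun D : n.-tuple obs => mean D (fun x => clampA C1 C2 x * oPhi m x)).
  by move=> i Ji m; exact: (bm_mean n (bmM bA (bo i Ji m))).
have bmY : forall i (Ji : (J0 <= i)%N) (m : Zidx W i), bm (fun D : n.-tuple obs => mean D (fun x => clampY C1 C2 x * oPhi m x)).
  by move=> i Ji m; exact: (bm_mean n (bmM bY (bo i Ji m))).
have bAY := bm_mean n (bmM bA bY).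
have eINT := mseE (measurable_psi_INT W_cdv J1 J2) (bmB (bm_second bAY)
  (bm_first (bm_cross P bA bY (bo j1 J1) (bo j2 J2) n))) (INT_ae W_cdv PX rangeAY J1 J2 n).
have bhatA j (Jj : (J0 <= j)%N) : bm (fun z : n.-tuple obs * obs => emp_proj (clampA C1 C2) (@oPhi R d W j) z.1 z.2).
  by apply: bm_sum => m; apply: bmM; [exact: (bm_fst (bmA j Jj m))|exact: (bm_snd (bo j Jj m))].
have bhatY j (Jj : (J0 <= j)%N) : bm (fun z : n.-tuple obs * obs => emp_proj (clampY C1 C2) (@oPhi R d W j) z.1 z.2).
  by apply: bm_sum => m; apply: bmM; [exact: (bm_fst (bmY j Jj m))|exact: (bm_snd (bo j Jj m))].
have m13 : measurable_fun setT (fun D : n.-tuple obs * n.-tuple obs * n.-tuple obs => (D.1.1, D.2)).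
  apply: measurable_fun_pair; last exact: measurable_snd.
  exact: (measurableT_comp measurable_fst measurable_fst).
have eMC := mseE (measurable_psi_MC W_cdv j1 j2 (n:=n)) (bmB (bm_second bAY)
  (bm_comp m13 (bm_mean_pair (bmM (bhatA j1 J1) (bhatY j2 J2)) n))) (MC_ae PX rangeAY j1 j2 n).
have bA2 : bm (fun z : n.-tuple obs * obs => clampA C1 C2 z.2) := bm_snd bA.
have bY2 : bm (fun z : n.-tuple obs * obs => clampY C1 C2 z.2) := bm_snd bY.
have eIF := mseE (measurable_psi_IF W_cdv j1 j2 (n:=n))
  (bm_fst (bm_mean_pair (bmM (bmB bA2 (bhatA j1 J1)) (bmB bY2 (bhatY j2 J2))) n))
  (IF_ae PX rangeAY j1 j2 n).
rewrite eINT eMC eIF psE !lee_fin.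
have T1g := ltW T10; have T2g := ltW T20.
have K402 x : 0 <= x -> 402 * (B ^+ 4 * c' ^+ 2) * T * x <= 700 * (B ^+ 4 * c' ^+ 6) * T * x.
  move=> x0; apply: (ler_wpM2r x0); apply: (ler_wpM2r (ltW T0)).
  apply: ler_pM; [by rewrite ler0n|exact: (ltW (Bc0 2))|by rewrite ler_nat|].
  apply: ler_wpM2l; [exact: exprn_ge0|by rewrite ler_weXn2l].
have r0 i : 0 <= n%:R^-1 + scale i ^+ 2 / n%:R ^+ 2 + decay (alpha + beta) i.
  by apply: addr_ge0; [apply: addr_ge0; [rewrite invr_ge0|apply: divr_ge0; apply: sqr_ge0]|exact: decay_ge0].
rewrite /rate; case: (leqP j1 j2) => j12.
  split.
  - apply: le_trans (K402 _ (r0 j1)).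
    exact: (INT_risk_ordered PX bA bY bp bb B1 AB YB cE1 cE2 g1B g2B T1g T2g tp tb J1 j12 c'1 Kle n0).
  - move=> kn; have kn' := le_trans kn Cc.
    exact: (MC_risk_ordered PX bA bY bp bb B1 AB YB cE1 cE2 g1B g2B T1g T2g tp tb J1 j12 c'1 Kle KL1 n0 kn').
  - move=> kn; have kn' := le_trans kn Cc.
    exact: (IF_risk_ordered PX bA bY bp bb B1 AB YB cE1 cE2 g1B T1g T2g tp tb J1 j12 c'1 Kle KL1 n0 kn').
(* The bounds are symmetric in (A, p) and (Y, b): the other order of the resolutions follows by exchanging them. *)
have j21 := ltnW j12.
have eAY : (fun o : obs => clampA C1 C2 o * clampY C1 C2 o) = (fun o => clampY C1 C2 o * clampA C1 C2 o).
  by apply/funext => o; rewrite mulrC.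
have eT : T = T2 * T1 + 1 by rewrite /T mulrC.
rewrite eAY dotC [alpha + beta]addrC eT; split.
- rewrite -eT [beta + alpha]addrC; apply: le_trans (K402 _ (r0 j2)); rewrite eT [alpha + beta]addrC.
  under eq_fun do rewrite crossC.
  exact: (INT_risk_ordered PX bY bA bb bp B1 YB AB cE2 cE1 g2B g1B T2g T1g tb tp J2 j21 c'1 Kle n0).
- move=> kn; have kn' := le_trans kn Cc.
  have eF D : (fun o => emp_proj (clampA C1 C2) (@oPhi R d W j1) D o * emp_proj (clampY C1 C2) (@oPhi R d W j2) D o) =
     (fun o => emp_proj (clampY C1 C2) (@oPhi R d W j2) D o * emp_proj (n:=n) (clampA C1 C2) (@oPhi R d W j1) D o).
    by apply/funext => o; rewrite mulrC.
  under eq_fun do rewrite eF.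
  exact: (MC_risk_ordered PX bY bA bb bp B1 YB AB cE2 cE1 g2B g1B T2g T1g tb tp J2 j21 c'1 Kle KL1 n0 kn').
- move=> kn; have kn' := le_trans kn Cc.
  have eF D : (fun o => (clampA C1 C2 o - emp_proj (clampA C1 C2) (@oPhi R d W j1) D o) * (clampY C1 C2 o - emp_proj (clampY C1 C2) (@oPhi R d W j2) D o)) =
     (fun o => (clampY C1 C2 o - emp_proj (clampY C1 C2) (@oPhi R d W j2) D o) * (clampA C1 C2 o - emp_proj (n:=n) (clampA C1 C2) (@oPhi R d W j1) D o)).
    by apply/funext => o; rewrite mulrC.
  under eq_fun do rewrite eF.
  exact: (IF_risk_ordered PX bY bA bb bp B1 YB AB cE2 cE1 g2B T2g T1g tb tp J2 j21 c'1 Kle KL1 n0 kn').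
Qed.

End uniform_risk.
End upper_bounds.

(** * Rates for given resolutions *)

Section growth.
Context {R : realType}.
Implicit Types (x y e : R).

Lemma lesssimP (f g : nat -> R) : lesssim (EFin \o f) (EFin \o g) <->
  exists (C : R) (n0 : nat), 0 < C /\ forall n, (n0 <= n)%N -> f n <= C * g n.
Proof.
by split=> -[C [n0 [C0 h]]]; exists C, n0; split=> // n /h; rewrite /= -EFinM lee_fin.
Qed.

Lemma lesssim_trans (u v w : nat -> \bar R) : lesssim u v -> lesssim v w -> lesssim u w.
Proof.
move=> [C [n0 [C0 h]]] [C' [n1 [C'0 h']]]; exists (C * C'), (maxn n0 n1); split; first exact: mulr_gt0.
move=> n; rewrite geq_max => /andP[/h hn /h' h'n]; apply: (le_trans hn).
by rewrite EFinM -muleA lee_pmul2l ?fin_numE// lte_fin.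
Qed.

Lemma nsqrtE : @nsqrt R = npow (1 / 2).
Proof. by apply/funext => n; rewrite /nsqrt /npow -powR12_sqrt// mul1r. Qed.

Lemma powR_anti x y e : 0 < x -> x <= y -> 0 <= e -> y `^ (- e) <= x `^ (- e).
Proof.
move=> x0 xy e0; have y0 := lt_le_trans x0 xy.
by rewrite !powRN lef_pV2 ?posrE ?powR_gt0// ge0_ler_powR ?nnegrE// ltW.
Qed.

Context {d J0 : nat} {W : wavelet_system R d}.
Hypothesis d_gt0 : (0 < d)%N.
Local Notation scale := (@scale R d).

Lemma scale_powR (j : nat) : scale j = 2 `^ (j%:R * d%:R) :> R.
Proof. by rewrite /scale -natrM powR_mulrn. Qed.

Lemma decay_scale s j : decay s j = scale j `^ (- (2 * s / d%:R)) :> R.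
Proof.
have d0 : d%:R != 0 :> R by rewrite pnatr_eq0 -lt0n.
rewrite /decay scale_powR -powRrM -powR_mulrn ?powR_ge0// -powRrM; congr (_ `^ _).
by field.
Qed.

Lemma kminE (j1 j2 : nat -> nat) : @kmin R d j1 j2 = EFin \o (fun n => scale (minn (j1 n) (j2 n)) : R).
Proof.
apply/funext => n; rewrite /kmin /scale /= -natrX; congr (_%:R%:E).
case: (leqP (j1 n) (j2 n)) => h; first by apply/minn_idPl; rewrite leq_exp2l// leq_mul2r h orbT.
by apply/minn_idPr; rewrite leq_exp2l// leq_mul2r (ltnW h) orbT.
Qed.

Lemma kmaxE (j1 j2 : nat -> nat) : @kmax R d j1 j2 = EFin \o (fun n => scale (maxn (j1 n) (j2 n)) : R).
Proof.
apply/funext => n; rewrite /kmax /scale /= -natrX; congr (_%:R%:E).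
case: (leqP (j1 n) (j2 n)) => h; first by apply/maxn_idPr; rewrite leq_exp2l// leq_mul2r h orbT.
by apply/maxn_idPl; rewrite leq_exp2l// leq_mul2r (ltnW h) orbT.
Qed.

Section terms.
Variables (n : nat) (rho C : R).
Hypotheses (n0 : (0 < n)%N) (C0 : 0 < C).
Let N : R := n%:R.
Let N1 : 1 <= N. Proof. by rewrite ler1n. Qed.
Let N0 : 0 < N. Proof. by rewrite ltr0n. Qed.
Let NM a b : N `^ a * N `^ b = N `^ (a + b).
Proof. by rewrite powRD// (gt_eqF N0) implybT. Qed.

Lemma parametric_term : rho <= 1 -> n%:R^-1 <= N `^ (- rho).
Proof. by move=> h; rewrite -powR_inv1 ?(ltW N0)//; apply: ler_powR => //; lra. Qed.

(** Each of the next lemmas turns one term of the risk bound, for a resolution between two powers of n, into a power of n. *)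
Lemma square_term (k b : R) : 0 <= k -> k <= C * N `^ b -> rho <= 2 - 2 * b ->
  k ^+ 2 / N ^+ 2 <= C ^+ 2 * N `^ (- rho).
Proof.
move=> k0 kb h.
have -> : N ^+ 2 = N `^ 2 by rewrite -powR_mulrn// ltW.
rewrite -powRN; apply: (@le_trans _ _ ((C * N `^ b) ^+ 2 * N `^ (- 2))).
  by rewrite ler_wpM2r ?powR_ge0// ler_sqr ?nnegrE ?mulr_ge0 ?powR_ge0// ltW.
rewrite exprMn -mulrA ler_wpM2l ?sqr_ge0// expr2 !NM.
by apply: ler_powR => //; lra.
Qed.

Lemma linear_term (k e : R) : k <= C * N `^ e -> rho <= 2 - e ->
  N^-1 * (k / N) <= C * N `^ (- rho).
Proof.
move=> ke h; rewrite mulrA mulrC mulrA -invfM -expr2.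
have -> : N ^+ 2 = N `^ 2 by rewrite -powR_mulrn// ltW.
rewrite -powRN mulrC; apply: (@le_trans _ _ (C * N `^ e * N `^ (- 2))).
  by rewrite ler_wpM2r ?powR_ge0.
by rewrite -mulrA ler_wpM2l ?(ltW C0)// NM; apply: ler_powR => //; lra.
Qed.

Lemma bias_term s i (a : R) : 0 < s -> N `^ a <= C * scale i -> rho <= 2 * s * a / d%:R ->
  decay s i <= C `^ (2 * s / d%:R) * N `^ (- rho).
Proof.
move=> s0 ai h.
have d0 : 0 < d%:R :> R by rewrite ltr0n.
have e0 : 0 <= 2 * s / d%:R by rewrite divr_ge0// ltW// mulr_gt0.
rewrite decay_scale; apply: (@le_trans _ _ ((C^-1 * N `^ a) `^ (- (2 * s / d%:R)))).
  apply: powR_anti e0; first by rewrite mulr_gt0 ?invr_gt0 ?powR_gt0.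
  by rewrite mulrC ler_pdivrMr// mulrC.
rewrite powRM ?powR_ge0 ?invr_ge0 ?(ltW C0)// -powR_inv1 ?(ltW C0)// -!powRrM mulN1r opprK.
rewrite ler_wpM2l ?powR_ge0//; apply: ler_powR => //.
by rewrite mulrN lerN2 mulrC mulrAC.
Qed.
End terms.

Lemma max_risk_le (alpha beta M C1 C2 : R) (T : estimator R d) j1 j2 n r :
  (forall P, model J0 W alpha beta M C1 C2 P -> (mse P (T (j1 n) (j2 n) n) <= r%:E)%E) ->
  (max_risk J0 W alpha beta M C1 C2 T j1 j2 n <= r%:E)%E.
Proof. by move=> h; apply: ub_ereal_sup => _ [P mP <-]; exact: h. Qed.

Section upper_rates.
Variables (S : nat) (alpha beta M C1 C2 : R).
Hypotheses (W_cdv : cdv_basis S J0 W) (alpha0 : 0 < alpha) (beta0 : 0 < beta) (M0 : 0 <= M).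
Variables (j1 j2 : nat -> nat).
Hypothesis J12 : levels J0 j1 j2.
Let s := alpha + beta.
Let s0 : 0 < s. Proof. exact: addr_gt0. Qed.
Local Notation risk := (max_risk J0 W alpha beta M C1 C2).
Let d0 : 0 < d%:R :> R. Proof. by rewrite ltr0n. Qed.
Let kge0 j : 0 <= scale j :> R. Proof. by rewrite ltW// scale_gt0. Qed.

Lemma INT_upper_rate a b rho : rho <= 1 -> rho <= 2 - 2 * b -> rho <= 2 * s * a / d%:R ->
  lesssim (npow a) (@kmin R d j1 j2) -> lesssim (@kmin R d j1 j2) (npow b) ->
  lesssim (risk (psi_INT W) j1 j2) (npow (- rho)).
Proof.
move=> r1 r2 r3; rewrite kminE => /lesssimP[Ca [na [Ca0 ha]]] /lesssimP[Cb [nb [Cb0 hb]]].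
have [K K0 hK] := uniform_mse_le W_cdv C1 C2 alpha0 beta0 M0 (@lexx _ R 0).
exists (K * (1 + Cb ^+ 2 + Ca `^ (2 * s / d%:R))), (maxn 1 (maxn na nb)); split.
  by rewrite mulr_gt0// ltr_wpDr ?powR_ge0// ltr_wpDr ?sqr_ge0.
move=> n; rewrite !geq_max => /and3P[n1 /ha an /hb bn].
rewrite /npow -EFinM; apply: max_risk_le => P mP.
have [h _ _] := hK P mP n (j1 n) (j2 n) n1 (J12 n).1 (J12 n).2.
apply: (le_trans h); rewrite lee_fin -[leRHS]mulrA ler_wpM2l ?(ltW K0)//.
move: (parametric_term n1 r1) (square_term n1 Cb0 (kge0 _) bn r2) (bias_term n1 Ca0 s0 an r3) => e1 e2 e3.
apply: le_trans (lerD (lerD e1 e2) e3) _.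
by rewrite le_eqVlt; apply/orP; left; apply/eqP; ring.
Qed.

Lemma MC_upper_rate a b e rho : rho <= 1 -> b <= 1 -> rho <= 2 - e -> rho <= 2 - 2 * b ->
  rho <= 2 * s * a / d%:R ->
  lesssim (npow a) (@kmin R d j1 j2) -> lesssim (@kmin R d j1 j2) (npow b) ->
  lesssim (@kmax R d j1 j2) (npow e) ->
  lesssim (risk (psi_MC W) j1 j2) (npow (- rho)).
Proof.
move=> r1 b1 re r2 r3; rewrite kminE kmaxE => /lesssimP[Ca [na [Ca0 ha]]] /lesssimP[Cb [nb [Cb0 hb]]]
  /lesssimP[Ce [ne [Ce0 he]]].
have [K K0 hK] := uniform_mse_le W_cdv C1 C2 alpha0 beta0 M0 (ltW Cb0).
exists (K * (1 + Ce + Cb ^+ 2 + Ca `^ (2 * s / d%:R))), (maxn (maxn 1 na) (maxn nb ne)); split.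
  by rewrite mulr_gt0// ltr_wpDr ?powR_ge0// ltr_wpDr ?sqr_ge0// addr_gt0.
move=> n; rewrite !geq_max => /andP[/andP[n1 /ha an] /andP[/hb bn /he en]].
rewrite /npow -EFinM; apply: max_risk_le => P mP.
have [_ h _] := hK P mP n (j1 n) (j2 n) n1 (J12 n).1 (J12 n).2.
apply: (le_trans (h _)).
  apply: (le_trans bn); rewrite ler_wpM2l ?(ltW Cb0)// -[leRHS]powRr1//.
  by apply: ler_powR b1; rewrite ler1n.
rewrite lee_fin -[leRHS]mulrA ler_wpM2l ?(ltW K0)// mulrDr mulr1.
move: (parametric_term n1 r1) (linear_term n1 Ce0 en re) (square_term n1 Cb0 (kge0 _) bn r2)
  (bias_term n1 Ca0 s0 an r3) => e1 e2 e3 e4.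
apply: le_trans (lerD (lerD (lerD e1 e2) e3) e4) _.
by rewrite le_eqVlt; apply/orP; left; apply/eqP; ring.
Qed.

Lemma IF_upper_rate a b e rho : rho <= 1 -> b <= 1 -> rho <= 2 - e -> rho <= 2 - 2 * b ->
  rho <= 2 * s * a / d%:R ->
  lesssim (@kmin R d j1 j2) (npow b) -> lesssim (npow a) (@kmax R d j1 j2) ->
  lesssim (@kmax R d j1 j2) (npow e) ->
  lesssim (risk (psi_IF W) j1 j2) (npow (- rho)).
Proof.
move=> r1 b1 re r2 r3; rewrite kminE kmaxE => /lesssimP[Cb [nb [Cb0 hb]]] /lesssimP[Ca [na [Ca0 ha]]]
  /lesssimP[Ce [ne [Ce0 he]]].
have [K K0 hK] := uniform_mse_le W_cdv C1 C2 alpha0 beta0 M0 (ltW Cb0).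
exists (K * (1 + Ce + Cb ^+ 2 + Ca `^ (2 * s / d%:R))), (maxn (maxn 1 na) (maxn nb ne)); split.
  by rewrite mulr_gt0// ltr_wpDr ?powR_ge0// ltr_wpDr ?sqr_ge0// addr_gt0.
move=> n; rewrite !geq_max => /andP[/andP[n1 /ha an] /andP[/hb bn /he en]].
rewrite /npow -EFinM; apply: max_risk_le => P mP.
have [_ _ h] := hK P mP n (j1 n) (j2 n) n1 (J12 n).1 (J12 n).2.
apply: (le_trans (h _)).
  apply: (le_trans bn); rewrite ler_wpM2l ?(ltW Cb0)// -[leRHS]powRr1//.
  by apply: ler_powR b1; rewrite ler1n.
rewrite lee_fin -[leRHS]mulrA ler_wpM2l ?(ltW K0)// mulrDr mulr1.
move: (parametric_term n1 r1) (linear_term n1 Ce0 en re) (square_term n1 Cb0 (kge0 _) bn r2)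
  (bias_term n1 Ca0 s0 an r3) => e1 e2 e3 e4.
apply: le_trans (lerD (lerD (lerD e1 e2) e3) e4) _.
by rewrite le_eqVlt; apply/orP; left; apply/eqP; ring.
Qed.

End upper_rates.
End growth.

(** * The bias at deterministic laws *)

Section mean_products.
Context {dT : measure_display} {T : measurableType dT} {R : realType}.
Variables (P : probability T R) (n : nat).
Hypothesis n0 : (0 < n)%N.
Let nne : n%:R != 0 :> R. Proof. by rewrite pnatr_eq0 -lt0n. Qed.

Lemma Ex_mean f : bm f -> Ex (iid P n) (fun D => mean D f) = Ex P f.
Proof.
by move=> bf; rewrite ExZ ?Ex_tsum//; [rewrite mulrA mulVf ?mul1r|exact: bm_tsum].
Qed.

(** The n diagonal pairs among the n^2 pairs of observations carry the term in 1/n. *)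
Lemma Ex_meanM f g : bm f -> bm g ->
  Ex (iid P n) (fun D => mean D f * mean D g) =
  (1 - n%:R^-1) * (Ex P f * Ex P g) + n%:R^-1 * Ex P (fun x => f x * g x).
Proof.
move=> bf bg; have b1 := bm_tsum n bf; have b2 := bm_tsum n bg.
have -> : (fun D : n.-tuple T => mean D f * mean D g) =
    (fun D => n%:R^-1 ^+ 2 * (tsum D f * tsum D g)).
  by apply/funext => D; rewrite /mean /tsum; ring.
rewrite ExZ ?Ex_tsumM//; last exact: bmM.
by field.
Qed.

Variables (A Y : T -> R) (I J : finType) (phi : I -> T -> R) (chi : J -> T -> R).
Hypotheses (bA : bm A) (bY : bm Y) (bphi : forall i, bm (phi i)) (bchi : forall j, bm (chi j)).
Hypothesis nested : forall i, {ae P, forall x, phi i x = \sum_j dot P (phi i) (chi j) * chi j x}.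

(** By nestedness the double sum over both families becomes a single sum over the coarse one, for the product of the means as for the diagonal term. *)
Lemma Ex_cross_diag : Ex (iid P n) (fun D => cross P A Y phi chi D) =
  (1 - n%:R^-1) * (\sum_i dot P A (phi i) * dot P Y (phi i)) +
  n%:R^-1 * Ex P (fun x => A x * Y x * \sum_i phi i x ^+ 2).
Proof.
have bAp i := bmM bA (bphi i); have bYc j := bmM bY (bchi j).
have bmA i := bm_mean n (bAp i); have bmY j := bm_mean n (bYc j).
have reproduce f i : bm f -> \sum_j dot P f (chi j) * dot P (phi i) (chi j) = dot P f (phi i).
  move=> bf; have bl := bm_lincomb bchi (fun j => dot P (phi i) (chi j)).
  rewrite [RHS]dotC (ae_eq_dot (bphi i) bl bf (nested i)) dot_suml//.
  by apply: eq_bigr => j _; rewrite dotC mulrC.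
rewrite Ex_sum; last by move=> i; bmt.
transitivity (\sum_i ((1 - n%:R^-1) * (dot P A (phi i) * dot P Y (phi i)) +
    n%:R^-1 * Ex P (fun x => A x * Y x * phi i x ^+ 2))).
  apply: eq_bigr => i _; rewrite Ex_sum; last by move=> j; bmt.
  rewrite -(reproduce Y i bY).
  have -> : Ex P (fun x => A x * Y x * phi i x ^+ 2) =
      \sum_j dot P (fun x => A x * Y x * phi i x) (chi j) * dot P (phi i) (chi j).
    rewrite reproduce; last exact: (bmM (bmM bA bY) (bphi i)).
    by congr (Ex P _); apply/funext => x; rewrite expr2 mulrA.
  rewrite !mulr_sumr -big_split; apply: eq_bigr => j _ /=.
  rewrite ExZr; last by bmt.
  rewrite Ex_meanM// mulrDl; congr (_ + _); first by rewrite /dot; ring.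
  rewrite -mulrA; congr (_ * (_ * _)); congr (Ex P _); apply/funext => x; ring.
rewrite big_split -!mulr_sumr; congr (_ + _ * _).
rewrite -Ex_sum; last by move=> i; bmt.
by congr (Ex P _); apply/funext => x; rewrite mulr_sumr.
Qed.

(** Averaging over an independent subsample instead of integrating does not change the mean, so MC and INT have the same bias. *)
Lemma Ex_mean_emp_proj : Ex ((iid P n \x iid P n) \x iid P n)%E
    (fun D => mean D.2 (fun x => emp_proj A phi D.1.1 x * emp_proj Y chi D.1.1 x)) =
  Ex (iid P n) (fun D => cross P A Y phi chi D).
Proof.
have bF : bm (fun z : n.-tuple T * T => emp_proj A phi z.1 z.2 * emp_proj Y chi z.1 z.2).
  exact: (bmM (bm_emp_proj n bA bphi) (bm_emp_proj n bY bchi)).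
rewrite (Ex_third (iid P n) (bm_mean_pair bF n)) (Ex_prod _ _ (bm_mean_pair bF n)).
congr (Ex _ _); apply/funext => D /=.
by rewrite Ex_mean; [exact: dot_emp_proj|exact: (bm_pair1 bF D)].
Qed.

End mean_products.

Section bias.
Context {R : realType} {d : nat} (W : wavelet_system R d).
Local Notation vec := (vec R d).
Local Notation unif := (unif R d).

(** The mean of INT and of MC at the law where A = p(X) and Y = b(X). *)
Definition bias (n j : nat) (p b : vec -> R) : R := dot unif p b
  - (1 - n%:R^-1) * (\sum_(m : Zidx W j) dot unif p (cPhi m) * dot unif b (cPhi m))
  - n%:R^-1 * Ex unif (fun x => p x * b x * \sum_(m : Zidx W j) cPhi m x ^+ 2).

Lemma biasC n j p b : bias n j p b = bias n j b p.
Proof.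
rewrite /bias dotC; congr (_ - _ * _ - _ * _).
  by apply: eq_bigr => m _; rewrite mulrC.
by congr (Ex _ _); apply/funext => x; rewrite [p x * _]mulrC.
Qed.

Lemma biasDl n j p p' b : (forall m : Zidx W j, bm (cPhi m)) -> bm p -> bm p' -> bm b ->
  bias n j (fun x => p x + p' x) b = bias n j p b + bias n j p' b.
Proof.
move=> bphi bp bp' bb; rewrite /bias dotDl//.
have -> : \sum_(m : Zidx W j) dot unif (fun x => p x + p' x) (cPhi m) * dot unif b (cPhi m) =
    \sum_(m : Zidx W j) dot unif p (cPhi m) * dot unif b (cPhi m) +
    \sum_(m : Zidx W j) dot unif p' (cPhi m) * dot unif b (cPhi m).
  by rewrite -big_split; apply: eq_bigr => m _ /=; rewrite dotDl// mulrDl.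
have -> : (fun x => (p x + p' x) * b x * \sum_(m : Zidx W j) cPhi m x ^+ 2) =
    (fun x => p x * b x * (\sum_(m : Zidx W j) cPhi m x ^+ 2) + p' x * b x * \sum_(m : Zidx W j) cPhi m x ^+ 2).
  by apply/funext => x; rewrite !mulrDl.
rewrite ExD; [ring|bmt|bmt].
Qed.

Lemma biasDr n j p b b' : (forall m : Zidx W j, bm (cPhi m)) -> bm p -> bm b -> bm b' ->
  bias n j p (fun x => b x + b' x) = bias n j p b + bias n j p b'.
Proof. by move=> bphi bp bb bb'; rewrite biasC biasDl// !(biasC n j p). Qed.

End bias.

Section deterministic_law.
Context {R : realType} {d : nat}.
Local Notation vec := (vec R d).
Local Notation unif := (unif R d).
Local Notation obs := (obs R d).
Variables (p b : vec -> R) (C1 C2 : R).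
Hypotheses (bp : bm p) (bb : bm b).
Hypotheses (pC : forall x, C1 <= p x <= C2) (bC : forall x, C1 <= b x <= C2).

Definition graph (x : vec) : obs := (x, p x, b x).

Lemma measurable_graph : measurable_fun setT graph.
Proof.
apply: measurable_fun_pair; last exact: (bm_measurable bb).
by apply: measurable_fun_pair; [exact: measurable_id|exact: (bm_measurable bp)].
Qed.

(** X is uniform and A, Y are the functions p, b of X; conditionally on X nothing is random, so the functional vanishes at this law. *)
Definition graph_law : probability obs R :=
  distribution unif (mfun_Sub (mem_set measurable_graph)).

Lemma Ex_graph_law (f : obs -> R) : bm f -> Ex graph_law f = Ex unif (fun x => f (x, p x, b x)).
Proof. by move=> bf; rewrite Ex_distribution. Qed.

Lemma graph_lawX B : measurable B -> graph_law (@obsX R d @^-1` B) = unif B.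
Proof. by []. Qed.

Lemma ae_graph_law (G : set obs) : measurable G -> (forall x, G (graph x)) ->
  {ae graph_law, forall o, G o}.
Proof.
move=> mG hG; apply: (prob1_ae (P := graph_law) mG).
rewrite -[LHS]/(unif (graph @^-1` G)) (_ : graph @^-1` G = setT) ?probability_setT//.
by apply/seteqP; split => // x _; exact: hG.
Qed.

Lemma graph_law_range : {ae graph_law, forall o, C1 <= obsA o <= C2 /\ C1 <= obsY o <= C2}.
Proof.
apply: (ae_graph_law (G := [set o | C1 <= obsA o <= C2 /\ C1 <= obsY o <= C2])); last first.
  by move=> x; split; [exact: pC|exact: bC].
have mI : measurable (`[C1, C2]%classic : set R) by exact: measurable_itv.
have -> : [set o : obs | C1 <= obsA o <= C2 /\ C1 <= obsY o <= C2] =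
    (@obsA R d @^-1` `[C1, C2]%classic) `&` (@obsY R d @^-1` `[C1, C2]%classic).
  by apply/seteqP; split=> o /=; rewrite !in_itv.
apply: measurableI.
  by rewrite -[X in measurable X]setTI; exact: measurable_obsA.
by rewrite -[X in measurable X]setTI; exact: measurable_obsY.
Qed.

Lemma is_condexp_graph (F : obs -> R) (g : vec -> R) : measurable_fun setT F -> bm g ->
  (forall x, F (graph x) = g x) -> is_condexp graph_law F g.
Proof.
move=> mF bg Fg; have bgX := bm_obsX bg; split; first exact: (bm_measurable bg).
  exact: (bm_integrable graph_law bgX).
move=> B mB; have mXB : measurable (@obsX R d @^-1` B).
  by rewrite -[X in measurable X]setTI; exact: measurable_obsX.
have mE : measurable [set o : obs | F o - g (obsX o) = 0].
  rewrite -[X in measurable X]setTI.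
  have := measurable_funB mF (bm_measurable bgX).
  by move=> /(_ measurableT [set 0]); apply; exact: measurable_set1.
have aeE := ae_graph_law mE (fun x => etrans (congr1 (fun t => t - g x) (Fg x)) (subrr _)).
apply: ae_eq_integral => //.
- by apply: measurable_funTS; apply/measurable_EFinP.
- by apply: measurable_funTS; apply/measurable_EFinP; exact: (bm_measurable bgX).
- by apply: filterS aeE => o /= h _; congr (_%:E); apply/eqP; rewrite -subr_eq0 h.
Qed.

Lemma psi_graph_law : psi graph_law = 0.
Proof.
have condA := is_condexp_graph (@measurable_obsA R d) bp (fun=> erefl).
have condY := is_condexp_graph (@measurable_obsY R d) bb (fun=> erefl).
have bcp := bm_comp (@measurable_clampv R d) bp; have bcb := bm_comp (@measurable_clampv R d) bb.
rewrite (psiE graph_lawX graph_law_range bcp bcb condA condY).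
rewrite Ex_graph_law; last exact: (bmM (@bm_clampA R d C1 C2) (@bm_clampY R d C1 C2)).
apply/eqP; rewrite subr_eq0; apply/eqP; apply: (ae_eq_Ex (P := unif)).
- have -> : (fun x => clampA C1 C2 (x, p x, b x) * clampY C1 C2 (x, p x, b x)) = (fun x => p x * b x).
    by apply/funext => x; rewrite /clampA /clampY !clamp_id ?pC ?bC.
  exact: bmM.
- exact: bmM.
apply: filterS2 (cl_ae p) (cl_ae b) => x hp hb.
by rewrite /clampA /clampY !clamp_id ?pC ?bC// -hp -hb.
Qed.

End deterministic_law.

Section mse_bias.
Context {R : realType} {d S J0 : nat} {W : wavelet_system R d}.
Hypothesis W_cdv : cdv_basis S J0 W.
Local Notation vec := (vec R d).
Local Notation unif := (unif R d).
Local Notation obs := (obs R d).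

Section one_law.
Variables (p b : vec -> R) (C1 C2 : R) (n j1 j2 : nat).
Hypotheses (bp : bm p) (bb : bm b).
Hypotheses (pC : forall x, C1 <= p x <= C2) (bC : forall x, C1 <= b x <= C2).
Hypotheses (n0 : (0 < n)%N) (J1 : (J0 <= j1)%N) (J2 : (J0 <= j2)%N).
Local Notation P := (graph_law bp bb).
Local Notation A := (@clampA R d C1 C2).
Local Notation Y := (@clampY R d C1 C2).
Let bA : bm A. Proof. exact: bm_clampA. Qed.
Let bY : bm Y. Proof. exact: bm_clampY. Qed.
Let PX B (mB : measurable B) := graph_lawX bp bb mB.
Let rangeAY := graph_law_range bp bb pC bC.
Let bo j (Jj : (J0 <= j)%N) (m : Zidx W j) : bm (oPhi m) := bm_oPhi W_cdv m Jj.
Let A_graph x : A (graph p b x) = p x. Proof. by rewrite /clampA clamp_id ?pC. Qed.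
Let Y_graph x : Y (graph p b x) = b x. Proof. by rewrite /clampY clamp_id ?bC. Qed.

Let nested j j' (m : Zidx W j) : (J0 <= j)%N -> (j <= j')%N ->
  {ae P, forall o, oPhi m o = \sum_m' dot P (oPhi m) (@oPhi R d W j' m') * oPhi m' o}.
Proof.
move=> Jj jj'; apply: filterS (ae_obsX PX (Phi_nested_le W_cdv m Jj jj')) => o h.
rewrite [LHS]h; apply: eq_bigr => m' _.
by rewrite (dot_oPhi W_cdv PX)// (leq_trans Jj).
Qed.

Let Ex_cross_graph (Z1 Z2 : obs -> R) (g1 g2 : vec -> R) j j' : bm Z1 -> bm Z2 ->
  (forall x, Z1 (graph p b x) = g1 x) -> (forall x, Z2 (graph p b x) = g2 x) ->
  (J0 <= j)%N -> (j <= j')%N ->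
  Ex (iid P n) (fun D => cross P Z1 Z2 (@oPhi R d W j) (@oPhi R d W j') D) =
  dot unif g1 g2 - bias W n j g1 g2.
Proof.
move=> bZ1 bZ2 Zg1 Zg2 Jj jj'.
rewrite (Ex_cross_diag n0 bZ1 bZ2 (bo Jj) (bo (leq_trans Jj jj')) (fun m => nested m Jj jj')).
have bc (m : Zidx W j) : bm (cPhi m) := bm_Phi W_cdv m Jj.
have dotZ Z g (m : Zidx W j) : bm Z -> (forall x, Z (graph p b x) = g x) ->
    dot P Z (oPhi m) = dot unif g (cPhi m).
  move=> bZ Zg; rewrite /dot Ex_graph_law; last exact: (bmM bZ (bo Jj m)).
  by congr (Ex _ _); apply/funext => x; rewrite -Zg.
rewrite (Ex_graph_law bp bb (f := fun o => Z1 o * Z2 o * \sum_i @oPhi R d W j i o ^+ 2)); last by have h := bo Jj; bmt.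
have -> : (fun x : vec => Z1 (x, p x, b x) * Z2 (x, p x, b x) * \sum_i @oPhi R d W j i (x, p x, b x) ^+ 2) =
    (fun x => g1 x * g2 x * \sum_i @cPhi R d W j i x ^+ 2).
  by apply/funext => x; rewrite -Zg1 -Zg2.
rewrite /bias (eq_bigr (fun m => dot unif g1 (cPhi m) * dot unif g2 (cPhi m))); first by ring.
by move=> m _; rewrite (dotZ _ _ m bZ1 Zg1) (dotZ _ _ m bZ2 Zg2).
Qed.

Let Ex_cross_min : Ex (iid P n) (fun D => cross P A Y (@oPhi R d W j1) (@oPhi R d W j2) D) =
  dot unif p b - bias W n (minn j1 j2) p b.
Proof.
case: (leqP j1 j2) => j12; first exact: Ex_cross_graph.
rewrite dotC biasC -(Ex_cross_graph bY bA Y_graph A_graph J2 (ltnW j12)).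
by congr (Ex _ _); apply/funext => D; rewrite crossC.
Qed.

Let Ex_AY : Ex P (fun o => A o * Y o) = dot unif p b.
Proof.
rewrite Ex_graph_law; last exact: bmM.
by congr (Ex _ _); apply/funext => x; rewrite -[X in _ = X * _]A_graph -[X in _ = _ * X]Y_graph.
Qed.

Let bAY := bm_mean n (bmM bA bY).
Let Q := ((iid P n \x iid P n) \x iid P n)%E.

(** The second moment is at least the square of the mean. *)
Let mse_ge (T T' : sample R d n -> R) : measurable_fun setT T -> bm T' ->
  {ae Q, forall D, T D = T' D} -> Ex Q T' = bias W n (minn j1 j2) p b ->
  ((bias W n (minn j1 j2) p b ^+ 2)%:E <= mse P T)%E.
Proof.
move=> mT bT' TT' <-; rewrite (mseE mT bT' TT') (psi_graph_law bp bb pC bC) lee_fin.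
apply: (le_trans (sqr_Ex_le Q bT')); rewrite le_eqVlt; apply/orP; left; apply/eqP.
by congr (Ex _ _); apply/funext => D; rewrite subr0.
Qed.

Lemma mse_INT_ge : ((bias W n (minn j1 j2) p b ^+ 2)%:E <= mse P (@psi_INT R d W j1 j2 n))%E.
Proof.
have b2 := bm_second bAY.
have b1 := bm_first (bm_cross P bA bY (bo J1) (bo J2) n).
apply: mse_ge (measurable_psi_INT W_cdv J1 J2) (bmB b2 b1) (INT_ae W_cdv PX rangeAY J1 J2 n) _.
rewrite (ExB Q b2 b1) (Ex_second (iid P n) bAY) (Ex_mean P n0 (bmM bA bY)) Ex_AY.
rewrite (Ex_first (iid P n) (bm_cross P bA bY (bo J1) (bo J2) n)) Ex_cross_min.
by rewrite opprB addrC subrK.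
Qed.

Lemma mse_MC_ge : ((bias W n (minn j1 j2) p b ^+ 2)%:E <= mse P (@psi_MC R d W j1 j2 n))%E.
Proof.
have b2 := bm_second bAY.
have m13 : measurable_fun setT (fun D : n.-tuple obs * n.-tuple obs * n.-tuple obs => (D.1.1, D.2)).
  apply: measurable_fun_pair; last exact: measurable_snd.
  exact: (measurableT_comp measurable_fst measurable_fst).
have b1 := bm_comp m13 (bm_mean_pair (bmM (bm_emp_proj n bA (bo J1)) (bm_emp_proj n bY (bo J2))) n).
apply: mse_ge (measurable_psi_MC W_cdv j1 j2 (n:=n)) (bmB b2 b1) (MC_ae PX rangeAY j1 j2 n) _.
rewrite (ExB Q b2 b1) (Ex_second (iid P n) bAY) (Ex_mean P n0 (bmM bA bY)) Ex_AY.
rewrite (Ex_mean_emp_proj P n0 bA bY (bo J1) (bo J2)) Ex_cross_min.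
by rewrite opprB addrC subrK.
Qed.

End one_law.
End mse_bias.

(** * From a bilinear bias to the maximal risk *)

Section perturbation.
Context {R : realType} {d S J0 : nat} {W : wavelet_system R d}.
Hypothesis W_cdv : cdv_basis S J0 W.
Local Notation vec := (vec R d).
Local Notation unif := (unif R d).
Local Notation cube := (@unit_cube R d).

Lemma inner_cl (h g : vec -> R) : inner (cl h) g = inner h g.
Proof. by apply: eq_Rintegral => x /set_mem cx; rewrite /cl clampv_id. Qed.

Lemma inner_bm (h g : vec -> R) : bm h -> bm (cl g) -> inner h g = dot unif h (cl g).
Proof.
move=> bh bg; have bch : bm (cl h) := bm_comp (@measurable_clampv R d) bh.
rewrite innerE//; apply: (ae_eq_dot (P := unif)) => //.
by apply: filterS (cl_ae h) => x ->.
Qed.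

Lemma holder_ball_cl alpha M (h : vec -> R) :
  holder_ball J0 W alpha M h -> holder_ball J0 W alpha M (cl h).
Proof.
move=> [uc hn]; split.
  move=> e e0; have [r r0 hr] := uc e e0; exists r => // x y cx cy xy.
  by rewrite /cl !clampv_id//; exact: hr.
apply: le_trans hn; rewrite le_eqVlt; apply/orP; left; apply/eqP; rewrite /holder_norm.
congr ((_ * _)%:E + ereal_sup _)%E; first by apply: eq_bigr => m _; rewrite inner_cl.
by apply/seteqP; split=> v [l [m [e [Jl ->]]]]; exists l, m, e; rewrite inner_cl.
Qed.

(** The Hoelder norm of h is at most eps; stated with separate bounds on the two kinds of coefficients, which is how it is checked. *)
Definition small_coefs alpha eps (h : vec -> R) := exists c1 c2 : R,
  [/\ 0 <= c1, forall m : Zidx W J0, `|dot unif h (cPhi m)| <= c1,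
      forall l em, (J0 <= l)%N ->
        2 `^ (l%:R * (alpha + d%:R / 2)) * `|dot unif h (@cPsi R d W l em)| <= c2
    & 2 `^ (J0%:R * (alpha + d%:R / 2)) * c1 + c2 <= eps].

(** What can be added to a function that satisfies the constraints of the model with room eps to spare. *)
Definition perturbation alpha eps (h : vec -> R) :=
  [/\ bm h, unif_continuous_on_cube h, forall x, `|h x| <= eps & small_coefs alpha eps h].

Lemma perturbation0 alpha eps : 0 <= eps -> perturbation alpha eps (fun=> 0).
Proof.
move=> e0; have d0 f : dot unif (fun=> 0 : R) f = 0.
  by rewrite /dot (_ : (fun _ => _) = fun=> 0) ?Ex_cst//; apply/funext => x; rewrite mul0r.
split; [exact: bm_cst|by move=> e e1; exists 1 => // x y; rewrite subrr normr0|by move=> x; rewrite normr0|].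
by exists 0, 0; split=> // [m|l em _|]; rewrite ?d0 ?normr0 ?mulr0 ?addr0.
Qed.

Lemma holder_ballD alpha M eps (p h : vec -> R) : holder_ball J0 W alpha (M - eps) p -> bm p ->
  perturbation alpha eps h -> holder_ball J0 W alpha M (fun x => p x + h x).
Proof.
move=> [ucp hp] bp [bh uch _ [c1 [c2 [c10 hc1 hc2 hc]]]]; split.
  move=> e e0; have [r r0 hr] := ucp (e / 2) (divr_gt0 e0 (ltr0n _ 2)).
  have [r' r'0 hr'] := uch (e / 2) (divr_gt0 e0 (ltr0n _ 2)).
  exists (Num.min r r'); first by rewrite lt_min r0.
  move=> x y cx cy xy; rewrite opprD addrACA (le_lt_trans (ler_normD _ _))//.
  rewrite [ltRHS](splitr e) ltrD//.
    by apply: hr => // i; have := xy i; rewrite lt_min => /andP[].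
  by apply: hr' => // i; have := xy i; rewrite lt_min => /andP[].
have inD g : bm (cl g) -> inner (fun x => p x + h x) g = inner p g + dot unif h (cl g).
  by move=> bg; rewrite !inner_bm ?dotDl//; exact: bmD.
rewrite /holder_norm in hp *.
set w := 2 `^ (J0%:R * (alpha + d%:R / 2)) in hc hp *.
set B := \big[Num.max/0]_m _ in hp; set s := ereal_sup _ in hp.
have w0 : 0 <= w by exact: powR_ge0.
apply: (@le_trans _ _ ((w * (B + c1))%:E + (s + c2%:E))%E).
  apply: leeD.
    rewrite lee_fin ler_wpM2l//; apply: bigmax_le => [|m _].
      by rewrite addr_ge0// /B; elim/big_ind : _ => // x y x0 y0; rewrite le_max x0.
    rewrite inD; last exact: (bm_Phi W_cdv m (leqnn J0)).
    rewrite (le_trans (ler_normD _ _))// lerD ?hc1//.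
    by rewrite /B; apply: le_bigmax_cond.
  apply: ub_ereal_sup => _ [l [m [e [Jl ->]]]].
  rewrite inD; last exact: (bm_Psi W_cdv e m Jl).
  apply: (@le_trans _ _ ((2 `^ (l%:R * (alpha + d%:R / 2)) * `|inner p (Psi e m)|)%:E +
    (2 `^ (l%:R * (alpha + d%:R / 2)) * `|dot unif h (cl (Psi e m))|)%:E)%E).
    by rewrite -EFinD lee_fin -mulrDr ler_wpM2l ?powR_ge0// ler_normD.
  apply: leeD; first by apply: ereal_sup_ubound; exists l, m, e.
  by rewrite lee_fin; exact: (hc2 l (e, m) Jl).
rewrite mulrDr EFinD addeACA -EFinD.
apply: (le_trans (leeD hp (_ : _ <= eps%:E)%E)); first by rewrite lee_fin.
by rewrite -EFinD subrK.
Qed.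

Variables (alpha beta M C1 C2 eps : R) (p0 b0 : vec -> R).
Hypotheses (hp0 : holder_ball J0 W alpha (M - eps) p0) (hb0 : holder_ball J0 W beta (M - eps) b0).
Hypotheses (rp0 : forall x, cube x -> C1 + eps <= p0 x <= C2 - eps)
  (rb0 : forall x, cube x -> C1 + eps <= b0 x <= C2 - eps).
Hypothesis eps0 : 0 <= eps.

Let range (q h : vec -> R) : (forall x, cube x -> C1 + eps <= q x <= C2 - eps) ->
  (forall x, `|h x| <= eps) -> forall x, C1 <= cl q x + h x <= C2.
Proof.
move=> hq hh x; have := hq _ (clampv_cube x); have := hh x; rewrite /cl ler_norml.
move=> /andP[? ?] /andP[? ?]; apply/andP; split; lra.
Qed.

Let bp0 : bm (cl p0). Proof. by apply: bm_cl_unif_continuous; case: hp0. Qed.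
Let bb0 : bm (cl b0). Proof. by apply: bm_cl_unif_continuous; case: hb0. Qed.

Lemma model_graph_law h h' (bp : bm (fun x => cl p0 x + h x)) (bb : bm (fun x => cl b0 x + h' x)) :
  perturbation alpha eps h -> perturbation beta eps h' ->
  model J0 W alpha beta M C1 C2 (graph_law bp bb).
Proof.
move=> ph ph'; have [_ _ he _] := ph; have [_ _ he' _] := ph'; split.
- exact: graph_lawX.
- exact: (graph_law_range bp bb (range rp0 he) (range rb0 he')).
- exists (fun x => cl p0 x + h x); first exact: (holder_ballD (holder_ball_cl hp0) bp0 ph).
  exact: (is_condexp_graph bp bb (@measurable_obsA R d) bp).
- exists (fun x => cl b0 x + h' x); first exact: (holder_ballD (holder_ball_cl hb0) bb0 ph').
  exact: (is_condexp_graph bp bb (@measurable_obsY R d) bb).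
Qed.

Variables (h h' : vec -> R) (T : estimator R d) (j1 j2 : nat -> nat) (n j : nat).
Hypotheses (ph : perturbation alpha eps h) (ph' : perturbation beta eps h') (Jj : (J0 <= j)%N).
Hypothesis T_bias : forall p b (bp : bm p) (bb : bm b),
  (forall x, C1 <= p x <= C2) -> (forall x, C1 <= b x <= C2) ->
  ((bias W n j p b ^+ 2)%:E <= mse (graph_law bp bb) (@T (j1 n) (j2 n) n))%E.

(** The mixed second difference of a bilinear form over the four points p0 + {0, h}, b0 + {0, h'} is its value at (h, h'); so at one of the four laws the bias is at least a quarter of it. *)
Lemma max_risk_ge : (((bias W n j h h' / 4) ^+ 2)%:E <= max_risk J0 W alpha beta M C1 C2 T j1 j2 n)%E.
Proof.
set r := max_risk _ _ _ _ _ _ _ _ _ _ _.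
have bc (m : Zidx W j) : bm (cPhi m) := bm_Phi W_cdv m Jj.
have z1 := perturbation0 alpha eps0; have z2 := perturbation0 beta eps0.
have risk g g' : perturbation alpha eps g -> perturbation beta eps g' ->
    ((bias W n j (fun x => cl p0 x + g x) (fun x => cl b0 x + g' x) ^+ 2)%:E <= r)%E.
  move=> pg pg'; have [bg _ he _] := pg; have [bg' _ he' _] := pg'.
  apply: (le_trans (T_bias (bmD bp0 bg) (bmD bb0 bg') (range rp0 he) (range rb0 he'))).
  by apply: ereal_sup_ubound; eexists; first exact: (model_graph_law (bmD bp0 bg) (bmD bb0 bg') pg pg').
have [bh _ _ _] := ph; have [bh' _ _ _] := ph'.
have expand g g' : bm g -> bm g' ->
    bias W n j (fun x => cl p0 x + g x) (fun x => cl b0 x + g' x) =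
    bias W n j (cl p0) (cl b0) + bias W n j (cl p0) g' + (bias W n j g (cl b0) + bias W n j g g').
  move=> bg bg'; rewrite biasDl//; last exact: bmD.
  by rewrite !biasDr.
have bz : bm (fun _ : vec => 0 : R) by exact: bm_cst.
have bias0l g : bm g -> bias W n j (fun=> 0) g = 0.
  move=> bg; have := biasDl n bc bz bz bg.
  rewrite (_ : (fun _ : vec => 0 + 0 : R) = fun=> 0); last by apply/funext => x; rewrite addr0.
  by move=> e; apply: (addrI (bias W n j (fun=> 0) g)); rewrite -e addr0.
have bias0r g : bm g -> bias W n j g (fun=> 0) = 0 by move=> bg; rewrite biasC bias0l.
have := risk _ _ ph ph'; have := risk _ _ ph z2; have := risk _ _ z1 ph'; have := risk _ _ z1 z2.
rewrite !expand// !bias0l// !bias0r// !addr0.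
set u := bias _ _ _ (cl p0) (cl b0); set v := bias _ _ _ (cl p0) h'; set w := bias _ _ _ h (cl b0).
set z := bias _ _ _ h h'.
case: r {risk} => [r| |]; [|by move=> *; rewrite leey|by rewrite leNgt ltNyr].
rewrite !lee_fin => h1 h2 h3 h4.
(* 4 (x^2 + y1^2 + y2^2 + u^2) - (x - y1 - y2 + u)^2 is the sum of the squares of the six pairwise combinations below. *)
set x := u + v + (w + z) in h4.
have -> : z = x - (u + w) - (u + v) + u by rewrite /x; ring.
move: h1 h2 h3 h4; move: (u + w) (u + v) => y1 y2 h1 h2 h3 h4.
have := sqr_ge0 (x + y1); have := sqr_ge0 (x + y2); have := sqr_ge0 (x - u).
have := sqr_ge0 (y1 - y2); have := sqr_ge0 (y1 + u); have := sqr_ge0 (y2 + u); nra.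
Qed.

End perturbation.

(** * Ridge profiles made of signed bumps *)

Section bell.
Context {R : realType} (S : nat).
Hypothesis S1 : (1 <= S)%N.
Implicit Types t u c y : R.

(** The exact Taylor expansion of a polynomial, whose terms of degree at least S are bounded separately. *)
Lemma taylor_remainder (p : {poly R}) : exists2 C : R, 0 <= C & forall c y, 0 <= c <= 1 -> `|y| <= 1 ->
  `|p.[c + y] - \sum_(i < S) p^`N(i).[c] * y ^+ i| <= C * `|y| ^+ S.
Proof.
have horner_le (q : {poly R}) c : 0 <= c <= 1 -> `|q.[c]| <= \sum_(i < size q) `|q`_i|.
  move=> /andP[c0 c1]; rewrite horner_coef (le_trans (ler_norm_sum _ _ _))//.
  apply: ler_sum => i _; rewrite normrM ler_piMr// ger0_norm ?exprn_ge0//.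
  exact: exprn_ile1.
exists (\sum_(k < size p) \sum_(i < size p^`N(S + k)) `|p^`N(S + k)`_i|).
  by apply: sumr_ge0 => k _; apply: sumr_ge0 => i _.
move=> c y c01 y1.
have -> : p.[c + y] = \sum_(i < S + size p) p^`N(i).[c] * y ^+ i.
  rewrite nderiv_taylor; last exact: mulrC.
  rewrite -(big_mkord xpredT (fun i => p^`N(i).[c] * y ^+ i)).
  rewrite -(big_mkord xpredT (fun i => p^`N(i).[c] * y ^+ i)).
  rewrite [RHS](big_cat_nat (n := size p))//=; last by rewrite leq_addl.
  rewrite [X in _ = _ + X]big_nat_cond [X in _ = _ + X]big1 ?addr0// => i /andP[/andP[pi _] _].
  by rewrite nderivn_poly0// horner0 mul0r.
rewrite big_split_ord /= [X in X - _]addrC addrK.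
rewrite (le_trans (ler_norm_sum _ _ _))// mulr_suml; apply: ler_sum => k _.
rewrite normrM exprD normrM mulrCA [leRHS]mulrC normrX ler_wpM2l ?exprn_ge0//.
by rewrite -[leRHS]mulr1 ler_pM// ?horner_le// normrX exprn_ile1.
Qed.

(** A bump on [0, 1], polynomial inside, which vanishes to the order S at both end points; no more smoothness is needed to be orthogonal to wavelets with S vanishing moments up to the Hoelder rate. *)
Definition bell t := Num.max 0 (t * (1 - t)) ^+ S.

Lemma bell_out t : ~~ (0 < t < 1) -> bell t = 0.
Proof.
move=> h; rewrite /bell (_ : Num.max _ _ = 0) ?expr0n ?gtn_eqF//.
by apply/max_idPl; case: (ltP 0 t) h => [t0|t0] /=; rewrite ?negbK -?leNgt => h; nra.
Qed.

Lemma bell_in t : 0 <= t <= 1 -> bell t = (t * (1 - t)) ^+ S.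
Proof. by move=> /andP[t0 t1]; congr (_ ^+ S); apply/max_idPr; nra. Qed.

Lemma bell_ge0 t : 0 <= bell t.
Proof. by rewrite exprn_ge0// le_max lexx. Qed.

Lemma bell_le1 t : bell t <= 1.
Proof. by rewrite exprn_ile1// ?le_max ?lexx// ge_max ler01; nra. Qed.

Lemma bell_gt0 t : bell t != 0 -> 0 < t < 1.
Proof. by apply: contraNT => h; rewrite bell_out. Qed.

(** Since t (1 - t) is at most the distance from t to 0 and to 1, and z lies beyond one of these. *)
Lemma bell_dist t z : z <= 0 \/ 1 <= z -> bell t <= `|t - z| ^+ S.
Proof.
move=> hz; case: (boolP (0 < t < 1)) => [/andP[t0 t1]|h]; last by rewrite bell_out ?exprn_ge0.
rewrite bell_in ?(ltW t0) ?(ltW t1)// lerXn2r ?nnegrE//; first by nra.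
by case: hz => z0; [rewrite ger0_norm|rewrite ler0_norm]; nra.
Qed.

Lemma bell_lip t u : `|bell t - bell u| <= S%:R * `|t - u|.
Proof.
have powlip (x y : R) n : 0 <= x <= 1 -> 0 <= y <= 1 -> `|x ^+ n - y ^+ n| <= n%:R * `|x - y|.
  move=> hx /andP[y0 y1]; elim: n => [|n IH]; first by rewrite !expr0 subrr normr0 mul0r.
  rewrite !exprS (_ : _ - _ = x * (x ^+ n - y ^+ n) + (x - y) * y ^+ n); last by ring.
  rewrite (le_trans (ler_normD _ _))// -[n.+1%:R]natr1 [leRHS]mulrDl mul1r !normrM lerD//.
    case/andP: hx => x0 x1; rewrite (ger0_norm x0) (le_trans _ IH)// ler_piMl//.
  by rewrite ler_piMr// normrX exprn_ile1// ger0_norm.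
have m0 x : 0 <= Num.max 0 (x * (1 - x)) :> R by rewrite le_max lexx.
have m1 x : x * (1 - x) <= Num.max 0 (x * (1 - x)) :> R by rewrite le_max lexx orbT.
have m01 (x : R) : 0 <= Num.max 0 (x * (1 - x)) <= 1.
  by rewrite m0 ge_max ler01; have := sqr_ge0 x; nra.
apply: (le_trans (powlip _ _ S (m01 t) (m01 u))); rewrite ler_wpM2l//.
wlog tu : t u / u <= t => [h|].
  by case: (leP u t) => [/h//|/ltW/h]; rewrite distrC [`|t - u|]distrC.
rewrite (ger0_norm (_ : 0 <= t - u)) ?subr_ge0// ler_norml lerBlDr lerNl opprB lerBlDr.
rewrite !ge_max ![0 <= _ + Num.max _ _]addr_ge0 ?subr_ge0 ?m0//=; apply/andP; split.
  case: (leP t 1) => t1; first by apply: (le_trans _ (lerD (lexx _) (m1 t))); nra.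
  by apply: (le_trans _ (lerD (lexx _) (m0 t))); have := sqr_ge0 (u - 1); nra.
case: (leP 0 u) => u0; first by apply: (le_trans _ (lerD (lexx _) (m1 u))); nra.
by apply: (le_trans _ (lerD (lexx _) (m0 u))); have := sqr_ge0 t; nra.
Qed.

Lemma bell_mid t : 1 / 4 <= t <= 3 / 4 -> (3 / 16) ^+ S <= bell t.
Proof.
move=> /andP[t0 t1]; rewrite bell_in; last by apply/andP; split; lra.
by rewrite lerXn2r ?nnegrE; nra.
Qed.

Definition bell_poly : {poly R} := ('X * (1 - 'X)) ^+ S.

Lemma bell_polyE t : 0 <= t <= 1 -> bell t = bell_poly.[t].
Proof. by move=> h; rewrite bell_in// /bell_poly !hornerE. Qed.

Section ridge.
Variables (N : nat) (sg : 'I_N -> R).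
Hypothesis sg1 : forall q, `|sg q| = 1.

(** Bumps with signs sg on the N cells of length 1/N. *)
Definition ridge u := \sum_(q < N) sg q * bell (N%:R * u - q%:R).

Lemma bell_disjoint (q q' : nat) u : q != q' ->
  bell (N%:R * u - q%:R) * bell (N%:R * u - q'%:R) = 0.
Proof.
move=> qq'; apply/eqP; rewrite mulf_eq0; apply: contra_neqT qq'.
rewrite negb_or => /andP[/bell_gt0/andP[a b] /bell_gt0/andP[a' b']].
have qq : (q < q'.+1)%N by rewrite -(ltr_nat R) -natr1; lra.
have qq' : (q' < q.+1)%N by rewrite -(ltr_nat R) -natr1; lra.
by apply/eqP; rewrite eqn_leq -ltnS qq -ltnS qq'.
Qed.

Lemma ridge_single (q : 'I_N) u : bell (N%:R * u - q%:R) != 0 ->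
  ridge u = sg q * bell (N%:R * u - q%:R).
Proof.
move=> hq; rewrite /ridge (bigD1 q)//= big1 ?addr0// => q' qq'.
have := bell_disjoint u (_ : (q' : nat) != q); rewrite (inj_eq val_inj) => /(_ qq')/eqP.
by rewrite mulf_eq0 (negPf hq) orbF => /eqP ->; rewrite mulr0.
Qed.

Lemma ridge_cases u : ridge u = 0 \/
  exists2 q : 'I_N, ridge u = sg q * bell (N%:R * u - q%:R) & bell (N%:R * u - q%:R) != 0.
Proof.
case: (boolP [exists q : 'I_N, bell (N%:R * u - q%:R) != 0]) => [/existsP[q hq]|].
  by right; exists q => //; exact: ridge_single.
rewrite negb_exists => /forallP h; left; rewrite /ridge big1// => q _.
by have := h q; rewrite negbK => /eqP ->; rewrite mulr0.
Qed.

Lemma ridge_le1 u : `|ridge u| <= 1.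
Proof.
case: (ridge_cases u) => [->|[q -> _]]; first by rewrite normr0.
by rewrite normrM sg1 mul1r ger0_norm ?bell_ge0 ?bell_le1.
Qed.

Lemma ridge_sqr u : ridge u ^+ 2 = \sum_(q < N) bell (N%:R * u - q%:R) ^+ 2.
Proof.
rewrite expr2 {1}/ridge mulr_suml; apply: eq_bigr => q _.
case: (eqVneq (bell (N%:R * u - q%:R)) 0) => [->|hq]; first by rewrite mulr0 mul0r expr0n.
rewrite (ridge_single hq) mulrACA -!expr2.
by rewrite -[X in X * _]real_normK ?num_real// sg1 expr1n mul1r.
Qed.

Lemma ridge_dist (z : nat) u : `|ridge u| <= `|N%:R * u - z%:R| ^+ S.
Proof.
case: (ridge_cases u) => [->|[q -> _]]; first by rewrite normr0 exprn_ge0.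
rewrite normrM sg1 mul1r ger0_norm ?bell_ge0//.
have -> : N%:R * u - z%:R = N%:R * u - q%:R - (z%:R - q%:R) :> R by ring.
apply: bell_dist; case: (leqP z q) => zq.
  by left; rewrite subr_le0 ler_nat.
by right; rewrite lerBrDr nat1r ler_nat.
Qed.

Lemma ridge_lip u v : `|ridge u - ridge v| <= N%:R * (S%:R * (N%:R * `|u - v|)).
Proof.
rewrite -sumrB (le_trans (ler_norm_sum _ _ _))//.
apply: (@le_trans _ _ (\sum_(q < N) (S%:R * (N%:R * `|u - v|)))).
  apply: ler_sum => q _; rewrite -mulrBr normrM sg1 mul1r (le_trans (bell_lip _ _))//.
  by rewrite opprB addrA subrK -mulrBr normrM normr_nat.
by rewrite sumr_const card_ord -[leLHS]mulr_natl.
Qed.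

End ridge.

(** If the set A comes within delta of an end point of a cell then the ridge is itself of order delta^S on A, and the zero polynomial will do. Otherwise A stays inside a single cell, where the ridge is a polynomial, and its Taylor polynomial of degree less than S will do. *)
Lemma ridge_local : exists2 C : R, 0 <= C & forall N (sg : 'I_N -> R), (forall q, `|sg q| = 1) ->
  forall (A : set R) (delta : R), (forall u, A u -> 0 <= u <= 1) ->
  (forall u v, A u -> A v -> N%:R * `|u - v| <= delta) ->
  exists2 q : {poly R}, (size q <= S)%N & forall u, A u -> `|ridge sg u - q.[u]| <= C * delta ^+ S.
Proof.
have [C C0 taylor] := taylor_remainder bell_poly.
exists (C + 2 ^+ S); first by rewrite addr_ge0// exprn_ge0.
move=> N sg sg1 A delta A01 diam.
have [[v Av]|nA] := pselect (exists v, A v); last first.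
  by exists 0; rewrite ?size_poly0// => u Au; exfalso; apply: nA; exists u.
have delta0 : 0 <= delta by apply: le_trans (diam v v Av Av); rewrite mulr_ge0.
have [[z [u1 [Au1 hz]]]|far] := pselect (exists z : nat, exists u, A u /\ `|N%:R * u - z%:R| <= delta).
  exists 0; rewrite ?size_poly0// => u Au; rewrite horner0 subr0 (le_trans (ridge_dist sg1 z u))//.
  apply: (@le_trans _ _ ((2 * delta) ^+ S)).
    rewrite lerXn2r ?nnegrE ?mulr_ge0//.
    rewrite (_ : _ - _ = N%:R * (u - u1) + (N%:R * u1 - z%:R)); last by ring.
    by rewrite (le_trans (ler_normD _ _))// normrM normr_nat [leRHS]mulr_natl mulr2n lerD// diam.
  by rewrite exprMn ler_wpM2r ?exprn_ge0// lerDr.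
have far' z u : A u -> delta < `|N%:R * u - z%:R|.
  by move=> Au; rewrite ltNge; apply/negP => h; apply: far; exists z, u.
have /andP[v0 v1] := A01 v Av.
have Nv0 : 0 <= N%:R * v by rewrite mulr_ge0.
(* The cell that contains v, hence all of A. *)
pose k := Num.truncn (N%:R * v).
have /andP[kv vk] := truncn_itv Nv0; rewrite -/k in kv vk.
have inside u : A u -> k%:R < N%:R * u < k%:R + 1.
  move=> Au; have := diam u v Au Av; have := far' k v Av; have := far' k.+1 v Av.
  rewrite (ler0_norm (_ : N%:R * v - k.+1%:R <= 0)) ?subr_le0 ?(ltW vk)//.
  rewrite (ger0_norm (_ : 0 <= N%:R * v - k%:R)) ?subr_ge0// -natr1 => h1 h2.
  have -> : N%:R * `|u - v| = `|N%:R * u - N%:R * v| by rewrite -mulrBr normrM normr_nat.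
  rewrite ler_norml => /andP[h3 h4]; apply/andP.
  by move: (N%:R * u) (N%:R * v) h1 h2 h3 h4 => x y *; split; lra.
have kN : (k < N)%N.
  rewrite -(ltr_nat R); have /andP[h _] := inside v Av; apply: (lt_le_trans h).
  by rewrite ler_piMr.
pose q0 := Ordinal kN.
pose q := sg q0 *: \sum_(i < S) (bell_poly^`N(i)).[N%:R * v - k%:R] *: ((N%:R : R) *: ('X - v%:P)) ^+ i.
exists q.
  rewrite (leq_trans (size_scale_leq _ _))//; apply: (leq_trans (size_sum _ _ _)).
  apply/bigmax_leqP => i _; rewrite (leq_trans (size_scale_leq _ _))//.
  rewrite exprZn (leq_trans (size_scale_leq _ _))// size_exp_XsubC.
  exact: ltn_ord.
move=> u Au; have /andP[ku uk] := inside u Au.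
have u01 : 0 <= N%:R * u - k%:R <= 1 by apply/andP; split; lra.
have v01 : 0 <= N%:R * v - k%:R <= 1 by have /andP[? ?] := inside v Av; apply/andP; split; lra.
have rE : ridge sg u = sg q0 * bell (N%:R * u - k%:R).
  case: (eqVneq (bell (N%:R * u - k%:R)) 0) => [h|hk]; last exact: (@ridge_single _ _ q0).
  have := bell_polyE u01; rewrite bell_in// in h => _.
  move/eqP: h; rewrite expf_eq0 mulf_eq0 => /andP[_ /orP[/eqP h|/eqP h]]; lra.
have qE : q.[u] = sg q0 * \sum_(i < S) bell_poly^`N(i).[N%:R * v - k%:R] * (N%:R * (u - v)) ^+ i.
  rewrite hornerZ horner_sum; congr (_ * _); apply: eq_bigr => i _.
  by rewrite hornerZ horner_exp hornerZ hornerXsubC.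
rewrite rE qE -mulrBr normrM sg1 mul1r (bell_polyE u01).
have -> : N%:R * u - k%:R = N%:R * v - k%:R + N%:R * (u - v) by ring.
have yd : `|N%:R * (u - v)| <= delta by rewrite normrM normr_nat diam.
apply: (le_trans (taylor _ _ v01 _)).
  by have /andP[? ?] := inside v Av; rewrite mulrBr ler_norml; apply/andP; split; lra.
rewrite mulrDl ler_wpDr ?mulr_ge0 ?exprn_ge0//.
by rewrite ler_wpM2l// lerXn2r ?nnegrE.
Qed.

End bell.

(** * Ridges nearly orthogonal to a space of low resolution *)

(** The signs are chosen one after the other: the new cross term is linear in the new sign, so one of the two signs makes it nonpositive. *)
Lemma exists_signs {R : realFieldType} (I : finType) (a : nat -> I -> R) N :
  exists2 sg : nat -> R, (forall q, `|sg q| = 1) &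
    \sum_i (\sum_(q < N) sg q * a q i) ^+ 2 <= \sum_i \sum_(q < N) a q i ^+ 2.
Proof.
elim: N => [|N [sg sg1 IH]].
  exists (fun=> 1) => [q|]; first by rewrite normr1.
  by apply: ler_sum => i _; rewrite !big_ord0 expr0n.
pose X i := \sum_(q < N) sg q * a q i.
pose s : R := if \sum_i X i * a N i <= 0 then 1 else -1.
have s1 : s ^+ 2 = 1 by rewrite /s; case: ifP; rewrite ?sqrrN expr1n.
have cross : s * \sum_i X i * a N i <= 0.
  rewrite /s; case: ifP => [|/negbT]; first by rewrite mul1r.
  by rewrite -ltNge mulN1r oppr_le0 => /ltW.
exists (fun q => if q == N then s else sg q) => [q|].
  by case: eqP => _; rewrite ?sg1// /s; case: ifP; rewrite ?normrN normr1.
have -> : \sum_i (\sum_(q < N.+1) (if (q : nat) == N then s else sg q) * a q i) ^+ 2 =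
    \sum_i X i ^+ 2 + 2 * (s * \sum_i X i * a N i) + \sum_i a N i ^+ 2.
  rewrite !mulr_sumr -!big_split; apply: eq_bigr => i _ /=.
  rewrite big_ord_recr /= eqxx (eq_bigr (fun q : 'I_N => sg q * a q i)).
    rewrite -/(X i) sqrrD [(s * _) ^+ 2]exprMn s1 mul1r; congr (_ + _ + _); ring.
  by move=> q _; rewrite ltn_eqF.
under [leRHS]eq_bigr do rewrite big_ord_recr /=.
rewrite big_split /= lerD2r (le_trans _ IH)// gerDl; lra.
Qed.

Lemma Ex_uniform01_inside {R : realType} (a b : R) : 0 <= a -> a <= b -> b <= 1 ->
  Ex (uniform_prob (@ltr01 R)) (\1_(`[a, b]%classic : set (measurableTypeR R))) = b - a.
Proof.
move=> a0 ab b1; have mI : measurable (`[a, b]%classic : set (measurableTypeR R)) by exact: measurable_itv.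
apply: EFin_inj; rewrite (Ex_indic _ mI); apply: (etrans (uniform01_eq mI _)).
  by move=> x /=; rewrite !in_itv/= => /andP[ax xb]; rewrite (le_trans a0 ax) (le_trans xb b1).
by rewrite lebesgue_measure_itv/= lte_fin; case: ltgtP ab => // ->; rewrite subrr.
Qed.
Section coordinate.
Context {R : realType} {d : nat} (i0 : 'I_d).
Local Notation vec := (vec R d).
Local Notation unif := (unif R d).
Local Notation U01 := (uniform_prob (@ltr01 R)).

Lemma bm_coord (f : R -> R) : bm (f : measurableTypeR R -> R) -> bm (fun x : vec => f (tnth x i0)).
Proof. by move=> bf; exact: (bm_comp (@measurable_tnth _ _ _ i0) bf). Qed.

Lemma Ex_unif_coord (f : R -> R) : bm (f : measurableTypeR R -> R) ->
  Ex unif (fun x => f (tnth x i0)) = Ex U01 (f : measurableTypeR R -> R).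
Proof.
move=> bf; pose F (i : 'I_d) : measurableTypeR R -> R := if i == i0 then f else fun=> 1.
have bF i : bm (F i) by rewrite /F; case: eqP => // _; exact: bm_cst.
have := Ex_iid_prod U01 bF.
rewrite (bigD1 i0)//= [X in _ * X]big1 ?mulr1; last by move=> i /negPf ne; rewrite /F ne Ex_cst.
rewrite {2}/F eqxx => <-; congr (Ex _ _); apply/funext => x.
rewrite (bigD1 i0)//= [X in _ * X]big1 ?mulr1; last by move=> i /negPf ne; rewrite /F ne.
by rewrite /F eqxx.
Qed.

(** A box with side 2s in the direction i0 and 2r in the others. *)
Lemma Ex_box_side_le (a : 'I_d -> R) (r c : R) (s : R) : 0 <= r -> 0 <= s ->
  Ex unif (fun x => \1_(`[c - s, c + s]%classic : set R) (tnth x i0) *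
    \prod_(i | i != i0) \1_(`[a i - r, a i + r]%classic : set R) (tnth x i)) <=
  2 * s * \prod_(i < d | i != i0) (2 * r).
Proof.
move=> r0 s0.
pose F (i : 'I_d) : measurableTypeR R -> R :=
  if i == i0 then \1_(`[c - s, c + s]%classic) else \1_(`[a i - r, a i + r]%classic).
have bI (x y : R) : bm (\1_(`[x, y]%classic) : measurableTypeR R -> R).
  by apply: bm_indic; exact: measurable_itv.
have bF i : bm (F i) by rewrite /F; case: ifP.
have -> : (fun x : vec => \1_(`[c - s, c + s]%classic : set R) (tnth x i0) *
    \prod_(i | i != i0) \1_(`[a i - r, a i + r]%classic : set R) (tnth x i)) =
    (fun x => \prod_i F i (tnth x i)).
  apply/funext => x; rewrite [RHS](bigD1 i0)//= {1}/F eqxx; congr (_ * _).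
  by apply: eq_bigr => i /negPf ne; rewrite /F ne.
rewrite (Ex_iid_prod U01 bF) (bigD1 i0)//= ler_pM//.
- by apply: Ex_ge0 => x; rewrite /F; case: ifP; rewrite indicE.
- by apply: prodr_ge0 => i _; apply: Ex_ge0 => x; rewrite /F; case: ifP; rewrite indicE.
- by rewrite /F eqxx; exact: Ex_uniform01_itv.
apply: ler_prod => i /negPf ne; rewrite /F ne Ex_uniform01_itv// andbT.
by apply: Ex_ge0 => x; rewrite indicE.
Qed.

End coordinate.

Section ridge_on_cube.
Context {R : realType} {d S : nat} (i0 : 'I_d).
Hypothesis S1 : (1 <= S)%N.
Local Notation vec := (vec R d).
Local Notation unif := (unif R d).
Local Notation U01 := (uniform_prob (@ltr01 R)).

Lemma bm_bell (a b : R) : bm (fun u : measurableTypeR R => bell S (a * u - b)).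
Proof.
split; last by exists 1 => u; rewrite ger0_norm ?bell_ge0 ?bell_le1.
apply: measurable_funX; apply: measurable_maxr => //.
have m : measurable_fun setT (fun u : measurableTypeR R => a * u - b).
  by apply: measurable_funB => //; apply: measurable_funM.
by apply: measurable_funM => //; apply: measurable_funB.
Qed.

Variable N : nat.
Hypothesis N0 : (0 < N)%N.
Let Nr0 : 0 < N%:R :> R. Proof. by rewrite ltr0n. Qed.
Let Nne : N%:R != 0 :> R. Proof. by rewrite gt_eqF. Qed.

Definition ridgev (sg : nat -> R) (x : vec) : R := ridge S (fun q : 'I_N => sg q) (tnth x i0).

Lemma bm_ridgev sg : bm (ridgev sg).
Proof.
apply: (bm_coord i0 (f := ridge S (fun q : 'I_N => sg q))).
by apply: bm_sum => q; apply: bmM; [exact: bm_cst|exact: bm_bell].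
Qed.

Variable sg : nat -> R.
Hypothesis sg1 : forall q, `|sg q| = 1.
Let sg1' : forall q : 'I_N, `|sg q| = 1. Proof. by move=> q. Qed.

Lemma ridgev_le1 x : `|ridgev sg x| <= 1.
Proof. exact: ridge_le1. Qed.

Lemma ridgev_unif_continuous (c : R) : unif_continuous_on_cube (fun x => c * ridgev sg x).
Proof.
move=> e e0; pose L := (`|c| + 1) * (N%:R * (S%:R * N%:R)).
have L0 : 0 < L.
  by rewrite !mulr_gt0// ?ltr0n// ltr_wpDl.
exists (e / L); first exact: divr_gt0.
move=> x y _ _ /(_ i0); rewrite ltr_pdivlMr// => h; apply: le_lt_trans h.
rewrite -mulrBr normrM (le_trans (ler_wpM2l (normr_ge0 _) (ridge_lip S sg1' _ _)))//.
rewrite /L; set D := `|tnth x i0 - _|.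
rewrite (_ : `|c| * (N%:R * (S%:R * (N%:R * D))) = D * (`|c| * (N%:R * (S%:R * N%:R)))); last by ring.
apply: ler_wpM2l; first exact: normr_ge0.
by apply: ler_wpM2r; rewrite ?mulr_ge0// lerDl.
Qed.

(** The bumps do not overlap, and each is at least (3/16)^S on the middle half of its cell. *)
Lemma ridgev_norm_ge : (3 / 16) ^+ S ^+ 2 / 2 <= dot unif (ridgev sg) (ridgev sg).
Proof.
pose I q : set (measurableTypeR R) := `[(q%:R + 1 / 4) / N%:R, (q%:R + 3 / 4) / N%:R]%classic.
pose f (u : R) := \sum_(q < N) (3 / 16 : R) ^+ S ^+ 2 * \1_(I q) u.
have bI q : bm (\1_(I q) : measurableTypeR R -> R) by apply: bm_indic; exact: measurable_itv.
have bf : bm (f : measurableTypeR R -> R) by apply: bm_sum => q; apply: bmM => //; exact: bm_cst.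
apply: (@le_trans _ _ (Ex unif (fun x => f (tnth x i0)))).
  rewrite Ex_unif_coord// Ex_sum; last by move=> q; apply: bmM => //; exact: bm_cst.
  under eq_bigr => q _.
    rewrite ExZ// Ex_uniform01_inside; first over.
    - by rewrite divr_ge0// addr_ge0.
    - by rewrite ler_pM2r ?invr_gt0//; lra.
    - rewrite ler_pdivrMr// mul1r.
      have : (q.+1)%:R <= N%:R :> R by rewrite ler_nat ltn_ord.
      by rewrite -natr1; lra.
  rewrite (eq_bigr (fun=> (3 / 16) ^+ S ^+ 2 * (1 / 2 / N%:R))); last by move=> q _; congr (_ * _); field.
  rewrite sumr_const card_ord -[leRHS]mulr_natl le_eqVlt; by apply/orP; left; apply/eqP; field.
rewrite dotff; apply: le_Ex.
- exact: bm_coord.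
- exact: (bmX 2 (bm_ridgev sg)).
move=> x; rewrite /ridgev (ridge_sqr S1 sg1'); apply: ler_sum => q _.
have [/set_mem|h] := boolP (tnth x i0 \in I q); last by rewrite indicE (negPf h) mulr0 sqr_ge0.
rewrite /I /= in_itv /= ler_pdivrMr// ler_pdivlMr// => /andP[h1 h2].
rewrite indicE mem_set ?mulr1; last by rewrite /I /= in_itv /= ler_pdivrMr// ler_pdivlMr// h1.
have hb : (3 / 16) ^+ S <= bell S (N%:R * tnth x i0 - q%:R) :> R.
  by apply: bell_mid; apply/andP; rewrite [N%:R * _]mulrC; split; lra.
have c0 : 0 <= (3 / 16) ^+ S :> R by apply: exprn_ge0; lra.
by apply: lerXn2r hb; rewrite ?nnegrE ?bell_ge0.
Qed.
End ridge_on_cube.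

Section slabs.
Context {R : realType} {d : nat} (i0 : 'I_d) (N : nat).
Local Notation vec := (vec R d).

Definition slab (q : nat) (x : vec) : R := ((0 < N%:R * (tnth x i0 : R) - q%:R < 1)%R)%:R.

Lemma bm_slab q : (0 < N)%N -> bm (slab q).
Proof.
move=> N0; have Nr0 : 0 < N%:R :> R by rewrite ltr0n.
have -> : slab q = fun x : vec => \1_(`]q%:R / N%:R, (q%:R + 1) / N%:R[%classic : set R) (tnth x i0).
  apply/funext => x; rewrite /slab indicE; congr ((nat_of_bool _)%:R); apply/idP/idP.
    move=> /andP[h1 h2]; rewrite inE /= in_itv /= ltr_pdivrMr// ltr_pdivlMr// [_ * N%:R]mulrC.
    by apply/andP; split; lra.
  rewrite inE /= in_itv /= ltr_pdivrMr// ltr_pdivlMr// [_ * N%:R]mulrC => /andP[h1 h2].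
  by apply/andP; split; lra.
by apply: (bm_coord i0 (f := \1_(`]q%:R / N%:R, (q%:R + 1) / N%:R[%classic))); apply: bm_indic; exact: measurable_itv.
Qed.

Lemma slab_sum_le1 x : \sum_(q < N) slab q x <= 1.
Proof.
case: (boolP [exists q : 'I_N, slab q x != 0]) => [/existsP[q hq]|]; last first.
  rewrite negb_exists => /forallP h; rewrite big1 ?ler01// => q _.
  by have := h q; rewrite negbK => /eqP.
have slab_itv (k : nat) : slab k x != 0 -> 0 < N%:R * (tnth x i0 : R) - k%:R < 1.
  by rewrite /slab; case: (_ < _ < _) => //; rewrite eqxx.
rewrite (bigD1 q)//= big1 ?addr0; first by rewrite /slab; case: (_ < _ < _); rewrite ?lexx ?ler01.
move=> q' qq'; apply/eqP; apply: contraNT qq' => /slab_itv/andP[a b].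
have /andP[a' b'] := slab_itv _ hq; move: (N%:R * _) a b a' b' => z a b a' b'.
have h1 : (q < q'.+1)%N by rewrite -(ltr_nat R) -natr1; lra.
have h2 : (q' < q.+1)%N by rewrite -(ltr_nat R) -natr1; lra.
by rewrite -(inj_eq val_inj) eqn_leq -ltnS h2 -ltnS h1.
Qed.

End slabs.

Section ridge_wavelets.
Context {R : realType} {d S J0 : nat} {W : wavelet_system R d} (i0 : 'I_d).
Hypothesis W_cdv : cdv_basis S J0 W.
Hypothesis S1 : (1 <= S)%N.
Local Notation vec := (vec R d).
Local Notation unif := (unif R d).
Local Notation cube := (@unit_cube R d).
Local Notation scale := (@scale R d).

(** Cauchy-Schwarz inequality on the intersection of the two supports: the bump is integrated over the box that carries the scaling function, and the scaling function over the slab that carries the bump. The first integral is at most the volume of the intersection; the second ones add up to 1 over the slabs. *)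
Lemma bell_coef_le (C : R) N q j (m : Zidx W j) : (0 < N)%N -> 1 <= C -> localized C j (@Phi _ _ W j) ->
  (J0 <= j)%N ->
  dot unif (fun x => bell S (N%:R * (tnth x i0 : R) - q%:R)) (cPhi m) ^+ 2 <=
  N%:R^-1 * (\prod_(i < d | i != i0) (2 * (C * 2 ^- j))) *
    Ex unif (fun x => cPhi m x ^+ 2 * slab i0 N q x).
Proof.
move=> N0 C1 loc Jj; have [_ [a supp] _] := loc.
have Nr0 : 0 < N%:R :> R by rewrite ltr0n.
have C0 : 0 <= C by exact: le_trans C1.
pose r := C * 2 ^- j; have r0 : 0 <= r by rewrite mulr_ge0// invr_ge0 exprn_ge0.
pose box (x : vec) : R := \prod_(i | i != i0) \1_(`[tnth (a m) i - r, tnth (a m) i + r]%classic : set R) (tnth x i).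
pose sl : vec -> R := slab i0 N q.
pose g (x : vec) := bell S (N%:R * (tnth x i0 : R) - q%:R).
have bg : bm g by apply: (bm_coord i0 (f := fun u => bell S (N%:R * u - q%:R))); exact: bm_bell.
have bphi := bm_Phi W_cdv m Jj.
have bI (x y : R) : bm (\1_(`[x, y]%classic) : measurableTypeR R -> R).
  by apply: bm_indic; exact: measurable_itv.
have bbox : bm box.
  by apply: bm_prod => i; exact: (bm_coord i (f := \1_(`[tnth (a m) i - r, tnth (a m) i + r]%classic))).
have bslab : bm sl by exact: bm_slab.
have bgb := bmM bg bbox; have bps := bmM bphi bslab.
have -> : dot unif g (cPhi m) = dot unif (fun x => g x * box x) (fun x => cPhi m x * sl x).
  apply: ae_eq_Ex; [exact: bmM|exact: bmM|].
  apply: filterS (@cube_ae R d) => x cx.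
  case: (eqVneq (g x) 0) => [->|gx]; first by rewrite !mul0r.
  have -> : sl x = 1 by rewrite /sl /slab (bell_gt0 S1 gx).
  case: (eqVneq (cPhi m x) 0) => [->|px]; first by rewrite mul0r !mulr0.
  suff -> : box x = 1 by rewrite !mulr1.
  rewrite /cPhi /cl clampv_id// in px.
  rewrite /box big1// => i _; rewrite indicE mem_set//= in_itv /=.
  by have := supp m x cx px i; rewrite ler_norml lerBrDr lerBlDl [- _ + _]addrC.
apply: (le_trans (dot_CS unif bgb bps)).
rewrite !dotff; apply: ler_pM.
- by apply: Ex_ge0 => x; rewrite sqr_ge0.
- by apply: Ex_ge0 => x; rewrite sqr_ge0.
- pose c := (q%:R + 1 / 2) / N%:R : R; pose s := (1 / 2) / N%:R : R.
  have s0 : 0 <= s by rewrite divr_ge0.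
  apply: (@le_trans _ _ (2 * s * \prod_(i < d | i != i0) (2 * r))); last first.
    rewrite (_ : 2 * s = N%:R^-1)// /s; field.
    exact: (lt0r_neq0 Nr0).
  apply: le_trans (Ex_box_side_le i0 (fun i => tnth (a m) i) c r0 s0).
  apply: le_Ex; first exact: bmX.
    by apply: bmM bbox; apply: (bm_coord i0 (f := \1_(`[c - s, c + s]%classic))).
  move=> x; have box01 : 0 <= box x <= 1.
    apply/andP; split; first by apply: prodr_ge0 => i _; rewrite indicE.
    by apply: prodr_ile1 => i _; rewrite indicE; case: (_ \in _); rewrite lexx ler01.
  have /andP[b0 b1] := box01; rewrite exprMn.
  apply: ler_pM; rewrite ?sqr_ge0//; last by rewrite expr2 ler_piMl.
  case: (eqVneq (g x) 0) => [->|gx]; first by rewrite expr0n indicE.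
  have /andP[h1 h2] := bell_gt0 S1 gx.
  rewrite indicE mem_set; first by rewrite exprn_ile1 ?bell_ge0 ?bell_le1.
  rewrite /= in_itv /= /c /s -mulrBl -mulrDl ler_pdivrMr// ler_pdivlMr// [_ * N%:R]mulrC.
  by apply/andP; split; lra.
apply: le_Ex; [exact: bmX|by apply: bmM bslab; exact: bmX|] => x.
by rewrite exprMn /sl /slab; case: (_ < _ < _); rewrite ?expr1n ?expr0n.
Qed.

(** With the signs of the greedy choice the energy is at most the sum over bumps and scaling functions of the squared inner products. Since the slabs are disjoint this sum is at most the number of scaling functions times the volume of the intersection of a slab with the support of one of them, i.e. O(2^(jd)) O(2^(-j(d-1)) / N). *)
Lemma ridge_energy : exists2 C : R, 0 < C & forall j N, (J0 <= j)%N -> (0 < N)%N ->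
  exists2 sg : nat -> R, (forall q, `|sg q| = 1) &
    @energy R d W (@ridgev R d S i0 N sg) j <= C * (2 ^+ j / N%:R).
Proof.
have [C C1 hC] := localization_const W_cdv.
have [cz' [CZ [_ cardZ]]] := card_Zidx W_cdv.
have C0 : 0 < C by apply: lt_le_trans C1.
have CC : 0 < (2 * C) ^+ d by rewrite exprn_gt0// mulr_gt0.
exists ((`|CZ| + 1) * (2 * C) ^+ d); first by rewrite mulr_gt0// ltr_wpDl.
move=> j N Jj N0; have Nr0 : 0 < N%:R :> R by rewrite ltr0n.
pose a q (m : Zidx W j) := dot unif (fun x => bell S (N%:R * (tnth x i0 : R) - q%:R)) (cPhi m).
have [sg sg1 hsg] := exists_signs a N; exists sg => //.
have bg q : bm (fun x : vec => bell S (N%:R * (tnth x i0 : R) - q%:R)).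
  by apply: (bm_coord i0 (f := fun u => bell S (N%:R * u - q%:R))); exact: bm_bell.
have bphi (m : Zidx W j) : bm (cPhi m) := bm_Phi W_cdv m Jj.
rewrite /energy (eq_bigr (fun m => (\sum_(q < N) sg q * a q m) ^+ 2)); last first.
  by move=> m _; rewrite dot_suml.
apply: (le_trans hsg).
have [loc _] := hC j Jj.
pose p := \prod_(i < d | i != i0) (2 * (C * 2 ^- j)).
have rho0 : 0 < 2 * (C * 2 ^- j) by rewrite !mulr_gt0// invr_gt0 exprn_gt0.
have p0 : 0 <= p by apply: prodr_ge0 => i _; exact: ltW.
(* p is a product of d - 1 equal sides; one more side makes it the volume of a cube. *)
have pE : p * (2 * (C * 2 ^- j)) = (2 * C) ^+ d * (scale j)^-1 :> R.
  have : \prod_(i < d) (2 * (C * 2 ^- j)) = 2 * (C * 2 ^- j) * p by rewrite (bigD1 i0).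
  rewrite prodr_const card_ord => e; rewrite mulrC -e mulrA exprMn.
  by rewrite exprVn -exprM.
apply: (@le_trans _ _ (\sum_(m : Zidx W j) N%:R^-1 * p)).
  apply: ler_sum => m _.
  apply: (@le_trans _ _ (\sum_(q < N) N%:R^-1 * p * Ex unif (fun x => cPhi m x ^+ 2 * slab i0 N q x))).
    by apply: ler_sum => q _; exact: bell_coef_le.
  have bs q : bm (slab (R := R) i0 N q) by exact: bm_slab.
  have bps q : bm (fun x => cPhi m x ^+ 2 * slab i0 N q x) := bmM (bmX 2 (bphi m)) (bs q).
  rewrite -mulr_sumr -[leRHS]mulr1 ler_wpM2l ?mulr_ge0 ?invr_ge0//.
  rewrite -Ex_sum//; have <- : dot unif (cPhi m) (cPhi m) = 1.
    by rewrite (orthonormal_Phi W_cdv Jj) eqxx.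
  rewrite dotff; apply: le_Ex; [exact: bm_sum|exact: (bmX 2 (bphi m))|] => x.
  by rewrite -mulr_sumr ler_piMr ?sqr_ge0// slab_sum_le1.
rewrite sumr_const -[leLHS]mulr_natl.
have cz : #|Zidx W j|%:R <= (`|CZ| + 1) * scale j :> R.
  apply: (le_trans (proj2 (andP (cardZ j Jj)))); rewrite ler_wpM2r ?(ltW (scale_gt0 j))//.
  by rewrite (le_trans (ler_norm _))// lerDl.
apply: (@le_trans _ _ ((`|CZ| + 1) * scale j * (N%:R^-1 * p))).
  by rewrite ler_wpM2r// mulr_ge0// invr_ge0.
have -> : p = (2 * C) ^+ d * (scale j)^-1 * (2 ^+ j / (2 * C)).
  rewrite -pE -mulrA -[LHS]mulr1; congr (_ * _); field.
  by rewrite (gt_eqF C0) expf_neq0.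
rewrite (_ : _ * (N%:R^-1 * _) = (`|CZ| + 1) * (2 * C) ^+ d * (2 ^+ j / N%:R) * (2 * C)^-1); last first.
  by field; rewrite (gt_eqF C0) (gt_eqF Nr0) (gt_eqF (scale_gt0 j)).
apply: ler_piMr; last by rewrite invf_le1 ?mulr_gt0//; lra.
by rewrite !mulr_ge0 ?addr_ge0 ?(ltW CC) ?invr_ge0 ?exprn_ge0.
Qed.

End ridge_wavelets.

(** * Smoothness of ridges and their bias *)

Lemma norm_Ex_le {dT : measure_display} {T : measurableType dT} {R : realType}
  (P : probability T R) (f : T -> R) : bm f -> `|Ex P f| <= Ex P (fun x => `|f x|).
Proof.
move=> bf; have bn := bm_norm bf; rewrite ler_norml -ExN//.
apply/andP; split; apply: le_Ex; rewrite //; try by bmt.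
  by move=> x; rewrite lerNl ler_normr lexx orbT.
by move=> x; exact: ler_norm.
Qed.

Section smoothness.
Context {R : realType} {d S J0 : nat} {W : wavelet_system R d} (i0 : 'I_d).
Hypothesis W_cdv : cdv_basis S J0 W.
Hypothesis S1 : (1 <= S)%N.
Local Notation vec := (vec R d).
Local Notation unif := (unif R d).
Local Notation cube := (@unit_cube R d).

Let mono (i : nat) (x : vec) : R := clamp 0 1 (tnth x i0) ^+ i.

Let bmono i : bm (mono i).
Proof.
apply: bmX; apply: (bm_coord i0 (f := clamp 0 1)); split; first exact: measurable_clamp.
by exists 1 => u; have /andP[a b] := clamp_itv u (@ler01 R); rewrite ger0_norm.
Qed.

Lemma monomial_Phi j i : (J0 <= j)%N -> (i < S)%N ->
  exists c : Zidx W j -> R, {ae unif, forall x, mono i x = \sum_m c m * cPhi m x}.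
Proof.
move=> Jj iS.
have sumi : (\sum_(k < d) (if k == i0 then i else 0) < S)%N.
  by rewrite (bigD1 i0)//= eqxx big1 ?addn0// => k /negPf ->.
have [c hc] := Phi_polynomials W_cdv Jj sumi; exists c.
apply: filterS2 (ae_cl hc) (@cube_ae R d) => x hx cx.
rewrite -[RHS]hx /cl /mono (bigD1 i0)//= eqxx big1 ?mulr1 => [|k /negPf ->]; last by rewrite expr0.
by rewrite tnth_mktuple.
Qed.

(** Vanishing moments: monomials of degree less than S are in V_l, which is orthogonal to the wavelets of level l. *)
Lemma monomial_Psi l em i : (J0 <= l)%N -> (i < S)%N -> dot unif (mono i) (@cPsi R d W l em) = 0.
Proof.
move=> Jl iS; have [c hc] := monomial_Phi Jl iS.
have bphi (m : Zidx W l) : bm (cPhi m) := bm_Phi W_cdv m Jl.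
have bpsi : bm (@cPsi R d W l em) := bm_Psi W_cdv em.1 em.2 Jl.
rewrite (ae_eq_dot (bmono i) (bm_lincomb bphi c) bpsi hc) dot_suml// big1// => m _.
by rewrite (Phi_Psi_orth W_cdv)// mulr0.
Qed.

(** Below the frequency of the ridge its inner product with a wavelet is bounded by the L^1 norm of the wavelet. Above it, a polynomial that is close to the ridge on the support of the wavelet can be subtracted for free. *)
Lemma ridge_coefs : exists2 C : R, 0 <= C & forall N (sg : nat -> R), (0 < N)%N ->
  (forall q, `|sg q| = 1) ->
  (forall m : Zidx W J0, `|dot unif (ridgev (S := S) i0 N sg) (cPhi m)| <= C) /\
  forall l em, (J0 <= l)%N ->
    `|dot unif (ridgev (S := S) i0 N sg) (@cPsi R d W l em)| <=
    C * Num.min 1 ((N%:R / 2 ^+ l) ^+ S) * (2 `^ (l%:R * d%:R / 2))^-1.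
Proof.
have [C C1 hC] := localization_const W_cdv.
have C0 : 0 <= C by exact: le_trans C1.
have [D D0 hD] := ridge_local (R := R) S1.
pose L := C * (2 * C) ^+ d.
have L0 : 0 <= L by rewrite mulr_ge0// exprn_ge0// mulr_ge0.
pose E := 1 + D * (2 * C) ^+ S.
have E0 : 0 <= D * (2 * C) ^+ S by rewrite mulr_ge0// exprn_ge0// mulr_ge0.
have w1 l : 1 <= 2 `^ (l%:R * d%:R / 2) :> R.
  rewrite -[leLHS](powRr0 2); apply: ler_powR; first by rewrite ler1n.
  by rewrite divr_ge0// mulr_ge0.
have dot_le (g psi : vec -> R) (e l1 : R) : bm g -> bm psi -> 0 <= e ->
    {ae unif, forall x, psi x != 0 -> `|g x| <= e} -> Ex unif (fun x => `|psi x|) <= l1 ->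
    `|dot unif g psi| <= e * l1.
  move=> bg bpsi e0 hg hl; have bgp := bmM bg bpsi; have bn := bm_norm bpsi.
  apply: (le_trans (norm_Ex_le unif bgp)); apply: le_trans (ler_wpM2l e0 hl).
  rewrite -ExZ//; apply: ae_le_Ex; [exact: bm_norm|by bmt|].
  apply: filterS hg => x hx; rewrite normrM.
  case: (eqVneq (psi x) 0) => [->|/hx h]; first by rewrite normr0 !mulr0.
  by rewrite ler_wpM2r.
exists (L * E); first by rewrite mulr_ge0// addr_ge0.
move=> N sg N0 sg1; have bG : bm (ridgev (S := S) i0 N sg) by exact: bm_ridgev.
have G1 x : `|ridgev (S := S) i0 N sg x| <= 1 by exact: ridgev_le1.
split=> [m|l em Jl].
  have [loc _] := hC J0 (leqnn _).
  apply: (le_trans (dot_le _ _ 1 _ bG (bm_Phi W_cdv m (leqnn _)) ler01 _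
    (localized_L1 (@Phi_measurable _ _ _ _ _ W_cdv J0) loc C0 m))); first exact: aeW.
  rewrite mul1r -/L ler_wpM2l// (@le_trans _ _ 1)//; last by rewrite lerDl.
  by rewrite invf_le1// (lt_le_trans ltr01).
have [_ /(_ em.1) loc] := hC l Jl; have [_ [a supp] _] := loc.
have bpsi : bm (@cPsi R d W l em) := bm_Psi W_cdv em.1 em.2 Jl.
have psiL1 := localized_L1 (@Psi_measurable _ _ _ _ _ W_cdv l em.1) loc C0 em.2.
rewrite -/L in psiL1.
set w := (2 `^ _)^-1 in psiL1 *.
have w0 : 0 <= w by rewrite invr_ge0 powR_ge0.
suff [e [e0 eE le_e]] : exists e, [/\ 0 <= e, e <= E * Num.min 1 ((N%:R / 2 ^+ l) ^+ S)
    & `|dot unif (ridgev (S := S) i0 N sg) (@cPsi R d W l em)| <= e * (L * w)].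
  apply: (le_trans le_e); rewrite mulrA ler_wpM2r// mulrC -mulrA ler_wpM2l//.
have [h1|h1] := leP 1 ((N%:R / 2 ^+ l : R) ^+ S).
  exists 1; split=> //; first by rewrite mulr1 lerDl.
  by apply: dot_le => //; exact: aeW.
(* The i0-th coordinates of the points where the wavelet does not vanish. *)
pose A : set R := [set u | exists x, [/\ cube x, Psi em.1 em.2 x != 0 & u = tnth x i0]].
pose delta : R := N%:R * (2 * C / 2 ^+ l).
have [||q qS hq] := hD N (fun q => sg q) (fun q => sg1 q) A delta.
- by move=> u [x [cx _ ->]]; exact: cx.
- move=> u v [x [cx px ->]] [y [cy py ->]]; rewrite /delta ler_wpM2l//.
  rewrite (_ : tnth x i0 - tnth y i0 = (tnth x i0 - tnth (a em.2) i0 : R) - (tnth y i0 - tnth (a em.2) i0)); last first.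
    by move: (tnth x i0 : R) (tnth y i0 : R) (tnth (a em.2) i0 : R) => *; ring.
  rewrite (le_trans (ler_normB _ _))// (_ : 2 * C / 2 ^+ l = C * 2 ^- l + C * 2 ^- l); last by ring.
  by rewrite lerD// supp.
pose Q (x : vec) := \sum_(i < size q) q`_i * mono i x.
have bQ : bm Q by apply: bm_lincomb.
have QE x : cube x -> Q x = q.[tnth x i0].
  move=> cx; rewrite horner_coef; apply: eq_bigr => i _; congr (_ * _ ^+ _).
  by rewrite clamp_id//; exact: cx.
have Q0 : dot unif Q (@cPsi R d W l em) = 0.
  rewrite dot_suml// big1// => i _; rewrite monomial_Psi ?mulr0//.
  exact: leq_trans (ltn_ord i) qS.
exists (D * delta ^+ S); split.
- by rewrite mulr_ge0// exprn_ge0// !mulr_ge0// invr_ge0 exprn_ge0.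
- have -> : D * delta ^+ S = D * (2 * C) ^+ S * (N%:R / 2 ^+ l) ^+ S.
    by rewrite -mulrA -exprMn; congr (_ * _ ^+ _); rewrite /delta; ring.
  by apply: ler_wpM2r; [rewrite exprn_ge0// divr_ge0// exprn_ge0|rewrite /E lerDr].
have -> : dot unif (ridgev (S := S) i0 N sg) (@cPsi R d W l em) =
    dot unif (fun x => ridgev (S := S) i0 N sg x - Q x) (@cPsi R d W l em).
  by rewrite dotBl// Q0 subr0.
apply: dot_le => //; first exact: bmB.
  by rewrite mulr_ge0// exprn_ge0// !mulr_ge0// invr_ge0 exprn_ge0.
apply: filterS (@cube_ae R d) => x cx; rewrite /cPsi /cl clampv_id// => px.
by rewrite QE//; apply: hq; exists x.
Qed.

(** At the level l with y = 2^l / N, the normalized coefficient is at most y^alpha min(1, y^(-S)), which is at most 1 because alpha < S. *)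
Lemma ridge_perturbation (alpha eps : R) : 0 < alpha -> alpha < S%:R -> 0 < eps ->
  exists2 t : R, 0 < t & forall N (sg : nat -> R), (0 < N)%N -> (forall q, `|sg q| = 1) ->
    @perturbation R d J0 W alpha eps (fun x => t * N%:R `^ (- alpha) * ridgev (S := S) i0 N sg x).
Proof.
move=> alpha0 alphaS eps0; have [C C0 hC] := ridge_coefs.
pose w : R := 2 `^ (J0%:R * (alpha + d%:R / 2)).
have w0 : 0 <= w by exact: powR_ge0.
have den0 : 0 < w * C + C + 1 by rewrite ltr_wpDl// addr_ge0// mulr_ge0.
exists (eps / (w * C + C + 1)); first exact: divr_gt0.
move=> N sg N0 sg1; set t := eps / _.
have t0 : 0 < t by exact: divr_gt0.
have Nr0 : 0 < N%:R :> R by rewrite ltr0n.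
have [hPhi hPsi] := hC N sg N0 sg1.
have bG : bm (ridgev (S := S) i0 N sg) by exact: bm_ridgev.
have Na1 : N%:R `^ (- alpha) <= 1 :> R.
  by rewrite -[leRHS](powRr0 N%:R) ler_powR ?ler1n// oppr_le0 ltW.
have tN0 : 0 <= t * N%:R `^ (- alpha) by rewrite mulr_ge0 ?powR_ge0// ltW.
have tNt : t * N%:R `^ (- alpha) <= t by rewrite ler_piMr// ltW.
have tE : t * (w * C + C + 1) = eps by rewrite /t divfK// gt_eqF.
clearbody t.
have dotE g : bm g -> dot unif (fun x => t * N%:R `^ (- alpha) * ridgev (S := S) i0 N sg x) g =
    t * N%:R `^ (- alpha) * dot unif (ridgev (S := S) i0 N sg) g.
  move=> bg; rewrite /dot -ExZ; last exact: bmM.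
  by congr (Ex _ _); apply/funext => x; rewrite mulrA.
split.
- by bmt.
- exact: ridgev_unif_continuous.
- move=> x; rewrite normrM ger0_norm// -[leRHS]mulr1 ler_pM//; last exact: ridgev_le1.
  by apply: (le_trans tNt); rewrite -tE ler_peMr ?(ltW t0)// lerDr addr_ge0// mulr_ge0.
exists (t * C), (t * C); split.
- by rewrite mulr_ge0// ltW.
- move=> m; rewrite dotE; last exact: (bm_Phi W_cdv m (leqnn _)).
  by rewrite normrM (ger0_norm tN0) ler_pM.
- move=> l em Jl; rewrite dotE; last exact: (bm_Psi W_cdv em.1 em.2 Jl).
  rewrite normrM (ger0_norm tN0).
  pose v : R := 2 `^ (l%:R * d%:R / 2); have v0 : 0 < v by exact: powR_gt0.
  have -> : 2 `^ (l%:R * (alpha + d%:R / 2)) = (2 ^+ l) `^ alpha * v.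
    rewrite /v -powR_mulrn// -powRrM -powRD ?pnatr_eq0 ?implybT//.
    by congr (_ `^ _); ring.
  set y := N%:R / 2 ^+ l : R.
  have y0 : 0 < y by rewrite divr_gt0// exprn_gt0.
  apply: (@le_trans _ _ ((2 ^+ l) `^ alpha * v * (t * N%:R `^ (- alpha) * (C * Num.min 1 (y ^+ S) * v^-1)))).
    by apply: ler_wpM2l; [rewrite mulr_ge0 ?powR_ge0 ?ltW|apply: ler_wpM2l => //; exact: hPsi].
  rewrite (_ : _ * _ * _ = t * C * ((2 ^+ l) `^ alpha * N%:R `^ (- alpha) * Num.min 1 (y ^+ S))); last first.
    by field; rewrite gt_eqF.
  have -> : (2 ^+ l) `^ alpha * N%:R `^ (- alpha) = y `^ (- alpha).
    rewrite /y powRM ?invr_ge0 ?exprn_ge0// mulrC -[in RHS]powR_inv1 ?exprn_ge0// -powRrM.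
    by rewrite mulN1r opprK.
  apply: ler_piMr; first by rewrite mulr_ge0// ltW.
  have [y1|y1] := leP 1 y.
    rewrite (min_idPl _); last by rewrite exprn_ege1.
    by rewrite mulr1 -[leRHS](powRr0 y) ler_powR// oppr_le0 ltW.
  rewrite (min_idPr _); last by rewrite exprn_ile1// ltW.
  rewrite -powR_mulrn ?(ltW y0)// -powRD ?(gt_eqF y0) ?implybT//.
  have p1 : 1 `^ (- alpha + S%:R) = 1 :> R by rewrite powR1.
  rewrite -[leRHS]p1; apply: ge0_ler_powR; rewrite ?nnegrE ?(ltW y0) ?(ltW y1)//.
  by rewrite addrC subr_ge0 ltW.
rewrite -/w -tE [leLHS](_ : _ = t * (w * C + C)); last by ring.
by rewrite ler_wpM2l ?(ltW t0)// lerDl.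
Qed.

Let mono0 : mono 0 = fun=> 1. Proof. by apply/funext => x; rewrite /mono expr0. Qed.

Lemma const_perturbation (alpha eps : R) : 0 < eps ->
  exists2 t : R, 0 < t & @perturbation R d J0 W alpha eps (fun=> t).
Proof.
move=> eps0; pose w : R := 2 `^ (J0%:R * (alpha + d%:R / 2)).
have w0 : 0 <= w by exact: powR_ge0.
have den0 : 0 < w + 1 by rewrite ltr_wpDl.
exists (eps / (w + 1)); first exact: divr_gt0.
set t := eps / _; have t0 : 0 < t by exact: divr_gt0.
have tE : t * (w + 1) = eps by rewrite /t divfK// gt_eqF.
clearbody t; have te : t <= eps by rewrite -tE ler_peMr ?(ltW t0)// lerDr.
have dotE g : bm g -> dot unif (fun=> t) g = t * dot unif (fun=> 1) g.
  by move=> bg; rewrite /dot -ExZ; [congr (Ex _ _); apply/funext => x; rewrite mul1r|bmt].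
split; [exact: bm_cst| |by move=> x; rewrite ger0_norm// ltW|].
  by move=> e e0; exists 1 => // x y _ _ _; rewrite subrr normr0.
exists t, 0; split; [exact: ltW| | |].
- move=> m; have bphi : bm (cPhi m) := bm_Phi W_cdv m (leqnn J0).
  have b1 : bm (fun _ : vec => 1 : R) by exact: bm_cst.
  rewrite dotE// normrM (gtr0_norm t0) ler_piMr ?(ltW t0)//.
  rewrite -(expr_le1 (n := 2))// real_normK ?num_real//.
  apply: (le_trans (dot_CS unif b1 bphi)).
  by rewrite (orthonormal_Phi W_cdv (leqnn J0)) eqxx mulr1 /dot mulr1 Ex_cst.
- move=> l em Jl; rewrite dotE; last exact: (bm_Psi W_cdv em.1 em.2 Jl).
  by rewrite -mono0 monomial_Psi// mulr0 normr0 mulr0.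
- by rewrite addr0 -/w -tE mulrC ler_wpM2l ?(ltW t0)// lerDl.
Qed.

(** Constants are in V_j, so the first two terms of the bias differ by 1/n only, while the diagonal of the kernel integrates to the dimension of V_j. *)
Lemma bias_const n j (t t' : R) : (J0 <= j)%N ->
  bias W n j (fun=> t) (fun=> t') = t * t' * ((1 - #|Zidx W j|%:R) / n%:R).
Proof.
move=> Jj; have bphi (m : Zidx W j) : bm (cPhi m) := bm_Phi W_cdv m Jj.
have b1 : bm (fun _ : vec => 1 : R) by exact: bm_cst.
have dotE (a : R) g : bm g -> dot unif (fun=> a) g = a * dot unif (fun=> 1) g.
  by move=> bg; rewrite /dot -ExZ; [congr (Ex _ _); apply/funext => x; rewrite mul1r|bmt].
have one : \sum_(m : Zidx W j) dot unif (fun=> 1) (cPhi m) ^+ 2 = 1.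
  have [c hc] := monomial_Phi Jj S1; rewrite mono0 in hc.
  have hd := ae_dot_coef bphi (orthonormal_Phi W_cdv Jj) b1 hc.
  transitivity (dot unif (fun=> 1) (fun=> 1)); last by rewrite /dot mulr1 Ex_cst.
  rewrite (ae_eq_dot b1 (bm_lincomb bphi _) b1 hd) dot_suml//.
  by apply: eq_bigr => m _; rewrite [dot _ (cPhi m) _]dotC expr2.
rewrite /bias.
have -> : \sum_(m : Zidx W j) dot unif (fun=> t) (cPhi m) * dot unif (fun=> t') (cPhi m) = t * t'.
  rewrite -[RHS]mulr1 -one mulr_sumr; apply: eq_bigr => m _.
  by rewrite (dotE t)// (dotE t')//; ring.
have -> : Ex unif (fun x => t * t' * \sum_(m : Zidx W j) cPhi m x ^+ 2) = t * t' * #|Zidx W j|%:R.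
  rewrite ExZ; last by bmt.
  rewrite Ex_sum; last by move=> m; bmt.
  congr (_ * _); rewrite (eq_bigr (fun=> 1)) ?sumr_const// => m _.
  by rewrite -dotff (orthonormal_Phi W_cdv Jj) eqxx.
by rewrite /dot Ex_cst; ring.
Qed.

Lemma biasZ n j (a b : R) (p q : vec -> R) : (J0 <= j)%N -> bm p -> bm q ->
  bias W n j (fun x => a * p x) (fun x => b * q x) = a * b * bias W n j p q.
Proof.
move=> Jj bp bq; have bphi (m : Zidx W j) : bm (cPhi m) := bm_Phi W_cdv m Jj.
have dotE (c : R) f g : bm f -> bm g -> dot unif (fun x => c * f x) g = c * dot unif f g.
  move=> bf bg; rewrite /dot -ExZ; last exact: bmM.
  by congr (Ex _ _); apply/funext => x; rewrite mulrA.
rewrite /bias dotE//; last by bmt.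
rewrite dotC dotE// dotC.
have -> : \sum_(m : Zidx W j) dot unif (fun x => a * p x) (cPhi m) * dot unif (fun x => b * q x) (cPhi m) =
    a * b * \sum_(m : Zidx W j) dot unif p (cPhi m) * dot unif q (cPhi m).
  by rewrite mulr_sumr; apply: eq_bigr => m _; rewrite !dotE//; ring.
have -> : (fun x => a * p x * (b * q x) * \sum_(m : Zidx W j) cPhi m x ^+ 2) =
    (fun x => a * b * (p x * q x * \sum_(m : Zidx W j) cPhi m x ^+ 2)).
  by apply/funext => x; ring.
by rewrite ExZ; [ring|bmt].
Qed.

(** The squared norm of the ridge is bounded below; its energy is a quarter of this bound for r large, and so is the diagonal term as soon as k/n is small. *)
Lemma ridge_bias : exists r, exists2 delta : R, 0 < delta & exists2 c : R, 0 < c &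
  forall n j, (0 < n)%N -> (J0 <= j)%N -> @scale R d j <= delta * n%:R ->
  exists2 sg : nat -> R, (forall q, `|sg q| = 1) &
    c <= bias W n j (ridgev (S := S) i0 (2 ^ (j + r)) sg) (ridgev (S := S) i0 (2 ^ (j + r)) sg).
Proof.
have [C C0 hC] := ridge_energy i0 W_cdv S1.
have [K K1 hK] := wavelet_kernel_const W_cdv.
have K0 : 0 < K by apply: lt_le_trans K1.
pose c : R := (3 / 16) ^+ S ^+ 2 / 2.
have c0 : 0 < c by rewrite divr_gt0// !exprn_gt0// divr_gt0.
(* r is such that the energy bound C 2^j / 2^(j+r) is at most c / 4. *)
pose r := (Num.truncn (4 * C / c)).+1; exists r.
have r_large : 4 * C / c < 2 ^+ r.
  have /andP[_ h] := truncn_itv (ltW (divr_gt0 (mulr_gt0 (ltr0n _ 4) C0) c0)).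
  by apply: (lt_le_trans h); rewrite -natrX ler_nat ltnW// ltn_expl.
exists (c / (4 * K)); first by rewrite divr_gt0// mulr_gt0.
exists (c / 2); first exact: divr_gt0.
move=> n j n0 Jj kn; have N0 : (0 < 2 ^ (j + r))%N by rewrite expn_gt0.
have nr0 : 0 < n%:R :> R by rewrite ltr0n.
have [sg sg1 hE] := hC j _ Jj N0; exists sg => //.
set G := ridgev _ _ sg in hE *; have bG : bm G by exact: bm_ridgev.
have bphi (m : Zidx W j) : bm (cPhi m) := bm_Phi W_cdv m Jj.
have G2 : c <= dot unif G G by exact: ridgev_norm_ge.
have E1 : @energy R d W G j <= c / 4.
  apply: (le_trans hE); have -> : 2 ^+ j / (2 ^ (j + r))%:R = (2 ^+ r)^-1 :> R.
    by rewrite natrX exprD; field; rewrite !expf_neq0.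
  rewrite ler_pdivrMr ?exprn_gt0//; move: r_large; rewrite ltr_pdivrMr//.
  by move: (2 ^+ r : R) => z; lra.
have E0 : 0 <= @energy R d W G j by apply: sumr_ge0 => m _; exact: sqr_ge0.
have D1 : n%:R^-1 * Ex unif (fun x => G x * G x * \sum_(m : Zidx W j) cPhi m x ^+ 2) <= c / 4.
  rewrite mulrC ler_pdivrMr//; apply: (@le_trans _ _ (K * @scale R d j)).
    rewrite -[leRHS](Ex_cst unif); apply: le_Ex; [by bmt|exact: bm_cst|] => x.
    have s0 : 0 <= \sum_(m : Zidx W j) cPhi m x ^+ 2 by apply: sumr_ge0 => m _; exact: sqr_ge0.
    have := (hK j Jj).1 x x; rewrite (eq_bigr (fun m => cPhi m x ^+ 2)) => [|m _]; last by rewrite expr2.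
    rewrite ger0_norm// => h; apply: le_trans h; rewrite ler_piMl// -expr2.
    by rewrite -real_normK ?num_real// expr_le1 ?ridgev_le1.
  apply: (le_trans (ler_wpM2l (ltW K0) kn)).
  by rewrite le_eqVlt; apply/orP; left; apply/eqP; field; rewrite gt_eqF.
have -> : bias W n j G G = dot unif G G - (1 - n%:R^-1) * @energy R d W G j -
    n%:R^-1 * Ex unif (fun x => G x * G x * \sum_(m : Zidx W j) cPhi m x ^+ 2).
  by rewrite /bias; congr (_ - _ * _ - _); apply: eq_bigr => m _; rewrite expr2.
have h2 : (1 - n%:R^-1) * @energy R d W G j <= @energy R d W G j.
  by rewrite ler_piMl// gerBl invr_ge0.
move: D1 h2 E1 G2; move: (n%:R^-1 * Ex unif _) ((1 - _) * energy G j) => x y.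
by move: (energy G j) (dot unif G G) => *; lra.
Qed.

End smoothness.

(** * The lower rate *)

Section npow_comparison.
Context {R : realType}.

Lemma npow_large (e x : R) : 0 < e -> exists n0, forall n, (n0 <= n)%N -> x <= n%:R `^ e.
Proof.
move=> e0; pose y := Num.max x 1; have y0 : 0 < y by rewrite lt_max ltr01 orbT.
exists (Num.truncn (y `^ e^-1)).+1 => n hn.
apply: (@le_trans _ _ y); first by rewrite le_max lexx.
have -> : y = (y `^ e^-1) `^ e by rewrite -powRrM mulVf ?gt_eqF// powRr1// ltW.
apply: ge0_ler_powR; rewrite ?nnegrE ?powR_ge0 ?(ltW e0)//.
have /andP[_ h] := truncn_itv (powR_ge0 y e^-1).
by apply: (le_trans (ltW h)); rewrite ler_nat.
Qed.

Lemma npow_not_lesssim (a b : R) : a < b -> ~ lesssim (npow (- a)) (npow (- b)).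
Proof.
move=> ab /lesssimP[C [n0 [C0 h]]].
have [n1 h1] := @npow_large (b - a) (C + 1) (ltac:(by rewrite subr_gt0)).
pose n := (maxn 1 (maxn n0 n1)).
have n_gt0 : (0 < n)%N by rewrite leq_max.
have nr0 : 0 < n%:R :> R by rewrite ltr0n.
have := h1 n; rewrite !leq_max leqnn !orbT => /(_ isT).
have := h n; rewrite !leq_max leqnn !orbT => /(_ isT) h2.
have : n%:R `^ (b - a) <= C.
  rewrite powRD ?(gt_eqF nr0) ?implybT// mulrC.
  apply: (le_trans (ler_wpM2r (powR_ge0 _ _) h2)).
  by rewrite -mulrA -powRD ?(gt_eqF nr0) ?implybT// addNr powRr0 mulr1.
lra.
Qed.

End npow_comparison.

Section lower_rate.
Context {R : realType} {d S J0 : nat} {W : wavelet_system R d}.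
Variables (alpha beta M C1 C2 : R).
Hypotheses (d_gt0 : (0 < d)%N) (S_ge1 : (1 <= S)%N).
Hypotheses (alpha0 : 0 < alpha) (beta0 : 0 < beta).
Hypotheses (alphaS : alpha < S%:R) (betaS : beta < S%:R).
Hypotheses (W_cdv : cdv_basis S J0 W).
Local Notation s := (alpha + beta).
Local Notation dd := (d%:R : R).
Local Notation scale := (@scale R d).
Let i0 : 'I_d := Ordinal d_gt0.
Let s0 : 0 < s. Proof. exact: addr_gt0. Qed.
Let d0 : 0 < dd. Proof. by rewrite ltr0n. Qed.

(** The property shared by INT and MC from which the lower bound is derived. *)
Definition risk_ge_bias (T : estimator R d) := forall (p b : vec R d -> R) (a1 a2 : R) n j1 j2
  (bp : bm p) (bb : bm b), (forall x, a1 <= p x <= a2) -> (forall x, a1 <= b x <= a2) ->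
  (0 < n)%N -> (J0 <= j1)%N -> (J0 <= j2)%N ->
  ((bias W n (minn j1 j2) p b ^+ 2)%:E <= mse (graph_law bp bb) (@T j1 j2 n))%E.

Variable T : estimator R d.
Hypothesis T_bias : risk_ge_bias T.
Hypothesis nondeg : nondegenerate_model J0 W alpha beta M C1 C2.
Local Notation risk := (max_risk J0 W alpha beta M C1 C2 T).

(** Ridges of frequency 2^(j+r), scaled by that frequency to the powers -alpha and -beta, give the first inequality; constants give the second. *)
Lemma risk_bounds : exists c delta k0 : R, [/\ 0 < c, 0 < delta & forall j1 j2 n,
  levels J0 j1 j2 -> (0 < n)%N ->
  (scale (minn (j1 n) (j2 n)) <= delta * n%:R ->
    (((c * scale (minn (j1 n) (j2 n)) `^ (- (s / dd))) ^+ 2)%:E <= risk j1 j2 n)%E) /\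
  (k0 <= scale (minn (j1 n) (j2 n)) ->
    (((c * (scale (minn (j1 n) (j2 n)) / n%:R)) ^+ 2)%:E <= risk j1 j2 n)%E)].
Proof.
have [eps [eps0 [p0 hp0 rp0] [b0 hb0 rb0]]] := nondeg.
have [r [delta delta0 [c c0 hridge]]] := @ridge_bias _ _ _ _ _ i0 W_cdv S_ge1.
have [t t0 ht] := ridge_perturbation i0 W_cdv S_ge1 alpha0 alphaS eps0.
have [t' t'0 ht'] := ridge_perturbation i0 W_cdv S_ge1 beta0 betaS eps0.
have [u u0 hu] := const_perturbation i0 W_cdv S_ge1 alpha eps0.
have [u' u'0 hu'] := const_perturbation i0 W_cdv S_ge1 beta eps0.
have [cz [cz' [cz0 hcard]]] := card_Zidx W_cdv.
have r0 : 0 < (2 ^+ r : R) `^ (- s) by rewrite powR_gt0// exprn_gt0.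
pose a := t * t' * c * (2 ^+ r) `^ (- s) / 4.
have a0 : 0 < a by rewrite divr_gt0// !mulr_gt0.
pose e := u * u' * cz / 8.
have e0 : 0 < e by rewrite divr_gt0// !mulr_gt0.
have min_le x y : Num.min x y <= x :> R by rewrite ge_min lexx.
have min_le' x y : Num.min x y <= y :> R by rewrite ge_min lexx orbT.
have m0 : 0 < Num.min a e by rewrite lt_min a0.
(* Above the resolution 2 / cz the dimension of V_j minus one is at least cz / 2 times the resolution. *)
exists (Num.min a e), delta, (2 / cz); split=> // j1 j2 n J12 n0.
set j := minn (j1 n) (j2 n).
have Jj : (J0 <= j)%N by rewrite /j leq_min (J12 n).1 (J12 n).2.
have nr0 : 0 < n%:R :> R by rewrite ltr0n.
have Tb p b (bp : bm p) (bb : bm b) rp rb : ((bias W n j p b ^+ 2)%:E <= mse (graph_law bp bb) (@T (j1 n) (j2 n) n))%E :=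
  @T_bias p b C1 C2 n (j1 n) (j2 n) bp bb rp rb n0 (J12 n).1 (J12 n).2.
have lower h h' x : @perturbation R d J0 W alpha eps h -> @perturbation R d J0 W beta eps h' ->
    0 <= x -> x <= `|bias W n j h h' / 4| -> ((x ^+ 2)%:E <= risk j1 j2 n)%E.
  move=> ph ph' x0 hx.
  have := max_risk_ge (T := T) (j1 := j1) (j2 := j2) (n := n) W_cdv hp0 hb0 rp0 rb0 (ltW eps0) ph ph' Jj Tb.
  apply: le_trans; rewrite lee_fin -[leRHS]real_normK ?num_real//.
  by rewrite ler_sqr ?nnegrE.
have k0 : 0 < scale j by exact: scale_gt0.
split=> [kn|k_large].
  have [sg sg1 hb] := hridge n j n0 Jj kn.
  have N0 : (0 < 2 ^ (j + r))%N by rewrite expn_gt0.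
  apply: (lower _ _ _ (ht _ sg N0 sg1) (ht' _ sg N0 sg1)).
    by rewrite mulr_ge0 ?powR_ge0// ltW.
  have bG := @bm_ridgev R d S i0 (2 ^ (j + r)) sg.
  rewrite (biasZ W_cdv)//; set B := bias _ _ _ _ _ in hb *.
  have Ns : (2 ^ (j + r))%:R `^ (- alpha) * (2 ^ (j + r))%:R `^ (- beta) =
      scale j `^ (- (s / dd)) * (2 ^+ r) `^ (- s) :> R.
    rewrite -powRD; last by rewrite pnatr_eq0 gtn_eqF ?implybT.
    rewrite natrX exprD powRM ?exprn_ge0// -opprD; congr (_ * _).
    rewrite -[scale j]/(2 ^+ (j * d)) exprM -[(2 ^+ j) ^+ d]powR_mulrn ?exprn_ge0// -powRrM; congr (_ `^ _).
    by field; rewrite gt_eqF.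
  rewrite (_ : _ * B = t * t' * (scale j `^ (- (s / dd)) * (2 ^+ r) `^ (- s)) * B); last first.
    by rewrite -Ns; ring.
  rewrite ger0_norm; last first.
    by rewrite divr_ge0// !mulr_ge0 ?powR_ge0 ?ltW// (lt_le_trans c0).
  apply: (@le_trans _ _ (a * scale j `^ (- (s / dd)))); first by rewrite ler_wpM2r ?powR_ge0.
  rewrite /a (_ : _ * _ = t * t' * (scale j `^ (- (s / dd)) * (2 ^+ r) `^ (- s)) * c / 4); last by field.
  by rewrite ler_pM2r ?invr_gt0// ler_wpM2l// !mulr_ge0 ?powR_ge0 ?ltW.
apply: (lower _ _ _ hu hu'); first by rewrite mulr_ge0 ?divr_ge0// ltW.
rewrite (bias_const _ W_cdv S_ge1)//.
have hc : cz * scale j <= #|Zidx W j|%:R by have /andP[] := hcard j Jj.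
have k2 : 2 <= cz * scale j by move: k_large; rewrite ler_pdivrMr// mulrC.
have z1 : cz * scale j / 2 <= #|Zidx W j|%:R - 1 by lra.
rewrite (_ : _ / 4 = - (u * u' * ((#|Zidx W j|%:R - 1) / n%:R) / 4)); last by field; rewrite gt_eqF.
rewrite normrN ger0_norm; last first.
  rewrite divr_ge0// !mulr_ge0 ?invr_ge0 ?ltW// (lt_le_trans _ z1)//.
  by rewrite divr_gt0// mulr_gt0.
apply: (@le_trans _ _ (e * (scale j / n%:R))); first by rewrite ler_wpM2r// divr_ge0// ltW.
rewrite /e (_ : _ * (scale j / _) = u * u' * ((cz * scale j / 2) / n%:R) / 4); last by field; rewrite gt_eqF.
rewrite ler_pM2r ?invr_gt0//; apply: ler_wpM2l; first by rewrite mulr_ge0// ltW.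
by rewrite ler_pM2r ?invr_gt0.
Qed.

(** The resolution n^(d/(s+d)) balances the two lower bounds: k^(-s/d) is at least n^(-s/(s+d)) below it, and k/n above it. *)
Lemma risk_lower_rate j1 j2 : levels J0 j1 j2 ->
  lesssim (npow (- (2 * s / (s + dd)))) (risk j1 j2).
Proof.
move=> J12; have [c [delta [k0 [c0 delta0 h]]]] := risk_bounds.
have sd0 : 0 < s + dd by exact: addr_gt0.
have [n1 h1] := npow_large delta^-1 (divr_gt0 s0 sd0).
have [n2 h2] := npow_large k0 (divr_gt0 d0 sd0).
exists (c ^- 2), (maxn 1 (maxn n1 n2)); split; first by rewrite invr_gt0 exprn_gt0.
move=> n; rewrite !geq_max => /and3P[n0 /h1 hn1 /h2 hn2].
have nr0 : 0 < n%:R :> R by rewrite ltr0n.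
set x : R := n%:R `^ (- (s / (s + dd))).
have kE : n%:R `^ (dd / (s + dd)) = n%:R * x.
  transitivity (n%:R `^ 1 * x); last by rewrite powRr1// ltW.
  rewrite /x -powRD ?(gt_eqF nr0) ?implybT//.
  by congr (_ `^ _); field; rewrite gt_eqF.
have xE : n%:R `^ (- (2 * s / (s + dd))) = x ^+ 2.
  by rewrite /x -powR_mulrn ?powR_ge0// -powRrM; congr (_ `^ _); field; rewrite gt_eqF.
have x0 : 0 < x by exact: powR_gt0.
suff hx : (((c * x) ^+ 2)%:E <= risk j1 j2 n)%E.
  rewrite /npow xE.
  have -> : (x ^+ 2)%:E = ((c ^- 2)%:E * ((c * x) ^+ 2)%:E)%E.
    by rewrite -EFinM; congr (_%:E); rewrite exprMn mulKf// expf_neq0// gt_eqF.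
  by rewrite lee_pmul2l ?fin_numE// lte_fin invr_gt0 exprn_gt0.
have [hsmall hlarge] := h j1 j2 n J12 n0.
set k := scale _ in hsmall hlarge.
have k_gt0 : 0 < k by exact: scale_gt0.
have sq y : x <= y -> (((c * y) ^+ 2)%:E <= risk j1 j2 n)%E -> (((c * x) ^+ 2)%:E <= risk j1 j2 n)%E.
  move=> xy; have y0 := lt_le_trans x0 xy; apply: le_trans; rewrite lee_fin; apply: lerXn2r.
  - by rewrite nnegrE mulr_ge0// ltW.
  - by rewrite nnegrE mulr_ge0// ltW.
  - by rewrite ler_pM2l.
have [kk|kk] := leP k (n%:R `^ (dd / (s + dd))).
  apply: sq (hsmall _).
    rewrite /x -[s / (s + dd)](_ : dd / (s + dd) * (s / dd) = _); last first.
      by field; rewrite !gt_eqF.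
    rewrite -mulrN powRrM; apply: powR_anti kk _ => //.
    by rewrite divr_ge0// ltW.
  apply: (le_trans kk); rewrite kE mulrC ler_wpM2r ?(ltW nr0)//.
  rewrite /x powRN -[leRHS]invrK lef_pV2 ?posrE ?invr_gt0 ?powR_gt0//.
apply: sq (hlarge _); last exact: (le_trans hn2 (ltW kk)).
by rewrite ler_pdivlMr// mulrC -kE ltW.
Qed.

End lower_rate.

(** * The corollary *)

Section dyadic_levels.
Context {R : realType} (d J0 : nat) (e : R).
Hypothesis e0 : 0 < e.

(** The level of the dyadic resolution nearest below n^(d e), but at least the coarsest level of the basis. *)
Definition dyadic_level n := maxn J0 (trunc_log 2 (Num.truncn ((n%:R : R) `^ e))).

Lemma dyadic_level_ge n : (J0 <= dyadic_level n)%N.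
Proof. exact: leq_maxl. Qed.

Lemma dyadic_level_bounds n : (0 < n)%N ->
  n%:R `^ e <= 2 * 2 ^+ dyadic_level n /\ 2 ^+ dyadic_level n <= 2 ^+ J0 * n%:R `^ e :> R.
Proof.
move=> n0; set x : R := n%:R `^ e; have x1 : 1 <= x.
  by rewrite -[leLHS](powRr0 (n%:R : R)) ler_powR ?ler1n// ltW.
have /andP[h1 h2] := truncn_itv (le_trans ler01 x1).
have t0 : (0 < Num.truncn x)%N.
  by rewrite lt0n; apply: contraTneq x1 => t0; rewrite -ltNge; rewrite t0 in h2.
have /andP[h3 h4] := trunc_log_bounds (ltnSn 1) t0.
have h3' : 2 ^+ trunc_log 2 (Num.truncn x) <= x by rewrite -natrX (le_trans _ h1)// ler_nat.
have h4' : x <= 2 * 2 ^+ trunc_log 2 (Num.truncn x).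
  by rewrite -exprS -natrX (le_trans (ltW h2))// ler_nat.
split.
  by apply: (le_trans h4'); rewrite ler_pM2l// ler_weXn2l ?ler1n// leq_maxr.
rewrite /dyadic_level -/x; case: (leqP J0 (trunc_log 2 (Num.truncn x))) => _.
  by apply: (le_trans h3'); rewrite ler_peMl ?(le_trans ler01)// exprn_ege1// ler1n.
by rewrite ler_peMr ?exprn_ge0.
Qed.

Lemma dyadic_level_scale : asymp (EFin \o (fun n => @scale R d (dyadic_level n))) (npow (d%:R * e)).
Proof.
have xd n : (n%:R : R) `^ (d%:R * e) = (n%:R `^ e) ^+ d.
  by rewrite -powR_mulrn ?powR_ge0// -powRrM mulrC.
split.
  exists ((2 ^+ J0) ^+ d), 1%N; split; first by rewrite !exprn_gt0.
  move=> n n0; rewrite /npow xd -EFinM lee_fin -exprMn /scale exprM.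
  have [_ h] := dyadic_level_bounds n0.
  by rewrite lerXn2r ?nnegrE ?mulr_ge0 ?exprn_ge0 ?powR_ge0.
exists (2 ^+ d), 1%N; split; first by rewrite exprn_gt0.
move=> n n0; rewrite /npow xd /= -EFinM lee_fin /scale exprM -exprMn.
have [h _] := dyadic_level_bounds n0.
by rewrite lerXn2r ?nnegrE ?mulr_ge0 ?exprn_ge0 ?powR_ge0.
Qed.

End dyadic_levels.

Theorem corollary4 (R : realType) (d S J0 : nat) (W : wavelet_system R d)
    (alpha beta M C1 C2 : R)
    (d_gt0 : (0 < d)%N) (S_ge1 : (1 <= S)%N)
    (alpha_gt0 : 0 < alpha) (beta_gt0 : 0 < beta) (M_gt0 : 0 < M)
    (S_gt : Num.max alpha beta < S%:R) (J0_ge : (S <= 2 ^ J0)%N)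
    (W_cdv : cdv_basis S J0 W) :
  let s := alpha + beta in
  let dd : R := d%:R in
  let risk := max_risk J0 W alpha beta M C1 C2 in
  let INT := risk (psi_INT W) in
  let MC := risk (psi_MC W) in
  let IF := risk (psi_IF W) in
  let rstar := minimax_rate d alpha beta in
  let kmn := @kmin R d in
  let kmx := @kmax R d in
  let slow : nat -> \bar R :=
    npow (- ((2 * alpha + 2 * beta) / (alpha + beta + dd))) in
  (dd / 2 <= s / 2 ->
     [/\ forall j1 j2, levels J0 j1 j2 ->
           lesssim (npow (dd / (2 * alpha + 2 * beta))) (kmn j1 j2) ->
           lesssim (kmn j1 j2) nsqrt ->
           lesssim (INT j1 j2) rstar,
         forall j1 j2, levels J0 j1 j2 ->
           lesssim (npow (dd / (2 * alpha + 2 * beta))) (kmn j1 j2) ->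
           lesssim (kmn j1 j2) nsqrt ->
           lesssim (kmx j1 j2) (npow 1) ->
           lesssim (MC j1 j2) rstar
       & forall j1 j2, levels J0 j1 j2 ->
           lesssim (kmn j1 j2) nsqrt ->
           lesssim (npow (dd / (2 * alpha + 2 * beta))) (kmx j1 j2) ->
           lesssim (kmx j1 j2) (npow 1) ->
           lesssim (IF j1 j2) rstar])
  /\
  (s / 2 < dd / 2 ->
     [/\ [/\ nondegenerate_model J0 W alpha beta M C1 C2 ->
               forall j1 j2, levels J0 j1 j2 -> ~ lesssim (INT j1 j2) rstar,
             nondegenerate_model J0 W alpha beta M C1 C2 -> best_rate J0 INT slow
           & forall j1 j2, levels J0 j1 j2 ->
               asymp (kmn j1 j2) (npow (dd / (alpha + beta + dd))) ->
               lesssim (INT j1 j2) slow],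
         [/\ nondegenerate_model J0 W alpha beta M C1 C2 ->
               forall j1 j2, levels J0 j1 j2 -> ~ lesssim (MC j1 j2) rstar,
             nondegenerate_model J0 W alpha beta M C1 C2 -> best_rate J0 MC slow
           & forall j1 j2, levels J0 j1 j2 ->
               asymp (kmn j1 j2) (npow (dd / (alpha + beta + dd))) ->
               lesssim (kmx j1 j2) (npow (2 * dd / (alpha + beta + dd))) ->
               lesssim (MC j1 j2) slow]
       & (dd / 4 <= s / 2 ->
            forall j1 j2, levels J0 j1 j2 ->
              lesssim (kmn j1 j2) nsqrt ->
              lesssim (npow (dd / (2 * alpha + 2 * beta))) (kmx j1 j2) ->
              lesssim (kmx j1 j2) (npow 1) ->
              lesssim (IF j1 j2) rstar)
         /\
         (s / 2 < dd / 4 ->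
            forall j1 j2, levels J0 j1 j2 ->
              lesssim (kmn j1 j2)
                (npow (dd / (2 * alpha + 2 * beta + dd))) ->
              asymp (kmx j1 j2)
                (npow (2 * dd / (2 * alpha + 2 * beta + dd))) ->
              lesssim (IF j1 j2) rstar)]).

Proof.
move=> s dd risk INT MC IF rstar kmn kmx slow.
have dd0 : 0 < dd by rewrite ltr0n.
have s0 : 0 < s by exact: addr_gt0.
have [alphaS betaS] : alpha < S%:R /\ beta < S%:R by move: S_gt; rewrite gt_max => /andP.
have s2 : 2 * alpha + 2 * beta = 2 * s by rewrite /s; ring.
have sd0 : 0 < s + dd by exact: addr_gt0.
have s2d0 : 0 < 2 * s + dd by rewrite addr_gt0// mulr_gt0.
have slowE : slow = npow (- (2 * s / (s + dd))) by rewrite /slow s2.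
have M0 := ltW M_gt0.
have rstar_fast : dd / 4 <= s / 2 -> rstar = npow (- 1).
  by move=> h; rewrite /rstar /minimax_rate -/s -/dd h.
have rstar_slow : s / 2 < dd / 4 -> rstar = npow (- (4 * s / (2 * s + dd))).
  move=> h; have hf : (d%:R / 4 <= (alpha + beta) / 2) = false by apply/negbTE; rewrite -ltNge.
  rewrite /rstar /minimax_rate hf s2.
  by have -> : 4 * alpha + 4 * beta = 4 * s by rewrite /s; ring.
have exp1 : 1 <= 2 * s * (dd / (2 * s)) / dd.
  by rewrite le_eqVlt; apply/orP; left; apply/eqP; field; rewrite !gt_eqF.
have slow_exp : 2 * s / (s + dd) <= 2 * s * (dd / (s + dd)) / dd.
  by rewrite le_eqVlt; apply/orP; left; apply/eqP; field; rewrite !gt_eqF.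
have slow_exp2 : 2 * s / (s + dd) = 2 - 2 * (dd / (s + dd)) by field; rewrite gt_eqF.
have bd1 : dd / (s + dd) <= 1 by rewrite ler_pdivrMr// mul1r lerDr ltW.
have half1 : 1 / 2 <= 1 :> R by lra.
have half2 : 1 <= 2 - 2 * (1 / 2) :> R by lra.
have one2 : 1 <= 2 - 1 :> R by lra.
have INT_slow j1 j2 : s < dd -> levels J0 j1 j2 ->
    asymp (kmn j1 j2) (npow (dd / (alpha + beta + dd))) -> lesssim (INT j1 j2) slow.
  move=> sd J12 [hi lo]; rewrite slowE.
  apply: (INT_upper_rate d_gt0 _ _ W_cdv alpha_gt0 beta_gt0 M0 J12 _ _ _ lo hi) => //.
    by rewrite ler_pdivrMr// mul1r -/s; lra.
  by rewrite slow_exp2.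
have MC_slow j1 j2 : s < dd -> levels J0 j1 j2 ->
    asymp (kmn j1 j2) (npow (dd / (alpha + beta + dd))) ->
    lesssim (kmx j1 j2) (npow (2 * dd / (alpha + beta + dd))) -> lesssim (MC j1 j2) slow.
  move=> sd J12 [hi lo] mx; rewrite slowE.
  apply: (MC_upper_rate d_gt0 _ _ W_cdv alpha_gt0 beta_gt0 M0 J12 _ _ _ _ _ lo hi mx) => //.
  - by rewrite ler_pdivrMr// mul1r -/s; lra.
  - by rewrite slow_exp2 -/s mulrA.
  - by rewrite slow_exp2.
have IF_fast j1 j2 : dd / 4 <= s / 2 -> levels J0 j1 j2 ->
    lesssim (kmn j1 j2) nsqrt -> lesssim (npow (dd / (2 * alpha + 2 * beta))) (kmx j1 j2) ->
    lesssim (kmx j1 j2) (npow 1) -> lesssim (IF j1 j2) rstar.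
  move=> hs J12; rewrite nsqrtE rstar_fast// s2 => mn lo hi.
  exact: (IF_upper_rate d_gt0 _ _ W_cdv alpha_gt0 beta_gt0 M0 J12 _ _ _ _ _ mn lo hi).
have slow_rstar : s / 2 < dd / 2 -> ~ lesssim slow rstar.
  move=> sd; have [hs|hs] := leP (dd / 4) (s / 2).
    rewrite slowE rstar_fast//; apply: npow_not_lesssim.
    by rewrite ltr_pdivrMr// mul1r; lra.
  rewrite slowE rstar_slow//; apply: npow_not_lesssim.
  rewrite ltr_pdivrMr// mulrAC ltr_pdivlMr//.
  by nra.
have T_INT : @risk_ge_bias R d J0 W (psi_INT W).
  by move=> p b a1 a2 n j1 j2 bp bb rp rb n0 J1 J2; exact: (mse_INT_ge W_cdv bp bb rp rb n0 J1 J2).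
have T_MC : @risk_ge_bias R d J0 W (psi_MC W).
  by move=> p b a1 a2 n j1 j2 bp bb rp rb n0 J1 J2; exact: (mse_MC_ge W_cdv bp bb rp rb n0 J1 J2).
have lowINT j1 j2 : nondegenerate_model J0 W alpha beta M C1 C2 -> levels J0 j1 j2 -> lesssim slow (INT j1 j2).
  by move=> nd J12; rewrite slowE; exact: (risk_lower_rate d_gt0 S_ge1 alpha_gt0 beta_gt0 alphaS betaS W_cdv T_INT nd J12).
have lowMC j1 j2 : nondegenerate_model J0 W alpha beta M C1 C2 -> levels J0 j1 j2 -> lesssim slow (MC j1 j2).
  by move=> nd J12; rewrite slowE; exact: (risk_lower_rate d_gt0 S_ge1 alpha_gt0 beta_gt0 alphaS betaS W_cdv T_MC nd J12).
(* Both resolutions of the order n^(d/(s+d)) attain the slow rate, for INT as for MC. *)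
pose jj := dyadic_level J0 (s + dd)^-1.
have Jjj : levels J0 jj jj by move=> n; split; exact: dyadic_level_ge.
have [jhi jlo] := dyadic_level_scale d J0 (ltac:(by rewrite invr_gt0) : 0 < (s + dd)^-1).
have kmnE : kmn jj jj = EFin \o (fun n => @scale R d (jj n)).
  by rewrite /kmn kminE; congr (_ \o _); apply/funext => n; rewrite minnn.
have kmxE : kmx jj jj = EFin \o (fun n => @scale R d (jj n)).
  by rewrite /kmx kmaxE; congr (_ \o _); apply/funext => n; rewrite maxnn.
have kmx_jj : lesssim (kmx jj jj) (npow (2 * dd / (s + dd))).
  rewrite kmxE; apply: lesssim_trans jhi _; exists 1, 1%N; split=> // n n0.
  rewrite mul1e lee_fin; apply: ler_powR; first by rewrite ler1n.
  by rewrite -mulrA -/dd ler_peMl ?ler1n// divr_ge0// ltW.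
split=> sd.
  have sd4 : dd / 4 <= s / 2 by lra.
  split=> [j1 j2 J12|j1 j2 J12|j1 j2 J12]; rewrite ?nsqrtE ?rstar_fast ?s2//.
  - move=> lo hi.
    exact: (INT_upper_rate d_gt0 _ _ W_cdv alpha_gt0 beta_gt0 M0 J12 _ _ _ lo hi).
  - move=> lo hi mx.
    exact: (MC_upper_rate d_gt0 _ _ W_cdv alpha_gt0 beta_gt0 M0 J12 _ _ _ _ _ lo hi mx).
  - rewrite -nsqrtE -rstar_fast// -s2; exact: IF_fast.
have sd' : s < dd by lra.
split.
- split=> [nd j1 j2 J12 opt|nd|j1 j2]; last exact: INT_slow.
    by apply: (slow_rstar sd); exact: lesssim_trans (lowINT _ _ nd J12) opt.
  split; last by move=> j1 j2; exact: lowINT.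
  by exists jj, jj; split=> //; apply: INT_slow => //; rewrite kmnE.
- split=> [nd j1 j2 J12 opt|nd|j1 j2]; last exact: MC_slow.
    by apply: (slow_rstar sd); exact: lesssim_trans (lowMC _ _ nd J12) opt.
  split; last by move=> j1 j2; exact: lowMC.
  by exists jj, jj; split=> //; apply: MC_slow => //; rewrite kmnE.
split=> [hs j1 j2|hs j1 j2 J12]; first exact: IF_fast.
rewrite s2 rstar_slow// => mn [hi lo].
apply: (IF_upper_rate d_gt0 _ _ W_cdv alpha_gt0 beta_gt0 M0 J12 _ _ _ _ _ mn lo hi).
- by rewrite ler_pdivrMr// mul1r; lra.
- by rewrite ler_pdivrMr// mul1r lerDr mulr_ge0// ltW.
- by rewrite le_eqVlt; apply/orP; left; apply/eqP; field; rewrite gt_eqF.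
- by rewrite le_eqVlt; apply/orP; left; apply/eqP; field; rewrite gt_eqF.
- by rewrite le_eqVlt; apply/orP; left; apply/eqP; rewrite -/s; field; rewrite !gt_eqF.
Qed.
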